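(* Let $\lambda=\lambda_1\omega_1+\lambda_2\omega_2\in\Lambda$ and $\beta=\beta_1\alpha_1+\beta_2\alpha_2\in Q$ (so $\lambda_1,\lambda_2,\beta_1,\beta_2\in\mathbf{Z}$). For $k=1,\dots,33$ let $\mathfrak{c}_k\subseteq\mathbf{R}^4$ be the cone of all $(\lambda_1,\lambda_2,\beta_1,\beta_2)$ satisfying the inequalities listed under $\mathfrak{c}_k$ in the first list below, and let $f_k$ be the quasi-polynomial in the second list below. Then for every $k\in\{1,\dots,33\}$ and all integers $\lambda_1,\lambda_2,\beta_1,\beta_2$ with $(\lambda_1,\lambda_2,\beta_1,\beta_2)\in\mathfrak{c}_k$, $$K^\lambda_\beta=f_k(\lambda_1,\lambda_2,\beta_1,\beta_2),$$ and $K^\lambda_\beta=0$ whenever $(\lambda_1,\lambda_2,\beta_1,\beta_2)\notin\bigcup_{k=1}^{33}\mathfrak{c}_k$. Cones: $\mathfrak{c}_{1}$: $\lambda_2-\beta_2\ge0,\ \lambda_1-\beta_1\ge0,\ \beta_1-\beta_2\ge0,\ -\beta_1+2\beta_2\ge0$. $\mathfrak{c}_{2}$: $\beta_1-2\beta_2\ge0,\ \lambda_2-\beta_2\ge0,\ -\lambda_1+\beta_1\ge0,\ \lambda_1-\beta_1+\beta_2\ge0$. $\mathfrak{c}_{3}$: $\lambda_2-\beta_2\ge0,\ -\lambda_1+\beta_1\ge0,\ -\beta_1+2\beta_2\ge0,\ \beta_1-\beta_2\ge0,\ \lambda_1-\beta_1+\beta_2\ge0$. $\mathfrak{c}_{4}$: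 $\beta_1\ge0,\ \lambda_2-\beta_2\ge0,\ -\beta_1+\beta_2\ge0,\ \lambda_1-\beta_1\ge0$. $\mathfrak{c}_{5}$: $\beta_2\ge0,\ \beta_1-2\beta_2\ge0,\ \lambda_1-\beta_1\ge0,\ \lambda_2-\beta_2\ge0$. $\mathfrak{c}_{6}$: $\beta_1-\beta_2\ge0,\ 2\lambda_2+\beta_1-2\beta_2\ge0,\ -\beta_1+2\beta_2\ge0,\ -\lambda_2+\beta_2\ge0,\ \lambda_1-\beta_1\ge0$. $\mathfrak{c}_{7}$: $\lambda_1-\beta_1+2\beta_2\ge0,\ -\lambda_1+\beta_1-\beta_2\ge0,\ \beta_1-2\beta_2\ge0,\ \lambda_2-\beta_2\ge0$. $\mathfrak{c}_{8}$: $-\lambda_1+\beta_1\ge0,\ \lambda_1\ge0,\ \lambda_2-\beta_2\ge0,\ -\beta_1+\beta_2\ge0$. $\mathfrak{c}_{9}$: $-\lambda_1+\beta_1\ge0,\ \lambda_1-\beta_1+\beta_2\ge0,\ \lambda_1+2\lambda_2-\beta_1\ge0,\ -\lambda_2+\beta_2\ge0,\ \beta_1-2\beta_2\ge0$. $\mathfrak{c}_{10}$: $\lambda_1+\lambda_2-\beta_2\ge0,\ \lambda_1+2\lambda_2-\beta_1\ge0,\ 2\lambda_2+\beta_1-2\beta_2\ge0,\ \lambda_1-\beta_1+\beta_2\ge0,\ -\lambda_1+\beta_1\ge0$. $\mathfrak{c}_{11}$: $2\lambda_2+\beta_1-2\beta_2\ge0,\ -\lambda_2+\beta_2\ge0,\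 -\beta_1+\beta_2\ge0,\ \lambda_1-\beta_1\ge0$. $\mathfrak{c}_{12}$: $-\lambda_2+\beta_2\ge0,\ \lambda_2\ge0,\ \beta_1-2\beta_2\ge0,\ \lambda_1-\beta_1\ge0$. $\mathfrak{c}_{13}$: $-\beta_1+2\beta_2\ge0,\ -\lambda_1+\beta_1-\beta_2\ge0,\ \lambda_1\ge0,\ \lambda_2-\beta_2\ge0$. $\mathfrak{c}_{14}$: $-\lambda_1+\beta_1-\beta_2\ge0,\ \lambda_1+2\lambda_2-\beta_1\ge0,\ -\lambda_2+\beta_2\ge0,\ \beta_1-2\beta_2\ge0$. $\mathfrak{c}_{15}$: $-\beta_1+\beta_2\ge0,\ -\lambda_2+\beta_2\ge0,\ 2\lambda_2+\beta_1-2\beta_2\ge0,\ \lambda_1+\lambda_2-\beta_2\ge0,\ -\lambda_1+\beta_1\ge0$. $\mathfrak{c}_{16}$: $-\lambda_1-\lambda_2+\beta_2\ge0,\ \lambda_1+2\lambda_2-\beta_1\ge0,\ 2\lambda_2+\beta_1-2\beta_2\ge0,\ \lambda_1-\beta_1+\beta_2\ge0,\ \beta_1-\beta_2\ge0$. $\mathfrak{c}_{17}$: $\lambda_2+\beta_1-\beta_2\ge0,\ -2\lambda_2-\beta_1+2\beta_2\ge0,\ -\beta_1+\beta_2\ge0,\ \lambda_1-\beta_1\ge0$. $\mathfrak{c}_{18}$: $\beta_1-\beta_2\ge0,\ \lambda_2\ge0,\ -2\lambda_2-\beta_1+2\beta_2\ge0,\ \lambda_1-\beta_1\ge0$. $\mathfrak{c}_{19}$: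 $-\lambda_1+\beta_1-\beta_2\ge0,\ -\lambda_2+\beta_2\ge0,\ -\beta_1+2\beta_2\ge0,\ \lambda_1+2\lambda_2-\beta_1\ge0,\ \lambda_1+\lambda_2-\beta_2\ge0$. $\mathfrak{c}_{20}$: $\lambda_1+\lambda_2-\beta_1+\beta_2\ge0,\ -\lambda_1-2\lambda_2+\beta_1\ge0,\ -\lambda_1+\beta_1-\beta_2\ge0,\ \beta_1-2\beta_2\ge0$. $\mathfrak{c}_{21}$: $\lambda_1+\lambda_2-\beta_2\ge0,\ -\lambda_1+\beta_1\ge0,\ -2\lambda_2-\beta_1+2\beta_2\ge0,\ -\beta_1+\beta_2\ge0$. $\mathfrak{c}_{22}$: $-\lambda_1-\lambda_2+\beta_2\ge0,\ \lambda_1\ge0,\ 2\lambda_2+\beta_1-2\beta_2\ge0,\ -\beta_1+\beta_2\ge0$. $\mathfrak{c}_{23}$: $\lambda_2\ge0,\ -\lambda_1-2\lambda_2+\beta_1\ge0,\ \lambda_1-\beta_1+\beta_2\ge0,\ \beta_1-2\beta_2\ge0$. $\mathfrak{c}_{24}$: $-2\lambda_2-\beta_1+2\beta_2\ge0,\ \beta_1-\beta_2\ge0,\ \lambda_1+\lambda_2-\beta_2\ge0,\ -\lambda_1+\beta_1\ge0,\ \lambda_1+2\lambda_2-\beta_1\ge0$. $\mathfrak{c}_{25}$: $-\lambda_1-2\lambda_2+\beta_1\ge0,\ -\lambda_1+\beta_1-\beta_2\ge0,\ -\beta_1+2\beta_2\ge0,\ \lambda_1+\lambda_2-\beta_2\ge0$.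 $\mathfrak{c}_{26}$: $\lambda_1\ge0,\ -\lambda_1-\lambda_2+\beta_2\ge0,\ -\lambda_1+\beta_1-\beta_2\ge0,\ \lambda_1+2\lambda_2-\beta_1\ge0$. $\mathfrak{c}_{27}$: $\lambda_1+2\lambda_2+\beta_1-2\beta_2\ge0,\ -\lambda_1-\lambda_2+\beta_2\ge0,\ -2\lambda_2-\beta_1+2\beta_2\ge0,\ -\beta_1+\beta_2\ge0$. $\mathfrak{c}_{28}$: $-\lambda_1-2\lambda_2+\beta_1\ge0,\ -\beta_1+2\beta_2\ge0,\ 2\lambda_2+\beta_1-2\beta_2\ge0,\ \lambda_1-\beta_1+\beta_2\ge0,\ \lambda_1+\lambda_2-\beta_2\ge0$. $\mathfrak{c}_{29}$: $\lambda_2\ge0,\ -\lambda_1-2\lambda_2+\beta_1\ge0,\ -2\lambda_2-\beta_1+2\beta_2\ge0,\ \lambda_1+\lambda_2-\beta_2\ge0$. $\mathfrak{c}_{30}$: $-\lambda_1-\lambda_2+\beta_2\ge0,\ \beta_1-\beta_2\ge0,\ \lambda_1+2\lambda_2-\beta_1\ge0,\ -2\lambda_2-\beta_1+2\beta_2\ge0$. $\mathfrak{c}_{31}$: $-\lambda_1-2\lambda_2+\beta_1\ge0,\ -\lambda_1+\beta_1-\beta_2\ge0,\ 2\lambda_1+2\lambda_2-\beta_1\ge0,\ -\lambda_1-\lambda_2+\beta_2\ge0$. $\mathfrak{c}_{32}$: $2\lambda_2+\beta_1-2\beta_2\ge0,\ -\lambda_1-\lambda_2+\beta_2\ge0,\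 -\lambda_1-2\lambda_2+\beta_1\ge0,\ \lambda_1-\beta_1+\beta_2\ge0$. $\mathfrak{c}_{33}$: $-\lambda_1-\lambda_2+\beta_2\ge0,\ \lambda_1+2\lambda_2-\beta_2\ge0,\ -\lambda_1-2\lambda_2+\beta_1\ge0,\ -2\lambda_2-\beta_1+2\beta_2\ge0$. Quasi-polynomials: $f_{1}=\frac12\beta_1+\frac12\beta_2+\beta_2\beta_1-\frac12\beta_2^2+\frac78-\frac14\beta_1^2+\frac18(-1)^{\beta_1}$ $f_{2}=\frac12\lambda_1-\frac12\beta_1+\frac32\beta_2-\frac14\lambda_1^2+\frac12\beta_2^2+\frac78-\frac14\beta_1^2+\frac18(-1)^{\beta_1+\lambda_1}+\frac12\lambda_1\beta_1$ $f_{3}=\frac18(-1)^{\beta_1}+\frac12\lambda_1+\frac12\beta_2-\frac14\lambda_1^2+\frac34-\frac12\beta_2^2-\frac12\beta_1^2+\frac12\lambda_1\beta_1+\frac18(-1)^{\beta_1+\lambda_1}+\beta_2\beta_1$ $f_{4}=\frac18(-1)^{\beta_1}+\beta_1+\frac14\beta_1^2+\frac78$ $f_{5}=1+\frac32\beta_2+\frac12\beta_2^2$ $f_{6}=\frac12\lambda_2+\frac12\beta_1+\beta_2\beta_1-\beta_2^2-\frac14\beta_1^2+\lambda_2\beta_2-\frac12\lambda_2^2+\frac18(-1)^{\beta_1}+\frac78$ $f_{7}=\lambda_1-\beta_1+2\beta_2+\frac14\lambda_1^2+\frac18(-1)^{\beta_1+\lambda_1}+\beta_2^2+\frac78-\frac12\lambda_1\beta_1+\frac14\beta_1^2+\lambda_1\beta_2-\beta_2\beta_1$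 $f_{8}=\frac12\lambda_1+\frac12\beta_1-\frac14\lambda_1^2+\frac34+\frac12\lambda_1\beta_1+\frac18(-1)^{\beta_1+\lambda_1}+\frac18(-1)^{\beta_1}$ $f_{9}=\frac12\lambda_2+\frac12\lambda_1-\frac12\beta_1+\beta_2-\frac14\lambda_1^2-\frac14\beta_1^2+\lambda_2\beta_2+\frac12\lambda_1\beta_1-\frac12\lambda_2^2+\frac18(-1)^{\beta_1+\lambda_1}+\frac78$ $f_{10}=\frac12\lambda_2+\frac12\lambda_1-\frac14\lambda_1^2+\frac34-\beta_2^2-\frac12\beta_1^2+\lambda_2\beta_2+\frac18(-1)^{\beta_1}+\frac12\lambda_1\beta_1-\frac12\lambda_2^2+\frac18(-1)^{\beta_1+\lambda_1}+\beta_2\beta_1$ $f_{11}=\frac12\lambda_2+\beta_1-\frac12\beta_2-\frac12\beta_2^2+\frac14\beta_1^2+\frac78+\lambda_2\beta_2+\frac18(-1)^{\beta_1}-\frac12\lambda_2^2$ $f_{12}=1+\frac12\lambda_2+\beta_2+\lambda_2\beta_2-\frac12\lambda_2^2$ $f_{13}=\lambda_1-\frac12\beta_1+\beta_2+\frac14\lambda_1^2+\frac34+\lambda_1\beta_2+\frac18(-1)^{\beta_1}+\frac18(-1)^{\beta_1+\lambda_1}-\frac12\lambda_1\beta_1$ $f_{14}=\frac12\lambda_2+\lambda_1-\beta_1+\frac32\beta_2+\frac14\lambda_1^2+\frac12\beta_2^2+\lambda_1\beta_2+\frac14\beta_1^2+\lambda_2\beta_2-\frac12\lambda_2^2-\beta_2\beta_1-\frac12\lambda_1\beta_1+\frac78+\frac18(-1)^{\beta_1+\lambda_1}$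 $f_{15}=\frac12\lambda_2+\frac12\lambda_1+\frac12\beta_1-\frac12\beta_2+\frac18(-1)^{\beta_1}-\frac14\lambda_1^2+\frac34-\frac12\beta_2^2+\lambda_2\beta_2-\frac12\lambda_2^2+\frac18(-1)^{\beta_1+\lambda_1}+\frac12\lambda_1\beta_1$ $f_{16}=\lambda_2+\lambda_1-\frac12\beta_2+\frac18(-1)^{\beta_1}+\frac14\lambda_1^2+\frac34-\frac12\beta_2^2-\lambda_1\beta_2-\frac12\beta_1^2+\lambda_2\lambda_1+\frac12\lambda_1\beta_1+\frac18(-1)^{\beta_1+\lambda_1}+\beta_2\beta_1$ $f_{17}=1+\frac32\lambda_2+\frac32\beta_1-\frac32\beta_2+\frac12\beta_2^2+\frac12\beta_1^2-\lambda_2\beta_2+\frac12\lambda_2^2+\lambda_2\beta_1-\beta_2\beta_1$ $f_{18}=1+\frac32\lambda_2+\beta_1-\beta_2-\lambda_2\beta_2+\frac12\lambda_2^2+\lambda_2\beta_1$ $f_{19}=\frac12\lambda_2+\lambda_1-\frac12\beta_1+\frac12\beta_2+\frac14\lambda_1^2+\frac34-\frac12\beta_2^2+\lambda_1\beta_2+\lambda_2\beta_2-\frac12\lambda_2^2-\frac12\lambda_1\beta_1+\frac18(-1)^{\beta_1}+\frac18(-1)^{\beta_1+\lambda_1}$ $f_{20}=1+\frac12\beta_2^2+\frac12\lambda_1^2+\frac12\lambda_2^2+\lambda_2\lambda_1+\lambda_2\beta_2+\lambda_1\beta_2+\frac32\beta_2+\frac32\lambda_2+\frac32\lambda_1-\frac32\beta_1+\frac12\beta_1^2-\lambda_2\beta_1-\beta_2\beta_1-\lambda_1\beta_1$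 $f_{21}=\frac32\lambda_2+\frac12\lambda_1+\beta_1-\frac32\beta_2-\frac14\lambda_1^2+\frac12\beta_2^2+\frac14\beta_1^2-\lambda_2\beta_2+\frac78+\frac12\lambda_2^2+\frac18(-1)^{\beta_1+\lambda_1}+\lambda_2\beta_1+\frac12\lambda_1\beta_1-\beta_2\beta_1$ $f_{22}=\lambda_2+\lambda_1+\frac12\beta_1-\beta_2+\frac14\lambda_1^2+\frac34-\lambda_1\beta_2+\lambda_2\lambda_1+\frac18(-1)^{\beta_1}+\frac12\lambda_1\beta_1+\frac18(-1)^{\beta_1+\lambda_1}$ $f_{23}=1+\beta_2+\lambda_1-\beta_1+\frac12\lambda_2^2+\lambda_2\lambda_1+\lambda_2\beta_2+\frac32\lambda_2-\lambda_2\beta_1$ $f_{24}=\frac32\lambda_2+\frac12\lambda_1+\frac12\beta_1-\beta_2-\frac14\lambda_1^2-\frac14\beta_1^2-\lambda_2\beta_2+\frac12\lambda_2^2+\frac12\lambda_1\beta_1+\lambda_2\beta_1+\frac78+\frac18(-1)^{\beta_1+\lambda_1}$ $f_{25}=\frac32\lambda_2+\frac32\lambda_1-\beta_1+\frac12\beta_2+\frac12\lambda_1^2-\frac12\beta_2^2+\lambda_1\beta_2+\frac14\beta_1^2+\lambda_2\lambda_1+\lambda_2\beta_2+\frac12\lambda_2^2-\lambda_1\beta_1+\frac78+\frac18(-1)^{\beta_1}-\lambda_2\beta_1$ $f_{26}=\frac34+\frac34\lambda_1^2+\lambda_2\lambda_1+\lambda_2+\frac32\lambda_1-\frac12\lambda_1\beta_1+\frac18(-1)^{\beta_1}-\frac12\beta_1+\frac18(-1)^{\beta_1+\lambda_1}$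 $f_{27}=2\lambda_2+\lambda_1+\beta_1-2\beta_2+\frac14\lambda_1^2+\beta_2^2-\lambda_1\beta_2+\frac14\beta_1^2+\lambda_2\lambda_1-2\lambda_2\beta_2+\lambda_2^2+\frac12\lambda_1\beta_1+\frac18(-1)^{\beta_1+\lambda_1}-\beta_2\beta_1+\lambda_2\beta_1+\frac78$ $f_{28}=\frac32\lambda_2+\lambda_1-\frac12\beta_1-\beta_2^2-\frac14\beta_1^2+\lambda_2\lambda_1+\lambda_2\beta_2+\frac12\lambda_2^2+\beta_2\beta_1-\lambda_2\beta_1+\frac78+\frac18(-1)^{\beta_1}$ $f_{29}=1+\frac52\lambda_2+\lambda_1-\beta_2+\lambda_2\lambda_1-\lambda_2\beta_2+\frac32\lambda_2^2$ $f_{30}=2\lambda_2+\lambda_1+\frac12\beta_1-\frac32\beta_2+\frac14\lambda_1^2+\frac12\beta_2^2-\lambda_1\beta_2-\frac14\beta_1^2+\lambda_2\lambda_1-2\lambda_2\beta_2+\lambda_2^2+\frac12\lambda_1\beta_1+\frac78+\frac18(-1)^{\beta_1+\lambda_1}+\lambda_2\beta_1$ $f_{31}=\frac78+\lambda_2^2+\lambda_1^2+2\lambda_2\lambda_1+2\lambda_2+2\lambda_1-\beta_1+\frac14\beta_1^2-\lambda_2\beta_1-\lambda_1\beta_1+\frac18(-1)^{\beta_1}$ $f_{32}=2\lambda_2+\frac32\lambda_1-\frac12\beta_1-\frac12\beta_2+\frac12\lambda_1^2-\frac12\beta_2^2-\lambda_1\beta_2-\frac14\beta_1^2+2\lambda_2\lambda_1+\lambda_2^2+\frac18(-1)^{\beta_1}+\beta_2\beta_1+\frac78-\lambda_2\beta_1$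 $f_{33}=1+3\lambda_2+\frac32\lambda_1-\frac32\beta_2+\frac12\lambda_1^2+\frac12\beta_2^2-\lambda_1\beta_2+2\lambda_2\lambda_1-2\lambda_2\beta_2+2\lambda_2^2$
   Context: $\mathfrak{so}_5(\mathbf{C})$ is the Lie algebra of complex $(5\times5)$-matrices $A$ with $A^tM=-MA$ for a fixed nondegenerate symmetric complex $(5\times5)$-matrix $M$. Fix a Cartan subalgebra $\mathfrak{h}$ and simple roots $\alpha_1,\alpha_2\in\mathfrak{h}^*$ numbered so that $\alpha_2$ is the long root, and let $\omega_1,\omega_2$ be the corresponding fundamental weights; thus $\alpha_1=2\omega_1-\omega_2$ and $\alpha_2=-2\omega_1+2\omega_2$. Let $\Lambda=\mathbf{Z}\omega_1+\mathbf{Z}\omega_2$ be the weight lattice and $Q=\mathbf{Z}\alpha_1+\mathbf{Z}\alpha_2$ the root lattice. A weight $\lambda=\lambda_1\omega_1+\lambda_2\omega_2\in\Lambda$ is dominant if $\lambda_1,\lambda_2\ge0$. For $\lambda$ dominant, $V(\lambda)$ is the irreducible $\mathfrak{so}_5(\mathbf{C})$-module of highest weight $\lambda$, and $V(\lambda)_\mu$ is its subspace of vectors of weight $\mu$. For $\beta\in Q$ define $K^\lambda_\beta:=\dim V(\lambda)_{\lambda-\beta}$ if $\lambda$ is dominant, and $K^\lambda_\beta:=0$ if $\lambda\in\Lambda$ is not dominant. A quasi-polynomial is a function on $\mathbf{Z}^4$ that agrees with a polynomial on each coset of some lattice $L\subseteq\mathbf{Z}^4$.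
   Formalization: Cone c_10 is given the three further inequalities β1−β2≥0, −λ2+β2≥0, −β1+2β2≥0; with only the five listed the claim fails, e.g. at (λ1,λ2,β1,β2)=(0,2,0,0), where K=1 but f_10=0. *)

(* Defs.v *)
From HB Require Import structures.
From mathcomp Require Import all_boot all_order all_algebra.

Set Implicit Arguments.
Unset Strict Implicit.
Unset Printing Implicit Defensive.

Import Order.TTheory GRing.Theory Num.Theory.
Local Open Scope ring_scope.

Definition so_defect (C : fieldType) (M A : 'M[C]_5) : 'M[C]_5 :=
  A^T *m M + M *m A.

Fact so_defect_linear (C : fieldType) (M : 'M[C]_5) : linear (so_defect M).
Proof.
move=> a A B; rewrite /so_defect linearP /= mulmxDl mulmxDr.
by rewrite -scalemxAl -scalemxAr scalerDr addrACA.
Qed.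

HB.instance Definition _ (C : fieldType) (M : 'M[C]_5) :=
  GRing.isLinear.Build C 'M[C]_5 'M[C]_5 _ (so_defect M) (so_defect_linear M).

Definition so5_space (C : fieldType) (M : 'M[C]_5) : {vspace 'M[C]_5} :=
  lker (linfun (so_defect M)).

Lemma mem_so5_space (C : fieldType) (M A : 'M[C]_5) :
  (A \in so5_space M) = (A^T *m M == - (M *m A)).
Proof. by rewrite memv_ker lfunE /= addr_eq0. Qed.

Notation so5 M := (subvs_of (so5_space M)).

Definition bracket (C : fieldType) (M : 'M[C]_5) (X Y : so5 M) : so5 M :=
  vsproj (so5_space M)
    (vsval X *m vsval Y - vsval Y *m vsval X : 'M[C]_5).

Lemma vsval_bracket (C : fieldType) (M : 'M[C]_5) (X Y : so5 M) :
  vsval (bracket X Y) = vsval X *m vsval Y - vsval Y *m vsval X.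
Proof.
have h (Z : so5 M) : (vsval Z)^T *m M = - (M *m vsval Z).
  by apply/eqP; rewrite -mem_so5_space subvsP.
rewrite /bracket vsprojK // mem_so5_space linearB /= !trmx_mul mulmxBl.
rewrite -!mulmxA !h !mulmxN !mulmxA !h !mulNmx !opprK mulmxBr !mulmxA opprB.
by [].
Qed.

(* Self-centralizing abelian subalgebras acting diagonalizably under ad; in a
   complex semisimple Lie algebra these are the Cartan subalgebras. *)
Definition is_cartan (C : fieldType) (M : 'M[C]_5) (h : {vspace so5 M}) : Prop :=
  [/\ {in h &, forall H H', bracket H H' = 0},
      forall X, {in h, forall H, bracket H X = 0} -> X \in h &
      {in h, forall H, exists2 e : seq (so5 M), basis_of fullv e &
         {in e, forall X, exists c : C, bracket H X = c *: X}}].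

Notation dual C h := 'Hom(subvs_of h, C^o).

Definition trace_form (C : fieldType) (M : 'M[C]_5) (h : {vspace so5 M})
    (H H' : subvs_of h) : C^o :=
  \tr (vsval (vsval H) *m vsval (vsval H')).

Fact trace_form_linear (C : fieldType) (M : 'M[C]_5) (h : {vspace so5 M})
    (H : subvs_of h) : linear (trace_form H).
Proof.
by move=> a X Y; rewrite /trace_form !linearP.
Qed.

HB.instance Definition _ (C : fieldType) (M : 'M[C]_5) (h : {vspace so5 M})
    (H : subvs_of h) :=
  GRing.isLinear.Build C (subvs_of h) C^o _ (trace_form H)
    (trace_form_linear H).

Definition to_dual (C : fieldType) (M : 'M[C]_5) (h : {vspace so5 M})
    (H : subvs_of h) : dual C h :=
  linfun (trace_form H).

Fact to_dual_linear (C : fieldType) (M : 'M[C]_5) (h : {vspace so5 M}) :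
  linear (@to_dual C M h).
Proof.
move=> a X Y; apply/lfunP => Z; rewrite add_lfunE scale_lfunE !lfunE /=.
by rewrite /trace_form !linearP /= mulmxDl -scalemxAl linearP.
Qed.

HB.instance Definition _ (C : fieldType) (M : 'M[C]_5) (h : {vspace so5 M}) :=
  GRing.isLinear.Build C (subvs_of h) (dual C h) _ (@to_dual C M h)
    (@to_dual_linear C M h).

(* The bilinear form on h^* induced by the form tr(XY), which is one third of
   the Killing form of so_5; the scaling affects neither the comparison of root
   lengths nor coroot_pairing. *)
Definition dual_form (C : fieldType) (M : 'M[C]_5) (h : {vspace so5 M})
    (a b : dual C h) : C :=
  a ((linfun (@to_dual C M h))^-1%VF b).

(* The value of w on the coroot of a. *)
Definition coroot_pairing (C : fieldType) (M : 'M[C]_5) (h : {vspace so5 M})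
    (w a : dual C h) : C :=
  2 * dual_form w a / dual_form a a.

Definition root_vector (C : fieldType) (M : 'M[C]_5) (h : {vspace so5 M})
    (a : dual C h) (X : so5 M) : Prop :=
  forall H : subvs_of h, bracket (vsval H) X = (a H : C) *: X.

Definition is_root (C : fieldType) (M : 'M[C]_5) (h : {vspace so5 M})
    (a : dual C h) : Prop :=
  a != 0 /\ exists2 X : so5 M, X != 0 & root_vector a X.

Definition nonneg_comb (C : fieldType) (M : 'M[C]_5) (h : {vspace so5 M})
    (a1 a2 b : dual C h) : Prop :=
  exists m1 m2 : nat, b = a1 *+ m1 + a2 *+ m2.

Definition simple_roots (C : fieldType) (M : 'M[C]_5) (h : {vspace so5 M})
    (a1 a2 : dual C h) : Prop :=
  [/\ is_root a1, is_root a2, basis_of fullv [:: a1; a2] &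
      forall b : dual C h, is_root b ->
        nonneg_comb a1 a2 b \/ nonneg_comb a1 a2 (- b)].

(* The relation dual_form a1 a1 < dual_form a2 a2 in C means that the
   difference is a positive real number. *)
Definition long_second (C : numClosedFieldType) (M : 'M[C]_5)
    (h : {vspace so5 M}) (a1 a2 : dual C h) : Prop :=
  dual_form a1 a1 < dual_form a2 a2.

Definition fundamental_weights (C : fieldType) (M : 'M[C]_5)
    (h : {vspace so5 M}) (a1 a2 w1 w2 : dual C h) : Prop :=
  [/\ coroot_pairing w1 a1 = 1, coroot_pairing w1 a2 = 0,
      coroot_pairing w2 a1 = 0 & coroot_pairing w2 a2 = 1].

Definition is_rep (C : fieldType) (M : 'M[C]_5) (V : vectType C)
    (rho : 'Hom(so5 M, 'End(V))) : Prop :=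
  forall X Y : so5 M,
    rho (bracket X Y) = (rho X \o rho Y)%VF - (rho Y \o rho X)%VF.

Definition irreducible (C : fieldType) (M : 'M[C]_5) (V : vectType C)
    (rho : 'Hom(so5 M, 'End(V))) : Prop :=
  (fullv : {vspace V}) != 0%VS /\
  forall U : {vspace V}, (forall X : so5 M, (rho X @: U <= U)%VS) ->
    U = 0%VS \/ U = fullv.

Definition weight_space (C : fieldType) (M : 'M[C]_5) (V : vectType C)
    (rho : 'Hom(so5 M, 'End(V))) (h : {vspace so5 M}) (mu : dual C h) :
    {vspace V} :=
  (\bigcap_(H <- vbasis (fullv : {vspace subvs_of h}))
     passmx.leigenspace (rho (vsval H)) (mu H : C))%VS.

Lemma mem_weight_space (C : fieldType) (M : 'M[C]_5) (V : vectType C)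
    (rho : 'Hom(so5 M, 'End(V))) (h : {vspace so5 M}) (mu : dual C h) (v : V) :
  v \in weight_space rho mu <->
  forall H : subvs_of h, rho (vsval H) v = (mu H : C) *: v.
Proof.
have memE (H : subvs_of h) :
    (v \in passmx.leigenspace (rho (vsval H)) (mu H : C))
    = (rho (vsval H) v == (mu H : C) *: v).
  by rewrite memv_ker !lfun_simp subr_eq0.
rewrite /weight_space big_tnth; split=> [/subv_bigcapP hv H|hv].
  rewrite (coord_vbasis (memvf H)) !linear_sum /= sum_lfunE scaler_suml.
  apply: eq_bigr => i _; rewrite !linearZ /= scale_lfunE -scalerA.
  congr (_ *: _); apply/eqP; rewrite -memE.
  have := hv (cast_ord (esym (size_tuple _)) i) isT.
  by rewrite -memvE (tnth_nth 0).
apply/subv_bigcapP => i _; rewrite -memvE memE; exact/eqP/hv.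
Qed.

Definition has_highest_weight (C : fieldType) (M : 'M[C]_5) (V : vectType C)
    (rho : 'Hom(so5 M, 'End(V))) (h : {vspace so5 M})
    (a1 a2 lam : dual C h) : Prop :=
  exists v : V, [/\ v != 0, v \in weight_space rho lam &
    forall (b : dual C h) (X : so5 M),
      is_root b -> nonneg_comb a1 a2 b -> root_vector b X -> rho X v = 0].

(* For dominant lam: rho is the module V(lam), which is finite-dimensional. *)
Definition irreducible_module (C : fieldType) (M : 'M[C]_5) (V : vectType C)
    (rho : 'Hom(so5 M, 'End(V))) (h : {vspace so5 M})
    (a1 a2 lam : dual C h) : Prop :=
  [/\ is_rep rho, irreducible rho & has_highest_weight rho a1 a2 lam].

Definition dominant (l1 l2 : int) : bool := (0 <= l1) && (0 <= l2).

(* K^lam_beta for lam = l1 w1 + l2 w2 and beta = b1 a1 + b2 a2, where rho is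
   V(lam) if lam is dominant and is irrelevant otherwise. *)
Definition weight_multiplicity (C : fieldType) (M : 'M[C]_5) (V : vectType C)
    (rho : 'Hom(so5 M, 'End(V))) (h : {vspace so5 M})
    (a1 a2 w1 w2 : dual C h) (l1 l2 b1 b2 : int) : nat :=
  if dominant l1 l2 then
    \dim (weight_space rho (w1 *~ l1 + w2 *~ l2 - (a1 *~ b1 + a2 *~ b2)))
  else 0.

(* Cone 10 is stated in the original list with only the first five of the eight inequalities
   below.  With those five alone the formula fails, e.g. at
   (l1, l2, b1, b2) = (0, 2, 0, 0): this point also lies in cone 5 and has
   multiplicity 1, but the value of quasi-polynomial 10 there is 0. *)
Definition cone (R : numDomainType) (k : nat) (l1 l2 b1 b2 : R) : bool :=
  match k with
  | 1 =>
      [&& l2 - b2 >= 0, l1 - b1 >= 0, b1 - b2 >= 0 & - b1 + 2 * b2 >= 0]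
  | 2 =>
      [&& b1 - 2 * b2 >= 0, l2 - b2 >= 0, - l1 + b1 >= 0 & l1 - b1 + b2 >= 0]
  | 3 =>
      [&& l2 - b2 >= 0, - l1 + b1 >= 0, - b1 + 2 * b2 >= 0, b1 - b2 >= 0 &
         l1 - b1 + b2 >= 0]
  | 4 =>
      [&& b1 >= 0, l2 - b2 >= 0, - b1 + b2 >= 0 & l1 - b1 >= 0]
  | 5 =>
      [&& b2 >= 0, b1 - 2 * b2 >= 0, l1 - b1 >= 0 & l2 - b2 >= 0]
  | 6 =>
      [&& b1 - b2 >= 0, 2 * l2 + b1 - 2 * b2 >= 0, - b1 + 2 * b2 >= 0,
         - l2 + b2 >= 0 & l1 - b1 >= 0]
  | 7 =>
      [&& l1 - b1 + 2 * b2 >= 0, - l1 + b1 - b2 >= 0, b1 - 2 * b2 >= 0 &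
         l2 - b2 >= 0]
  | 8 =>
      [&& - l1 + b1 >= 0, l1 >= 0, l2 - b2 >= 0 & - b1 + b2 >= 0]
  | 9 =>
      [&& - l1 + b1 >= 0, l1 - b1 + b2 >= 0, l1 + 2 * l2 - b1 >= 0,
         - l2 + b2 >= 0 & b1 - 2 * b2 >= 0]
  | 10 =>
      [&& l1 + l2 - b2 >= 0, l1 + 2 * l2 - b1 >= 0, 2 * l2 + b1 - 2 * b2 >= 0,
         l1 - b1 + b2 >= 0, - l1 + b1 >= 0, b1 - b2 >= 0, - l2 + b2 >= 0 &
         - b1 + 2 * b2 >= 0]
  | 11 =>
      [&& 2 * l2 + b1 - 2 * b2 >= 0, - l2 + b2 >= 0, - b1 + b2 >= 0 &
         l1 - b1 >= 0]
  | 12 =>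
      [&& - l2 + b2 >= 0, l2 >= 0, b1 - 2 * b2 >= 0 & l1 - b1 >= 0]
  | 13 =>
      [&& - b1 + 2 * b2 >= 0, - l1 + b1 - b2 >= 0, l1 >= 0 & l2 - b2 >= 0]
  | 14 =>
      [&& - l1 + b1 - b2 >= 0, l1 + 2 * l2 - b1 >= 0, - l2 + b2 >= 0 &
         b1 - 2 * b2 >= 0]
  | 15 =>
      [&& - b1 + b2 >= 0, - l2 + b2 >= 0, 2 * l2 + b1 - 2 * b2 >= 0,
         l1 + l2 - b2 >= 0 & - l1 + b1 >= 0]
  | 16 =>
      [&& - l1 - l2 + b2 >= 0, l1 + 2 * l2 - b1 >= 0,
         2 * l2 + b1 - 2 * b2 >= 0, l1 - b1 + b2 >= 0 & b1 - b2 >= 0]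
  | 17 =>
      [&& l2 + b1 - b2 >= 0, - 2 * l2 - b1 + 2 * b2 >= 0, - b1 + b2 >= 0 &
         l1 - b1 >= 0]
  | 18 =>
      [&& b1 - b2 >= 0, l2 >= 0, - 2 * l2 - b1 + 2 * b2 >= 0 & l1 - b1 >= 0]
  | 19 =>
      [&& - l1 + b1 - b2 >= 0, - l2 + b2 >= 0, - b1 + 2 * b2 >= 0,
         l1 + 2 * l2 - b1 >= 0 & l1 + l2 - b2 >= 0]
  | 20 =>
      [&& l1 + l2 - b1 + b2 >= 0, - l1 - 2 * l2 + b1 >= 0,
         - l1 + b1 - b2 >= 0 & b1 - 2 * b2 >= 0]
  | 21 =>
      [&& l1 + l2 - b2 >= 0, - l1 + b1 >= 0, - 2 * l2 - b1 + 2 * b2 >= 0 &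
         - b1 + b2 >= 0]
  | 22 =>
      [&& - l1 - l2 + b2 >= 0, l1 >= 0, 2 * l2 + b1 - 2 * b2 >= 0 &
         - b1 + b2 >= 0]
  | 23 =>
      [&& l2 >= 0, - l1 - 2 * l2 + b1 >= 0, l1 - b1 + b2 >= 0 &
         b1 - 2 * b2 >= 0]
  | 24 =>
      [&& - 2 * l2 - b1 + 2 * b2 >= 0, b1 - b2 >= 0, l1 + l2 - b2 >= 0,
         - l1 + b1 >= 0 & l1 + 2 * l2 - b1 >= 0]
  | 25 =>
      [&& - l1 - 2 * l2 + b1 >= 0, - l1 + b1 - b2 >= 0, - b1 + 2 * b2 >= 0 &
         l1 + l2 - b2 >= 0]
  | 26 =>
      [&& l1 >= 0, - l1 - l2 + b2 >= 0, - l1 + b1 - b2 >= 0 &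
         l1 + 2 * l2 - b1 >= 0]
  | 27 =>
      [&& l1 + 2 * l2 + b1 - 2 * b2 >= 0, - l1 - l2 + b2 >= 0,
         - 2 * l2 - b1 + 2 * b2 >= 0 & - b1 + b2 >= 0]
  | 28 =>
      [&& - l1 - 2 * l2 + b1 >= 0, - b1 + 2 * b2 >= 0,
         2 * l2 + b1 - 2 * b2 >= 0, l1 - b1 + b2 >= 0 & l1 + l2 - b2 >= 0]
  | 29 =>
      [&& l2 >= 0, - l1 - 2 * l2 + b1 >= 0, - 2 * l2 - b1 + 2 * b2 >= 0 &
         l1 + l2 - b2 >= 0]
  | 30 =>
      [&& - l1 - l2 + b2 >= 0, b1 - b2 >= 0, l1 + 2 * l2 - b1 >= 0 &
         - 2 * l2 - b1 + 2 * b2 >= 0]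
  | 31 =>
      [&& - l1 - 2 * l2 + b1 >= 0, - l1 + b1 - b2 >= 0,
         2 * l1 + 2 * l2 - b1 >= 0 & - l1 - l2 + b2 >= 0]
  | 32 =>
      [&& 2 * l2 + b1 - 2 * b2 >= 0, - l1 - l2 + b2 >= 0,
         - l1 - 2 * l2 + b1 >= 0 & l1 - b1 + b2 >= 0]
  | 33 =>
      [&& - l1 - l2 + b2 >= 0, l1 + 2 * l2 - b2 >= 0, - l1 - 2 * l2 + b1 >= 0 &
         - 2 * l2 - b1 + 2 * b2 >= 0]
  | _ => false
  end.

Definition quasi_polynomial (k : nat) (L1 L2 B1 B2 : int) : rat :=
  let l1 : rat := L1%:~R in
  let l2 : rat := L2%:~R in
  let b1 : rat := B1%:~R in
  let b2 : rat := B2%:~R in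
  let s_b : rat := (-1) ^ B1 in
  let s_bl : rat := (-1) ^ (B1 + L1) in
  match k with
  | 1 =>
      1 / 2 * b1 + 1 / 2 * b2 + b2 * b1 - 1 / 2 * b2 ^+ 2 + 7 / 8
      - 1 / 4 * b1 ^+ 2 + 1 / 8 * s_b
  | 2 =>
      1 / 2 * l1 - 1 / 2 * b1 + 3 / 2 * b2 - 1 / 4 * l1 ^+ 2 + 1 / 2 * b2 ^+ 2
      + 7 / 8 - 1 / 4 * b1 ^+ 2 + 1 / 8 * s_bl + 1 / 2 * l1 * b1
  | 3 =>
      1 / 8 * s_b + 1 / 2 * l1 + 1 / 2 * b2 - 1 / 4 * l1 ^+ 2 + 3 / 4
      - 1 / 2 * b2 ^+ 2 - 1 / 2 * b1 ^+ 2 + 1 / 2 * l1 * b1 + 1 / 8 * s_bl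
      + b2 * b1
  | 4 =>
      1 / 8 * s_b + b1 + 1 / 4 * b1 ^+ 2 + 7 / 8
  | 5 =>
      1 + 3 / 2 * b2 + 1 / 2 * b2 ^+ 2
  | 6 =>
      1 / 2 * l2 + 1 / 2 * b1 + b2 * b1 - b2 ^+ 2 - 1 / 4 * b1 ^+ 2 + l2 * b2
      - 1 / 2 * l2 ^+ 2 + 1 / 8 * s_b + 7 / 8
  | 7 =>
      l1 - b1 + 2 * b2 + 1 / 4 * l1 ^+ 2 + 1 / 8 * s_bl + b2 ^+ 2 + 7 / 8
      - 1 / 2 * l1 * b1 + 1 / 4 * b1 ^+ 2 + l1 * b2 - b2 * b1
  | 8 =>
      1 / 2 * l1 + 1 / 2 * b1 - 1 / 4 * l1 ^+ 2 + 3 / 4 + 1 / 2 * l1 * b1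
      + 1 / 8 * s_bl + 1 / 8 * s_b
  | 9 =>
      1 / 2 * l2 + 1 / 2 * l1 - 1 / 2 * b1 + b2 - 1 / 4 * l1 ^+ 2
      - 1 / 4 * b1 ^+ 2 + l2 * b2 + 1 / 2 * l1 * b1 - 1 / 2 * l2 ^+ 2
      + 1 / 8 * s_bl + 7 / 8
  | 10 =>
      1 / 2 * l2 + 1 / 2 * l1 - 1 / 4 * l1 ^+ 2 + 3 / 4 - b2 ^+ 2
      - 1 / 2 * b1 ^+ 2 + l2 * b2 + 1 / 8 * s_b + 1 / 2 * l1 * b1
      - 1 / 2 * l2 ^+ 2 + 1 / 8 * s_bl + b2 * b1
  | 11 =>
      1 / 2 * l2 + b1 - 1 / 2 * b2 - 1 / 2 * b2 ^+ 2 + 1 / 4 * b1 ^+ 2 + 7 / 8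
      + l2 * b2 + 1 / 8 * s_b - 1 / 2 * l2 ^+ 2
  | 12 =>
      1 + 1 / 2 * l2 + b2 + l2 * b2 - 1 / 2 * l2 ^+ 2
  | 13 =>
      l1 - 1 / 2 * b1 + b2 + 1 / 4 * l1 ^+ 2 + 3 / 4 + l1 * b2 + 1 / 8 * s_b
      + 1 / 8 * s_bl - 1 / 2 * l1 * b1
  | 14 =>
      1 / 2 * l2 + l1 - b1 + 3 / 2 * b2 + 1 / 4 * l1 ^+ 2 + 1 / 2 * b2 ^+ 2
      + l1 * b2 + 1 / 4 * b1 ^+ 2 + l2 * b2 - 1 / 2 * l2 ^+ 2 - b2 * b1
      - 1 / 2 * l1 * b1 + 7 / 8 + 1 / 8 * s_bl
  | 15 =>
      1 / 2 * l2 + 1 / 2 * l1 + 1 / 2 * b1 - 1 / 2 * b2 + 1 / 8 * s_b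
      - 1 / 4 * l1 ^+ 2 + 3 / 4 - 1 / 2 * b2 ^+ 2 + l2 * b2 - 1 / 2 * l2 ^+ 2
      + 1 / 8 * s_bl + 1 / 2 * l1 * b1
  | 16 =>
      l2 + l1 - 1 / 2 * b2 + 1 / 8 * s_b + 1 / 4 * l1 ^+ 2 + 3 / 4
      - 1 / 2 * b2 ^+ 2 - l1 * b2 - 1 / 2 * b1 ^+ 2 + l2 * l1
      + 1 / 2 * l1 * b1 + 1 / 8 * s_bl + b2 * b1
  | 17 =>
      1 + 3 / 2 * l2 + 3 / 2 * b1 - 3 / 2 * b2 + 1 / 2 * b2 ^+ 2
      + 1 / 2 * b1 ^+ 2 - l2 * b2 + 1 / 2 * l2 ^+ 2 + l2 * b1 - b2 * b1
  | 18 =>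
      1 + 3 / 2 * l2 + b1 - b2 - l2 * b2 + 1 / 2 * l2 ^+ 2 + l2 * b1
  | 19 =>
      1 / 2 * l2 + l1 - 1 / 2 * b1 + 1 / 2 * b2 + 1 / 4 * l1 ^+ 2 + 3 / 4
      - 1 / 2 * b2 ^+ 2 + l1 * b2 + l2 * b2 - 1 / 2 * l2 ^+ 2
      - 1 / 2 * l1 * b1 + 1 / 8 * s_b + 1 / 8 * s_bl
  | 20 =>
      1 + 1 / 2 * b2 ^+ 2 + 1 / 2 * l1 ^+ 2 + 1 / 2 * l2 ^+ 2 + l2 * l1
      + l2 * b2 + l1 * b2 + 3 / 2 * b2 + 3 / 2 * l2 + 3 / 2 * l1 - 3 / 2 * b1
      + 1 / 2 * b1 ^+ 2 - l2 * b1 - b2 * b1 - l1 * b1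
  | 21 =>
      3 / 2 * l2 + 1 / 2 * l1 + b1 - 3 / 2 * b2 - 1 / 4 * l1 ^+ 2
      + 1 / 2 * b2 ^+ 2 + 1 / 4 * b1 ^+ 2 - l2 * b2 + 7 / 8 + 1 / 2 * l2 ^+ 2
      + 1 / 8 * s_bl + l2 * b1 + 1 / 2 * l1 * b1 - b2 * b1
  | 22 =>
      l2 + l1 + 1 / 2 * b1 - b2 + 1 / 4 * l1 ^+ 2 + 3 / 4 - l1 * b2 + l2 * l1
      + 1 / 8 * s_b + 1 / 2 * l1 * b1 + 1 / 8 * s_bl
  | 23 =>
      1 + b2 + l1 - b1 + 1 / 2 * l2 ^+ 2 + l2 * l1 + l2 * b2 + 3 / 2 * l2
      - l2 * b1
  | 24 =>
      3 / 2 * l2 + 1 / 2 * l1 + 1 / 2 * b1 - b2 - 1 / 4 * l1 ^+ 2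
      - 1 / 4 * b1 ^+ 2 - l2 * b2 + 1 / 2 * l2 ^+ 2 + 1 / 2 * l1 * b1
      + l2 * b1 + 7 / 8 + 1 / 8 * s_bl
  | 25 =>
      3 / 2 * l2 + 3 / 2 * l1 - b1 + 1 / 2 * b2 + 1 / 2 * l1 ^+ 2
      - 1 / 2 * b2 ^+ 2 + l1 * b2 + 1 / 4 * b1 ^+ 2 + l2 * l1 + l2 * b2
      + 1 / 2 * l2 ^+ 2 - l1 * b1 + 7 / 8 + 1 / 8 * s_b - l2 * b1
  | 26 =>
      3 / 4 + 3 / 4 * l1 ^+ 2 + l2 * l1 + l2 + 3 / 2 * l1 - 1 / 2 * l1 * b1
      + 1 / 8 * s_b - 1 / 2 * b1 + 1 / 8 * s_bl
  | 27 =>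
      2 * l2 + l1 + b1 - 2 * b2 + 1 / 4 * l1 ^+ 2 + b2 ^+ 2 - l1 * b2
      + 1 / 4 * b1 ^+ 2 + l2 * l1 - 2 * l2 * b2 + l2 ^+ 2 + 1 / 2 * l1 * b1
      + 1 / 8 * s_bl - b2 * b1 + l2 * b1 + 7 / 8
  | 28 =>
      3 / 2 * l2 + l1 - 1 / 2 * b1 - b2 ^+ 2 - 1 / 4 * b1 ^+ 2 + l2 * l1
      + l2 * b2 + 1 / 2 * l2 ^+ 2 + b2 * b1 - l2 * b1 + 7 / 8 + 1 / 8 * s_b
  | 29 =>
      1 + 5 / 2 * l2 + l1 - b2 + l2 * l1 - l2 * b2 + 3 / 2 * l2 ^+ 2
  | 30 =>
      2 * l2 + l1 + 1 / 2 * b1 - 3 / 2 * b2 + 1 / 4 * l1 ^+ 2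
      + 1 / 2 * b2 ^+ 2 - l1 * b2 - 1 / 4 * b1 ^+ 2 + l2 * l1 - 2 * l2 * b2
      + l2 ^+ 2 + 1 / 2 * l1 * b1 + 7 / 8 + 1 / 8 * s_bl + l2 * b1
  | 31 =>
      7 / 8 + l2 ^+ 2 + l1 ^+ 2 + 2 * l2 * l1 + 2 * l2 + 2 * l1 - b1
      + 1 / 4 * b1 ^+ 2 - l2 * b1 - l1 * b1 + 1 / 8 * s_b
  | 32 =>
      2 * l2 + 3 / 2 * l1 - 1 / 2 * b1 - 1 / 2 * b2 + 1 / 2 * l1 ^+ 2
      - 1 / 2 * b2 ^+ 2 - l1 * b2 - 1 / 4 * b1 ^+ 2 + 2 * l2 * l1 + l2 ^+ 2
      + 1 / 8 * s_b + b2 * b1 + 7 / 8 - l2 * b1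
  | 33 =>
      1 + 3 * l2 + 3 / 2 * l1 - 3 / 2 * b2 + 1 / 2 * l1 ^+ 2 + 1 / 2 * b2 ^+ 2
      - l1 * b2 + 2 * l2 * l1 - 2 * l2 * b2 + 2 * l2 ^+ 2
  | _ => 0
  end.

(* Main.v *)
Require Import Defs.
From HB Require Import structures.
From mathcomp Require Import all_boot all_order all_algebra.
From mathcomp Require Import reals complex.
From mathcomp Require Import ring lra zify.

Set Implicit Arguments.
Unset Strict Implicit.
Unset Printing Implicit Defensive.

Import Order.TTheory GRing.Theory Num.Theory.
Local Open Scope ring_scope.

(* Everything about so_5 is extracted abstractly from the Cartan decomposition.
   The trace form is nondegenerate and invariant, so it yields sl_2-triples for
   all roots; dim so_5 = 10 and dim h = 2 leave exactly eight roots, and together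
   with the relative lengths of the simple roots this forces the root system to
   be B_2.

   On the irreducible module the Casimir element of the trace form is a scalar.
   Taking its trace on a weight space, and using that tr(f e) on V_mu equals
   tr(e f) on V_(mu + alpha), gives Freudenthal's relation. Applying the
   difference operator prod_(alpha > 0) (1 - shift_alpha) turns it into
   (|lam + rho|^2 - |mu + rho|^2) n(mu) = 0, where n is the image of the
   multiplicity function. As n is antisymmetric under the dot action of the Weyl
   group and supported below lam, it is sum_w sgn(w) delta_(w . lam). Inverting
   the operator expresses the multiplicity as an alternating sum of eight values
   of Kostant's partition function, which is quasi-polynomial on three chambers;
   on each cone every argument stays in one (slightly enlarged) chamber. Outside
   the cones the weight is not in the convex hull of the Weyl orbit of lam. *)

(** * Eigenvectors and sl_2-representations *)

(** The order on the complex field is only partial, so the hypothesis that [a2] is the long root can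
    separate the two possible Cartan matrices only once root norms are known to be nonnegative. This
    sign comes from the defining representation: a coroot acts on the five-dimensional space with
    integral eigenvalues, so the trace of its square, which is 4 / (a, a), is a sum of integer
    squares.

    The difference operator works because (1 - shift_a) turns the string trace of a positive root a
    into an explicit multiple of one shifted multiplicity. Applying all four factors removes every
    trace, and the coefficients left on the eight shifted multiplicities collapse to one and the
    same number, [weyl_form p q], times the sign of the shift.

    The Weyl group enters only through the two simple reflections written in the coordinates (p, q)
    of lam - p a1 - q a2; descent on the height p + q takes the place of choosing dominant
    representatives.

    The dot action moves the arguments of the partition function past the walls by the offsets rho -
    w rho. This is why each chamber formula has to hold on a margin outside its chamber. *)

Section Eigenvectors.
Variables (C : fieldType) (V : vectType C).

Lemma basis_in_seq (s : seq V) :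
  exists2 b : seq V, {subset b <= s} & basis_of <<s>>%VS b.
Proof.
elim: s => [|x s [b bs bb]].
  by exists [::] => //; rewrite /basis_of eqxx nil_free.
have [xb|xb] := boolP (x \in <<b>>%VS).
  exists b; first by move=> y /bs; rewrite inE => ->; rewrite orbT.
  move/andP: bb => [/eqP sb fb]; rewrite /basis_of fb andbT span_cons -sb.
  by rewrite eq_sym; apply/eqP/addv_idPr; rewrite -memvE.
exists (x :: b).
  by move=> y; rewrite !inE => /orP[->//|/bs ->]; rewrite orbT.
move/andP: bb => [/eqP sb fb].
by rewrite /basis_of free_cons xb fb !span_cons sb eqxx.
Qed.

(** Applying [D - ev i0] to the sum removes the component [u i0] and multiplies the others by
    nonzero scalars, which allows induction on [r]. *)
Lemma eigen_components (I : eqType) (D : 'End(V)) (U : {vspace V})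
    (ev : I -> C) (r : seq I) (u : I -> V) :
    (forall x, x \in U -> D x \in U) ->
    uniq r -> {in r &, injective ev} ->
    {in r, forall i, D (u i) = ev i *: u i} ->
  \sum_(i <- r) u i \in U -> {in r, forall i, u i \in U}.
Proof.
move=> stU; elim: r u => [//|i0 r IH] u /= /andP[i0r ur] inj eig sU.
have inr i : i \in r -> i \in i0 :: r by rewrite inE => ->; rewrite orbT.
have rU : {in r, forall i, u i \in U}.
  move=> i ir.
  have : (ev i - ev i0) *: u i \in U.
    apply: (IH (fun i => (ev i - ev i0) *: u i)) => // [j k jr kr|j jr|].
    - by apply: inj; apply: inr.
    - by rewrite /= linearZ /= eig ?inr // !scalerA mulrC.
    - have -> : \sum_(j <- r) (ev j - ev i0) *: u j =
          D (\sum_(j <- i0 :: r) u j) - ev i0 *: \sum_(j <- i0 :: r) u j.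
        rewrite !big_cons linearD linear_sum /= eig ?mem_head // scalerDr opprD addrACA subrr.
        rewrite add0r scaler_sumr -sumrB !big_seq; apply: eq_bigr => j jr.
        by rewrite eig ?inr // scalerBl.
      by rewrite rpredB ?rpredZ ?stU.
  move=> h; rewrite -[u i]scale1r -(@mulVf _ (ev i - ev i0)).
    by rewrite -scalerA rpredZ.
  rewrite subr_eq0; apply: contra i0r => /eqP /inj.
  by move=> <- //; rewrite ?mem_head ?inr.
move=> i; rewrite inE => /orP[/eqP ->|/rU //].
move: sU; rewrite big_cons => h.
rewrite -[u i0](addrK (\sum_(j <- r) u j)) rpredB //.
by rewrite big_seq rpred_sum.
Qed.

(** Finite dimension enters here: [dim V + 1] nonzero eigenvectors with distinct eigenvalues would
    be free, by [eigen_components] with [U = 0]. All nilpotency of root vectors is derived from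
    this. *)
Lemma eigen_seq_zero (D : 'End(V)) (v : nat -> V) (ev : nat -> C) :
  injective ev -> (forall k, D (v k) = ev k *: v k) -> exists k, v k = 0.
Proof.
move=> inj eig.
have [[k /eqP vk]|nz] :
    (exists k : 'I_(dim V).+1, v k == 0) \/ forall k : 'I_(dim V).+1, v k != 0.
  case: (pickP (fun k : 'I_(dim V).+1 => v k == 0)) => [k vk|h]; [left|right].
    by exists k.
  by move=> k; rewrite h.
  by exists k.
pose X := [tuple v i | i < (dim V).+1].
have/eqP fX : free X.
  apply/freeP => k s0 i.
  have : k i *: v i \in (0%VS : {vspace V}).
    apply: (@eigen_components _ D 0%VS (fun i : 'I_(dim V).+1 => ev i)
      (index_enum _) (fun i => k i *: v i)) => //.
    - by move=> x /[!memv0] /eqP ->; rewrite linear0.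
    - exact: index_enum_uniq.
    - by move=> a b _ _ /inj /val_inj.
    - by move=> a _; rewrite /= linearZ /= eig !scalerA mulrC.
    - rewrite memv0 -[X in _ == X]s0; apply/eqP; apply: eq_bigr => j _.
      by rewrite -tnth_nth tnth_mktuple.
    - by rewrite mem_index_enum.
  rewrite memv0 scaler_eq0 => /orP[/eqP//|].
  by move/negP: (nz i).
have := dimvS (subvf <<X>>%VS); rewrite fX size_tuple dimvf.
by rewrite ltnn.
Qed.

Lemma eigenbasis_components (D : 'End(V)) (e : seq V) :
    basis_of fullv e -> {in e, forall X, exists c, D X = c *: X} ->
  forall x : V, exists n (ev : 'I_n -> C) (u : 'I_n -> V),
    [/\ injective ev, forall i, D (u i) = ev i *: u i & x = \sum_i u i].
Proof.
move=> /andP[/eqP be _] eig x.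
have [cs csP] : exists cs : seq C,
    {in e, forall X, exists2 c, c \in cs & D X = c *: X}.
  elim: e eig {be} => [|X e IH] eig; first by exists [::].
  have [cs csP] : exists cs : seq C,
      {in e, forall X, exists2 c, c \in cs & D X = c *: X}.
    by apply: IH => Y Ye; apply: eig; rewrite inE Ye orbT.
  have [c cX] := eig X (mem_head _ _).
  exists (c :: cs) => Y; rewrite inE => /orP[/eqP ->|/csP [c' c's eY]].
    by exists c; rewrite ?mem_head.
  by exists c'; rewrite ?inE ?c's ?orbT.
pose t := in_tuple (undup cs).
pose U i := passmx.leigenspace D (tnth t i).
have : x \in (\sum_i U i)%VS.
  have : (fullv <= \sum_i U i)%VS.
    rewrite -be; apply/span_subvP => X /csP [c ccs eX].
    have cu : c \in t by rewrite mem_undup.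
    case/tnthP: cu => i ei.
    apply: (subvP (sumv_sup i isT (subvv (U i)))).
    by rewrite memv_ker !lfun_simp -ei eX subrr.
  by move/subvP; apply; rewrite memvf.
case/memv_sumP => u uU ->.
exists _, (tnth t), u; split => //.
  by apply/tuple_uniqP; rewrite undup_uniq.
move=> i; have := uU i isT.
by rewrite memv_ker !lfun_simp subr_eq0 => /eqP.
Qed.

Lemma chain_stationary (U : nat -> {vspace V}) :
  (forall k, U k <= U k.+1)%VS -> exists k, (U k.+1 <= U k)%VS.
Proof.
move=> inc.
have step k : (exists k, (U k.+1 <= U k)%VS) \/ (k <= \dim (U k))%N.
  elim: k => [|k [IH|IH]]; [by right| by left|].
  have [le|nle] := boolP (U k.+1 <= U k)%VS; first by left; exists k.
  right; apply: leq_ltn_trans IH _; rewrite ltn_neqAle dimvS ?inc // andbT.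
  apply: contra nle => /eqP d.
  by have := dimv_leqif_eq (inc k) => -[_]; rewrite d eqxx => /esym/eqP <-; rewrite subvv.
have [//|] := step (dim V).+1.
by move=> /leq_trans/(_ (dimvS (subvf _))); rewrite dimvf ltnn.
Qed.

End Eigenvectors.

(** * Ladder operators: sl_2 and Heisenberg relations *)

Section Ladder.
Variables (C : numFieldType) (V : vectType C) (e f h : 'End(V)) (d : C).
Hypothesis he : forall u, h (e u) = e (h u) + d *: e u.
Hypothesis hf : forall u, h (f u) = f (h u) - d *: f u.
Hypothesis ef : forall u, e (f u) = f (e u) + h u.

Lemma ladder_up c v j :
  h v = c *: v -> h (iter j e v) = (c + d *+ j) *: iter j e v.
Proof.
move=> hv; elim: j => [|j IH] /=; first by rewrite addr0.
by rewrite he IH linearZ /= -scalerDl mulrSr addrA.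
Qed.

Lemma ladder_down c v j :
  h v = c *: v -> h (iter j f v) = (c - d *+ j) *: iter j f v.
Proof.
move=> hv; elim: j => [|j IH] /=; first by rewrite subr0.
by rewrite hf IH linearZ /= -scalerBl mulrSr opprD addrA.
Qed.

(** The coefficient is the sum of the eigenvalues [c - d i] for [i] from 0 to [j]. The step [d]
    stays general because [d = 2] is the sl_2 case and [d = 0] the Heisenberg case. *)
Lemma ladder_comm c v j : h v = c *: v ->
  e (iter j.+1 f v) = iter j.+1 f (e v)
    + (j.+1%:R * (c - d * j%:R / 2)) *: iter j f v.
Proof.
move=> hv; elim: j => [|j IH].
  by rewrite /= ef hv mulr0 mul0r subr0 mul1r.
rewrite [iter j.+2 f v]iterS ef IH (ladder_down _ hv) linearD linearZ /=.
rewrite -addrA; congr (_ + _); rewrite -scalerDl; congr (_ *: _).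
rewrite -(mulr_natr d) -![_.+2%:R]natr1 -![_.+1%:R]natr1. by field.
Qed.

End Ladder.

Section Sl2.
Variables (C : numFieldType) (V : vectType C) (e f h : 'End(V)).
Hypothesis he : forall u, h (e u) = e (h u) + 2 *: e u.
Hypothesis hf : forall u, h (f u) = f (h u) - 2 *: f u.
Hypothesis ef : forall u, e (f u) = f (e u) + h u.

Lemma iter_linear0 (g : 'End(V)) j : iter j g 0 = 0.
Proof. by elim: j => [//|j IH]; rewrite iterS IH linear0. Qed.

Lemma sl2_nilpotent c v : h v = c *: v -> exists N, iter N e v = 0.
Proof.
move=> hv; apply: (@eigen_seq_zero _ _ h _ (fun k => c + 2 *+ k)).
  by move=> i j /addrI /mulrIn; apply; rewrite pnatr_eq0.
by move=> k; apply: ladder_up hv.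
Qed.

(** Induction on the nilpotency order of [e] at [v]: the vector [e v] has weight [k + 2] and is
    killed by [j + 1] lowerings, hence vanishes. So [v] is a highest weight vector, and the
    coefficients [(j + 1) (k - j)] of [ladder_comm] are nonzero below [k]. *)
Lemma sl2_lowering_inj_aux N (k j : nat) v :
  iter N e v = 0 -> h v = k%:R *: v -> (j <= k)%N -> iter j f v = 0 -> v = 0.
Proof.
elim: N k j v => [//|N IH] k j v eN hv jk fj.
have ev0 : e v = 0.
  apply: (IH k.+2 j.+1); rewrite ?ltnS 1?ltnW //; first by rewrite -iterSr.
    by rewrite he hv linearZ /= -scalerDl -natrD addn2.
  have := ladder_comm hf ef j hv.
  by rewrite iterS fj !linear0 addr0.
elim: j jk fj => [//|j IHj] jk fj; apply: IHj; first exact: ltnW.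
have /esym/eqP := ladder_comm hf ef j hv.
rewrite fj linear0 ev0 iter_linear0 add0r scaler_eq0 => /orP[|/eqP//].
rewrite mulf_eq0 pnatr_eq0 /= mulrAC divff ?mul1r ?pnatr_eq0 //.
by rewrite subr_eq0 eqr_nat => /eqP E; move: jk; rewrite E ltnn.
Qed.

Lemma sl2_lowering_inj (k j : nat) v :
  h v = k%:R *: v -> (j <= k)%N -> iter j f v = 0 -> v = 0.
Proof. by move=> hv; have [N /sl2_lowering_inj_aux] := sl2_nilpotent hv; apply. Qed.

End Sl2.

Section Sl2Integral.
Variables (C : numFieldType) (V : vectType C) (e f h : 'End(V)).
Hypothesis he : forall u, h (e u) = e (h u) + 2 *: e u.
Hypothesis hf : forall u, h (f u) = f (h u) - 2 *: f u.
Hypothesis ef : forall u, e (f u) = f (e u) + h u.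

Lemma extremal_iterate (g : 'End(V)) v N :
  v != 0 -> iter N g v = 0 -> exists k, iter k g v != 0 /\ g (iter k g v) = 0.
Proof.
move=> v0 gN; have ex : exists k, iter k g v == 0 by exists N; rewrite gN.
case: (ex_minnP ex) => [[|k]] /=; first by rewrite (negPf v0).
move=> /eqP gk mn; exists k; split=> //.
by apply/negP => /mn; rewrite ltnn.
Qed.

(** Raising [v] as far as possible gives a highest weight vector; at the last nonzero lowering of
    it, [ladder_comm] forces its weight to be the number [j] of lowerings. *)
Lemma sl2_integral c v : v != 0 -> h v = c *: v -> exists z : int, c = z%:~R.
Proof.
move=> v0 hv; have [N eN] := sl2_nilpotent he hv.
have [k [u0 eu]] := extremal_iterate v0 eN.
have hu := ladder_up he k hv.
set u := iter k e v in u0 eu hu; set c' := c + _ in hu.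
have hf' : forall w, (- h) (f w) = f ((- h) w) + 2 *: f w.
  by move=> w; rewrite !opp_lfunE hf linearN opprB addrC.
have hu' : (- h) u = (- c') *: u by rewrite opp_lfunE hu scaleNr.
have [N' fN'] := sl2_nilpotent hf' hu'.
have [j [w0 fw]] := extremal_iterate u0 fN'.
have := ladder_comm hf ef j hu.
rewrite iterS fw linear0 eu iter_linear0 add0r => /esym/eqP.
rewrite scaler_eq0 (negPf w0) orbF mulf_eq0 pnatr_eq0 /=.
rewrite mulrAC divff ?mul1r ?pnatr_eq0 // subr_eq0 => /eqP cj.
exists (j%:Z - 2 *+ k).
by rewrite rmorphB rmorphMn /= -pmulrn -cj addrK.
Qed.

End Sl2Integral.

(** This excludes isotropic roots, for which [e], [f] and their commutator would span a Heisenberg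
    algebra. With step 0 the coefficient in [ladder_comm] is [(j + 1) c], which must vanish at the
    last nonzero lowering. *)
Lemma heisenberg_trivial (C : numFieldType) (V : vectType C)
    (e f h : 'End(V)) (c : C) (v : V) :
    (forall u, h (e u) = e (h u)) -> (forall u, h (f u) = f (h u)) ->
    (forall u, e (f u) = f (e u) + h u) ->
    v != 0 -> h v = c *: v -> (exists N, iter N e v = 0) ->
    (forall k, exists N, iter N f (iter k e v) = 0) ->
  c = 0.
Proof.
move=> he hf ef v0 hv [N eN] fN.
have [k [u0 eu]] := extremal_iterate v0 eN.
have he0 u : h (e u) = e (h u) + 0 *: e u by rewrite scale0r addr0.
have hf0 u : h (f u) = f (h u) - 0 *: f u by rewrite scale0r subr0.
have := ladder_up he0 k hv; rewrite mul0rn addr0 => hu.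
have [N' fN'] := fN k.
have [j [w0 fw]] := extremal_iterate u0 fN'.
have := ladder_comm hf0 ef j hu.
rewrite iterS fw linear0 eu iter_linear0 add0r => /esym/eqP.
rewrite scaler_eq0 (negPf w0) orbF mulf_eq0 pnatr_eq0 /= !mul0r subr0.
by move/eqP.
Qed.

(** * The Lie algebra so_5 and its trace form *)

Section So5Dim.
Variables (C : fieldType) (M : 'M[C]_5).
Hypotheses (Msym : M^T = M) (Munit : M \in unitmx).

(** The ten positions above the diagonal of a 5 by 5 matrix, numbered row by row. [pair_index] is
    the inverse numbering, with dummy value 0 on and below the diagonal. *)
Definition pair_fst : 'I_10 -> 'I_5 :=
  fun k => inord (nth 0 [:: 0; 0; 0; 0; 1; 1; 1; 2; 2; 3] k)%N.
Definition pair_snd : 'I_10 -> 'I_5 :=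
  fun k => inord (nth 0 [:: 1; 2; 3; 4; 2; 3; 4; 3; 4; 4] k)%N.
Definition pair_index (i j : 'I_5) : 'I_10 :=
  inord (nth 0 (nth [::] [:: [:: 0; 0; 1; 2; 3]; [:: 0; 0; 4; 5; 6];
    [:: 0; 0; 0; 7; 8]; [:: 0; 0; 0; 0; 9]] i) j)%N.

Lemma pair_lt k : (pair_fst k < pair_snd k)%N.
Proof. by case: k => [[|[|[|[|[|[|[|[|[|[|//]]]]]]]]]] ?]; rewrite /= !inordK. Qed.

Lemma pair_indexK k : pair_index (pair_fst k) (pair_snd k) = k.
Proof.
by apply: val_inj; case: k => [[|[|[|[|[|[|[|[|[|[|//]]]]]]]]]] ?];
  rewrite /pair_index /pair_fst /pair_snd /= !inordK //= !inordK.
Qed.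

Lemma pair_indexE (i j : 'I_5) : (i < j)%N ->
  pair_fst (pair_index i j) = i /\ pair_snd (pair_index i j) = j.
Proof.
by case: i j => [[|[|[|[|[|//]]]]] ?] [[|[|[|[|[|//]]]]] ?] // _;
  split; apply: val_inj; rewrite /pair_fst /pair_snd /pair_index /= !inordK //=
    !inordK.
Qed.

(** Since [A] lies in so_5 exactly when [M *m A] is skew-symmetric, these entries are linear
    coordinates on so_5 and give its dimension. *)
Definition upper_entries (A : 'M[C]_5) : 'rV[C]_10 :=
  \row_k (M *m A) (pair_fst k) (pair_snd k).

Fact upper_entries_linear : linear upper_entries.
Proof.
move=> a A B; rewrite /upper_entries mulmxDr -scalemxAr.
by apply/rowP => k; rewrite !mxE.
Qed.

HB.instance Definition _ :=
  GRing.isLinear.Build C 'M[C]_5 'rV[C]_10 _ upper_entries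
    upper_entries_linear.

Lemma so5_skew (A : 'M[C]_5) :
  (A \in so5_space M) = ((M *m A)^T == - (M *m A)).
Proof. by rewrite mem_so5_space trmx_mul Msym. Qed.

End So5Dim.

Section So5DimChar0.
Variables (C : numFieldType) (M : 'M[C]_5).
Hypotheses (Msym : M^T = M) (Munit : M \in unitmx).

Lemma dim_so5 : \dim (so5_space M) = 10%N.
Proof.
have dV : \dim {: 'rV[C]_10} = 10%N by rewrite dimvf dim_matrix.
rewrite -dV -(@limg_dim_eq _ _ _ (linfun (upper_entries M))).
  congr (\dim _); apply/eqP; rewrite eqEsubv subvf /=; apply/subvP => r _; apply/memv_imgP.
  pose S : 'M[C]_5 := \matrix_(i, j)
    (if (i < j)%N then r 0 (pair_index i j)
     else if (j < i)%N then - r 0 (pair_index j i) else 0).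
  have MS : M *m (invmx M *m S) = S by rewrite mulKVmx.
  exists (invmx M *m S).
    rewrite so5_skew // MS; apply/eqP/matrixP => i j; rewrite !mxE.
    by case: ltngtP; rewrite ?opprK ?oppr0.
  apply/rowP => k; rewrite lfunE /= mxE MS mxE pair_lt pair_indexK.
  by [].
apply/eqP; rewrite -subv0; apply/subvP => A /memv_capP[As].
rewrite memv_ker lfunE /= memv0 => /eqP/rowP A0.
move: As; rewrite so5_skew // => /eqP/matrixP sk.
have S0 : M *m A = 0.
  have lt (i j : 'I_5) : (i < j)%N -> (M *m A) i j = 0.
    move=> ij; have [ei ej] := pair_indexE ij.
    by have := A0 (pair_index i j); rewrite /upper_entries mxE ei ej => ->; rewrite mxE.
  apply/matrixP => i j; rewrite [RHS]mxE.
  have := sk i j; rewrite [LHS]mxE [RHS]mxE.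
  case: (ltngtP i j) => [/lt //|/lt -> /esym/eqP|/val_inj ->].
    by rewrite oppr_eq0 => /eqP.
  by move/eqP; rewrite -addr_eq0 -mulr2n mulrn_eq0 /= => /eqP.
by rewrite -(mulKmx Munit A) S0 mulmx0.
Qed.

End So5DimChar0.

Section Bracket.
Variables (C : numFieldType) (M : 'M[C]_5).
Implicit Types X Y Z : so5 M.

Fact bracket_linear X : linear (bracket X).
Proof.
move=> a Y Z; apply: subvs_inj.
have E : vsval (a *: Y + Z) = a *: vsval Y + vsval Z by rewrite linearP.
rewrite vsval_bracket E linearP /= !vsval_bracket.
rewrite mulmxDl -scalemxAl scalerBr opprD.
by rewrite addrACA.
Qed.

HB.instance Definition _ X :=
  GRing.isLinear.Build C (so5 M) (so5 M) _ (bracket X) (bracket_linear X).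

Lemma bracketC X Y : bracket X Y = - bracket Y X.
Proof. by apply: subvs_inj; rewrite [RHS]linearN /= !vsval_bracket opprB. Qed.

Lemma bracketxx X : bracket X X = 0.
Proof. by apply: subvs_inj; rewrite vsval_bracket subrr linear0. Qed.

Lemma jacobi X Y Z :
  bracket X (bracket Y Z) = bracket (bracket X Y) Z + bracket Y (bracket X Z).
Proof.
apply: subvs_inj; rewrite [RHS]linearD /= !vsval_bracket.
rewrite !mulmxBl !mulmxBr !mulmxA.
set a := _ *m _ *m _; set b := _ *m _ *m _.
set c := vsval Y *m vsval Z *m _; set d := vsval Z *m vsval Y *m _.
set e := vsval Y *m vsval X *m _; set f := vsval Z *m vsval X *m _.
rewrite !opprB !addrA.
by apply/eqP; rewrite -subr_eq0; apply/eqP; apply/matrixP => i j; rewrite !mxE; ring.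
Qed.

Definition ad X : 'End(so5 M) := linfun (bracket X).

Lemma adE X Y : ad X Y = bracket X Y. Proof. exact: lfunE. Qed.

Fact ad_linear : linear ad.
Proof.
move=> a X Y; apply/lfunP => Z; rewrite add_lfunE scale_lfunE !adE.
by rewrite bracketC linearP /= opprD -scalerN -!(bracketC _ Z).
Qed.

HB.instance Definition _ :=
  GRing.isLinear.Build C (so5 M) 'End(so5 M) _ ad ad_linear.

Definition adjoint : 'Hom(so5 M, 'End(so5 M)) := linfun ad.

Lemma adjointE X Y : adjoint X Y = bracket X Y.
Proof. by rewrite lfunE adE. Qed.

Lemma adjoint_rep : is_rep adjoint.
Proof.
move=> X Y; apply/lfunP => Z.
by rewrite add_lfunE opp_lfunE !comp_lfunE !adjointE jacobi addrK.
Qed.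

Definition kap X Y : C := \tr (vsval X *m vsval Y).

Fact kap_linear X : linear (kap X : so5 M -> C^o).
Proof. by move=> a Y Z; rewrite /kap !linearP. Qed.

HB.instance Definition _ X :=
  GRing.isLinear.Build C (so5 M) C^o _ (kap X : so5 M -> C^o) (kap_linear X).

Lemma kapC X Y : kap X Y = kap Y X.
Proof. exact: mxtrace_mulC. Qed.

Lemma kap_inv X Y Z : kap (bracket X Y) Z = kap X (bracket Y Z).
Proof.
rewrite /kap !vsval_bracket mulmxBl mulmxBr !linearB /= !mulmxA.
by congr (_ - _); rewrite -[in LHS]mulmxA; exact: mxtrace_mulC.
Qed.

Lemma kapZr a X Y : kap X (a *: Y) = a * kap X Y.
Proof. by rewrite /kap !linearZ. Qed.
Lemma kapDr X Y Z : kap X (Y + Z) = kap X Y + kap X Z.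
Proof. by rewrite /kap !linearD. Qed.
Lemma kap0r X : kap X 0 = 0.
Proof. by rewrite /kap !linear0. Qed.
Lemma kapZl a X Y : kap (a *: X) Y = a * kap X Y.
Proof. by rewrite kapC kapZr kapC. Qed.
Lemma kapDl X Y Z : kap (X + Y) Z = kap X Z + kap Y Z.
Proof. by rewrite kapC kapDr !(kapC Z). Qed.
Lemma kap0l X : kap 0 X = 0.
Proof. by rewrite kapC kap0r. Qed.

Hypotheses (Msym : M^T = M) (Munit : M \in unitmx).

(** Every matrix [B] yields the element [B - M^-1 B^T M] of so_5, whose pairing with [A] in so_5 is
    [2 tr(A B)]. So [A] is orthogonal to all matrices, in particular to the elementary ones. *)
Lemma kap_nondeg X : (forall Y, kap X Y = 0) -> X = 0.
Proof.
move=> h; apply: subvs_inj; rewrite linear0; set A := vsval X.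
have As : A^T *m M = - (M *m A) by apply/eqP; rewrite -mem_so5_space subvsP.
have tr0 B : \tr (A *m B) = 0.
  pose Y := B - invmx M *m B^T *m M.
  have Ys : Y \in so5_space M.
    rewrite mem_so5_space /Y linearB /= !trmx_mul trmx_inv Msym trmxK.
    by rewrite mulmxBl mulmxBr !mulmxA mulmxV // mul1mx mulmxKV // opprB.
  have := h (vsproj _ Y); rewrite /kap vsprojK // /Y mulmxBr linearB /=.
  have -> : \tr (A *m (invmx M *m B^T *m M)) = - \tr (A *m B).
    rewrite mulmxA mxtrace_mulC !mulmxA.
    have -> : M *m A = - (A^T *m M) by rewrite As opprK.
    by rewrite !mulNmx mulmxK // linearN /= -trmx_mul mxtrace_tr mxtrace_mulC.
  by rewrite opprK => /eqP; rewrite -mulr2n mulrn_eq0 /= => /eqP.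
apply/matrixP => i j; rewrite mxE -(tr0 (delta_mx j i)).
rewrite /mxtrace (bigD1 i) //= [X in _ + X]big1 ?addr0 => [|k ki].
  rewrite mxE (bigD1 j) //= mxE !eqxx mulr1 big1 ?addr0 // => k kj.
  by rewrite mxE (negPf kj) mulr0.
rewrite mxE big1 // => l _; rewrite mxE (negPf ki) andbF mulr0.
by [].
Qed.

End Bracket.

(** * Weight spaces and the Cartan decomposition *)

Lemma seq_choice (T : eqType) (S : Type) (y0 : S) (P : T -> S -> Prop) (s : seq T) :
  {in s, forall x, exists y, P x y} -> exists f, {in s, forall x, P x (f x)}.
Proof.
elim: s => [|x s IH] h; first by exists (fun _ => y0).
have [|f fP] := IH; first by move=> z zs; apply: h; rewrite inE zs orbT.
have [y Py] := h x (mem_head _ _).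
exists (fun z => if z == x then y else f z) => z.
by rewrite inE; case: eqP => [-> //|_ /= /fP].
Qed.

Section Weights.
Variables (C : numFieldType) (M : 'M[C]_5) (h : {vspace so5 M}).
Variables (V : vectType C) (rho : 'Hom(so5 M, 'End(V))).
Hypothesis rep : is_rep rho.

Lemma repE X Y u : rho X (rho Y u) = rho Y (rho X u) + rho (bracket X Y) u.
Proof. by rewrite rep add_lfunE opp_lfunE !comp_lfunE addrCA subrr addr0. Qed.

Lemma weight_shift (a mu : dual C h) X v :
  root_vector a X -> v \in weight_space rho mu ->
  rho X v \in weight_space rho (mu + a).
Proof.
move=> aX /mem_weight_space muv; apply/mem_weight_space => H.
rewrite repE muv aX !linearZ /= scale_lfunE add_lfunE scalerDl.
by [].
Qed.

Lemma weight_shift_iter (a mu : dual C h) X v k :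
  root_vector a X -> v \in weight_space rho mu ->
  iter k (rho X) v \in weight_space rho (mu + a *+ k).
Proof.
move=> aX muv; elim: k => [|k IH]; first by rewrite addr0.
by rewrite mulrSr addrA iterS; apply: weight_shift.
Qed.

Lemma weight_nilpotent (a mu : dual C h) X v :
  a != 0 -> root_vector a X -> v \in weight_space rho mu ->
  exists N, iter N (rho X) v = 0.
Proof.
move=> /lfunPn[H]; rewrite zero_lfunE => aH aX muv.
apply: (@eigen_seq_zero _ _ (rho (vsval H)) _
  (fun k => (mu H + a H *+ k : C))).
  by move=> i j /addrI /mulrIn; apply.
move=> k; have /mem_weight_space -> := weight_shift_iter k aX muv.
by rewrite add_lfunE; congr (( _ + _) *: _); elim: k => [|k IH];
  rewrite ?mulr0n ?zero_lfunE // !mulrS add_lfunE IH.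
Qed.

Lemma coord_weight n (b : n.-tuple V) (wt : V -> dual C h) mu v (i : 'I_n) :
    basis_of fullv b -> {in b, forall u, u \in weight_space rho (wt u)} ->
    v \in weight_space rho mu -> wt b`_i != mu ->
  coord b i v = 0.
Proof.
move=> bb wtP /mem_weight_space hv /lfunPn[H ne].
have fb : free b by case/andP: bb.
have vE := coord_basis bb (memvf v).
have : coord b i (rho (vsval H) v) = coord b i (mu H *: v) by rewrite hv.
rewrite linearZ /= [in LHS]vE !linear_sum /= (bigD1 i) //= big1 => [|j ji].
  have /wtP/mem_weight_space bi : b`_i \in b by rewrite mem_nth ?size_tuple.
  rewrite !linearZ /= bi !linearZ /= coord_free // eqxx mulr1 addr0 mulrC => /eqP.
  by rewrite -subr_eq0 -mulrBl mulf_eq0 subr_eq0 (negPf ne) => /eqP.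
have /wtP/mem_weight_space bj : b`_j \in b by rewrite mem_nth ?size_tuple.
rewrite !linearZ /= bj !linearZ /= coord_free //.
by rewrite (negPf ji) !mulr0.
Qed.

Lemma weight_basis_dim n (b : n.-tuple V) (wt : V -> dual C h) mu :
    basis_of fullv b -> {in b, forall v, v \in weight_space rho (wt v)} ->
  \dim (weight_space rho mu) = count (fun v => wt v == mu) b.
Proof.
move=> bb wtP; have /andP[/eqP sb fb] := bb.
pose s := filter (fun v => wt v == mu) b.
have fs : free s by apply: filter_free.
rewrite -size_filter -/s; move/eqP: (fs) => <-; congr (\dim _).
apply/vspaceP => v; apply/idP/idP; last first.
  suff /subvP : (<<s>> <= weight_space rho mu)%VS by apply.
  by apply/span_subvP => u; rewrite mem_filter => /andP[/eqP <- /wtP].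
move=> /mem_weight_space hv.
have vE : v = \sum_i coord b i v *: b`_i by rewrite -coord_span // sb memvf.
rewrite vE; apply: memv_suml => i _.
have [e|ne] := eqVneq (wt b`_i) mu.
  by apply/memvZ/memv_span; rewrite mem_filter e eqxx mem_nth ?size_tuple.
by rewrite (coord_weight bb wtP (mu := mu)) ?scale0r ?mem0v //; apply/mem_weight_space.
Qed.

End Weights.

Section CartanDecomposition.
Variables (C : numFieldType) (M : 'M[C]_5) (h : {vspace so5 M}).
Hypothesis h_cartan : is_cartan h.

Lemma root_vectorE (a : dual C h) X :
  root_vector a X <-> X \in weight_space (adjoint M) a.
Proof.
split=> [aX|/mem_weight_space aX]; last by move=> H; rewrite -adjointE.
by apply/mem_weight_space => H; rewrite adjointE.
Qed.

Lemma span_bind (T : vectType C) (P : T -> Prop) (s : seq T) :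
    {in s, forall Y, exists t, {in t, forall Z, P Z} /\ Y \in <<t>>%VS} ->
  exists t, {in t, forall Z, P Z} /\ (<<s>> <= <<t>>)%VS.
Proof.
elim: s => [|Y s IH] hs; first by exists [::]; split=> //; rewrite subvv.
have [|t [tP st]] := IH; first by move=> Z Zs; apply: hs; rewrite inE Zs orbT.
have [t' [t'P Yt]] := hs Y (mem_head _ _).
exists (t' ++ t); split=> [Z|].
  by rewrite mem_cat => /orP[/t'P|/tP].
by rewrite span_cons span_cat addvS // -memvE.
Qed.

(** Simultaneous diagonalization, one element of [Hs] at a time: each joint eigenvector found so far
    is split into its components for the new [ad H]. *)
Lemma joint_eigenvectors (Hs : seq (so5 M)) : {subset Hs <= h} ->
  forall X, exists s,
    {in s, forall Y, {in Hs, forall H, exists c : C, bracket H Y = c *: Y}} /\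
    X \in <<s>>%VS.
Proof.
have [habel _ hdiag] := h_cartan.
elim: Hs => [|H Hs IH] sub X.
  by exists [:: X]; split=> //; rewrite memv_span ?mem_head.
have Hh : H \in h by apply: sub; rewrite mem_head.
have subs : {subset Hs <= h} by move=> Y Ys; apply: sub; rewrite inE Ys orbT.
have [s [sP Xs]] := IH subs X.
have [|t [tP st]] := @span_bind _ (fun Y =>
    {in H :: Hs, forall H', exists c : C, bracket H' Y = c *: Y}) s.
  move=> Y /sP Yeig.
  have [e be eeig] := hdiag H Hh.
  have [|n [ev [u [evi ueig Yu]]]] := @eigenbasis_components _ _ (ad H) _ be _ Y.
    by move=> Z Ze; have [c cE] := eeig Z Ze; exists c; rewrite adE.
  exists [seq u i | i <- enum 'I_n]; split; last first.
    rewrite Yu; apply: memv_suml => i _.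
    by rewrite memv_span // map_f ?mem_enum.
  move=> _ /mapP[i _ ->] H'; rewrite inE => /orP[/eqP ->|H's].
    by exists (ev i); rewrite -adE.
  have [c cE] := Yeig H' H's; exists c.
  (* The eigenspaces of the earlier [ad H'] are stable under [ad H], as [h] is abelian, so they
     contain each component along with the whole vector. *)
  have : u i \in passmx.leigenspace (ad H') c.
    apply: (@eigen_components _ _ _ (ad H) _ ev (index_enum _) u) => //.
    - move=> Z; rewrite !memv_ker !add_lfunE !opp_lfunE !scale_lfunE !id_lfunE !adE.
      rewrite !subr_eq0 jacobi (habel H' H (subs _ H's) Hh) => /eqP ->.
      by rewrite linearZ /= (bracketC 0) linear0 oppr0 add0r.
    - exact: index_enum_uniq.
    - by move=> i1 j1 _ _; apply: evi.
    - by rewrite -Yu memv_ker add_lfunE opp_lfunE scale_lfunE id_lfunE adE subr_eq0 cE.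
    - by rewrite mem_index_enum.
  by rewrite memv_ker add_lfunE opp_lfunE scale_lfunE id_lfunE adE subr_eq0 => /eqP.
by exists t; split=> //; apply: (subvP st).
Qed.

Definition cartan_coord (i : 'I_(\dim h)) (H : subvs_of h) : C^o :=
  coord (vbasis h) i (vsval H).

Fact cartan_coord_linear i : linear (cartan_coord i).
Proof. by move=> a H H'; rewrite /cartan_coord !linearP. Qed.

HB.instance Definition _ i :=
  GRing.isLinear.Build C (subvs_of h) C^o _ (cartan_coord i)
    (cartan_coord_linear i).

Lemma joint_eigenvector_root X :
  {in vbasis h, forall H, exists c : C, bracket H X = c *: X} ->
  exists a : dual C h, root_vector a X.
Proof.
move=> /(seq_choice 0)[c cP].
exists (\sum_(i < \dim h) (c (vbasis h)`_i : C) *: linfun (cartan_coord i)) => H.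
rewrite {1}[vsval H](coord_vbasis (subvsP H)) sum_lfunE scaler_suml.
rewrite bracketC linear_sum -sumrN; apply: eq_bigr => i _.
rewrite linearZ /= -scalerN -bracketC cP ?mem_nth ?size_tuple //.
by rewrite scalerA scale_lfunE lfunE /= /cartan_coord mulrC.
Qed.

(** The Cartan decomposition in the form of a basis; the weight zero is allowed and accounts for [h]
    itself. *)
Lemma root_basis : exists b : (\dim {: so5 M}).-tuple (so5 M),
  exists wt : so5 M -> dual C h,
  basis_of fullv b /\ {in b, forall X, root_vector (wt X) X}.
Proof.
have [|t [tP st]] := @span_bind _ (fun Y => exists a : dual C h, root_vector a Y)
    (vbasis {: so5 M}).
  move=> Y _; have [|s [sP Ys]] := @joint_eigenvectors (vbasis h) _ Y.
    by move=> Z /vbasis_mem.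
  by exists s; split=> // Z Zs; apply: joint_eigenvector_root; apply: sP.
have [b bt bb] := basis_in_seq t.
have tf : <<t>>%VS = fullv.
  apply/eqP; rewrite eqEsubv subvf /=; apply: subv_trans st.
  by rewrite (span_basis (vbasisP _)) subvv.
rewrite tf in bb.
have sz : size b == \dim {: so5 M}.
  by move/andP: bb => [/eqP <- /eqP ->].
have [wt wtP] : exists wt, {in b, forall X, root_vector (wt X : dual C h) X}.
  by apply: (@seq_choice _ _ 0 (fun X (a : dual C h) => root_vector a X)) => X /bt /tP.
by exists (Tuple sz), wt.
Qed.

Lemma root_vector0 X : root_vector (0 : dual C h) X <-> X \in h.
Proof.
have [habel hself _] := h_cartan.
split=> [X0|Xh H]; last by rewrite habel ?subvsP // zero_lfunE scale0r.
apply: hself => H Hh; have := X0 (vsproj h H).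
by rewrite vsprojK // zero_lfunE scale0r.
Qed.

Lemma root_vectorZ (a : dual C h) c X : root_vector a X -> root_vector a (c *: X).
Proof. by move=> aX H; rewrite linearZ /= aX !scalerA mulrC. Qed.

Lemma root_vectorB (a b : dual C h) X Y :
  root_vector a X -> root_vector b Y -> root_vector (a + b) (bracket X Y).
Proof.
move=> /[dup] aX _ /root_vectorE bY; apply/root_vectorE.
by rewrite -adjointE addrC; apply: weight_shift aX bY; apply: adjoint_rep.
Qed.

Lemma kap_root (a b : dual C h) X Y :
  root_vector a X -> root_vector b Y -> a + b != 0 -> kap X Y = 0.
Proof.
move=> aX bY /lfunPn[H]; rewrite add_lfunE zero_lfunE => ab.
have : kap (bracket (vsval H) X) Y = - kap X (bracket (vsval H) Y).
  by rewrite bracketC -scaleN1r kapZl kap_inv mulN1r.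
rewrite aX bY kapZl kapZr => /eqP; rewrite -addr_eq0 -mulrDl mulf_eq0.
by rewrite (negPf ab) => /eqP.
Qed.

Hypotheses (Msym : M^T = M) (Munit : M \in unitmx).

(** By nondegeneracy some member of the root basis pairs nontrivially with [X], and by [kap_root]
    its weight can only be [- a]. The case [a = 0] is used too: it makes the form nondegenerate on
    [h]. *)
Lemma root_pairing (a : dual C h) X : X != 0 -> root_vector a X ->
  exists2 Y, root_vector (- a) Y & kap X Y = 1.
Proof.
move=> X0 aX; have [b [wt [bb wtP]]] := root_basis.
have /hasP[Y Yb XY] : has (fun Y => kap X Y != 0) b.
  apply: contraNT X0 => /hasPn nb; apply/eqP/(kap_nondeg Msym Munit) => Y.
  rewrite (coord_basis bb (memvf Y)) linear_sum /=; apply: big1 => i _.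
  have bi : b`_i \in b by rewrite mem_nth ?size_tuple.
  by rewrite kapZr; move: (nb _ bi); rewrite negbK => /eqP ->; rewrite mulr0.
have e : wt Y = - a.
  apply/eqP; rewrite -addr_eq0; apply: contraNT XY => ne.
  apply/eqP; apply: kap_root aX (wtP Y Yb) _; apply: contra ne.
  by rewrite addrC.
exists ((kap X Y)^-1 *: Y); last by rewrite kapZr mulVf.
by apply: root_vectorZ; rewrite -e; apply: wtP.
Qed.

Lemma cartan_nondeg (T : subvs_of h) :
  (forall H : subvs_of h, kap (vsval T) (vsval H) = 0) -> T = 0.
Proof.
move=> hT; apply/eqP/negPn/negP => T0.
have [||Y] := @root_pairing 0 (vsval T).
- by apply: contra T0 => /eqP e; apply/eqP/subvs_inj; rewrite e linear0.
- by apply/root_vector0; apply: subvsP.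
rewrite oppr0 => /root_vector0 Yh.
rewrite -(vsprojK Yh) hT => /eqP.
by rewrite eq_sym oner_eq0.
Qed.

Definition td (a : dual C h) : subvs_of h := ((linfun (@to_dual C M h))^-1)%VF a.

(** The operation [^-1%VF] inverts a map only on its image, so [to_dual] must be onto. It is
    injective by [cartan_nondeg], and both spaces have the same dimension. *)
Lemma tdE (a : dual C h) (H : subvs_of h) :
  kap (vsval (td a)) (vsval H) = a H.
Proof.
have inj : (fullv :&: lker (linfun (@to_dual C M h)) = 0)%VS.
  apply/eqP; rewrite -subv0; apply/subvP => T /memv_capP[_].
  rewrite memv_ker lfunE /= memv0 => /eqP T0; apply/eqP/cartan_nondeg => H'.
  by have := congr1 (fun g : dual C h => g H') T0; rewrite lfunE zero_lfunE.
have surj : limg (linfun (@to_dual C M h)) = fullv.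
  apply/eqP; rewrite eqEdim subvf (limg_dim_eq inj) !dimvf.
  by rewrite /dim /= muln1.
have := @limg_lfunVK _ _ _ (linfun (@to_dual C M h)) a.
rewrite surj memvf => /(_ isT) e.
by rewrite -[in RHS]e lfunE /= lfunE.
Qed.

Lemma dual_formE (a b : dual C h) : dual_form a b = a (td b). Proof. by []. Qed.

Lemma dual_formC (a b : dual C h) : dual_form a b = dual_form b a.
Proof. by rewrite !dual_formE -!tdE kapC. Qed.

Lemma dual_formDl (a b c : dual C h) :
  dual_form (a + b) c = dual_form a c + dual_form b c.
Proof. by rewrite /dual_form add_lfunE. Qed.

Lemma dual_formZl k (a b : dual C h) : dual_form (k *: a) b = k * dual_form a b.
Proof. by rewrite /dual_form scale_lfunE. Qed.

Lemma dual_formNl (a b : dual C h) : dual_form (- a) b = - dual_form a b.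
Proof. by rewrite /dual_form opp_lfunE. Qed.

Lemma dual_formDr (a b c : dual C h) :
  dual_form a (b + c) = dual_form a b + dual_form a c.
Proof. by rewrite !(dual_formC a) dual_formDl. Qed.

Lemma dual_formNr (a b : dual C h) : dual_form a (- b) = - dual_form a b.
Proof. by rewrite !(dual_formC a) dual_formNl. Qed.

Lemma bracket_opposite (a : dual C h) X Y :
  root_vector a X -> root_vector (- a) Y ->
  bracket X Y = kap X Y *: vsval (td a).
Proof.
move=> aX aY.
have : root_vector (0 : dual C h) (bracket X Y).
  by rewrite -(subrr a); apply: root_vectorB.
move=> /root_vector0 h0; rewrite -(vsprojK h0) -linearZ; congr vsval.
apply/eqP; rewrite -subr_eq0; apply/eqP; apply: cartan_nondeg => H.
rewrite linearB linearZ /= vsprojK //. rewrite scalerN -scaleNr kapDl kapZl tdE.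
rewrite kap_inv (bracketC Y) -scaleN1r kapZr aY kapZr opp_lfunE.
by rewrite mulN1r !mulNr opprK mulrC subrr.
Qed.

End CartanDecomposition.

(** * sl_2-triples of roots and symmetry of weight multiplicities *)

Section RootTheory.
Variables (C : numFieldType) (M : 'M[C]_5).
Hypotheses (Msym : M^T = M) (Munit : M \in unitmx).
Variable h : {vspace so5 M}.
Hypothesis h_cartan : is_cartan h.

Let tdE := tdE h_cartan Msym Munit.
Let dual_formC := dual_formC h_cartan Msym Munit.
Let root_pairing := root_pairing h_cartan Msym Munit.
Let bracket_opposite := bracket_opposite h_cartan Msym Munit.

Lemma cartan_separated (T : subvs_of h) :
  (forall b : dual C h, b T = 0) -> T = 0.
Proof.
move=> bT; apply: (cartan_nondeg h_cartan Msym Munit) => H.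
by have := bT (to_dual H); rewrite lfunE kapC.
Qed.

Section Sl2OfRoot.
Variables (a : dual C h) (e f : so5 M).
Hypotheses (ae : root_vector a e) (af : root_vector (- a) f).
Hypotheses (ef1 : kap e f = 1) (aa : dual_form a a != 0).
Variables (V : vectType C) (rho : 'Hom(so5 M, 'End(V))).
Hypothesis rep : is_rep rho.

Let k := 2 / dual_form a a.
Let E := rho e.
Let F := k *: rho f.
Let H := k *: rho (vsval (td a)).

(** The factor [k] turns [td a] into the coroot of [a]; rescaling [f] by it gives the standard
    relations, so weights of [H] are coroot pairings. *)
Lemma sl2_of_root :
  [/\ forall u, H (E u) = E (H u) + 2 *: E u,
      forall u, H (F u) = F (H u) - 2 *: F u,
      forall u, E (F u) = F (E u) + H u &
      forall (mu : dual C h) v, v \in weight_space rho mu ->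
        H v = coroot_pairing mu a *: v].
Proof.
have ka : k * dual_form a a = 2 by rewrite mulfVK.
split=> [u|u|u|mu v /mem_weight_space muv]; rewrite /H /F /E !scale_lfunE.
- rewrite (repE rep) ae !linearZ scale_lfunE scalerDr; congr (_ + _).
  by rewrite scalerA -dual_formE ka.
- rewrite !linearZ /= (repE rep) af opp_lfunE !linearZ scale_lfunE /=.
  rewrite !scalerDr; congr (_ + _).
  by rewrite !scalerN !scalerA -scaleNr -dual_formE -ka; congr (_ *: _); ring.
- rewrite !linearZ /= (repE rep) (bracket_opposite ae af) ef1 scale1r.
  by rewrite scalerDr.
- rewrite muv scalerA /coroot_pairing -dual_formE; congr (_ *: _).
  by rewrite /k mulrAC.
Qed.

End Sl2OfRoot.

Variables (a1 a2 : dual C h).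
Hypothesis a_simple : simple_roots a1 a2.

Lemma simple_span (b : dual C h) : exists c1 c2, b = c1 *: a1 + c2 *: a2.
Proof.
have [_ _ /andP[/eqP sp _] _] := a_simple.
have : b \in <<[:: a1; a2]>>%VS by rewrite sp memvf.
rewrite span_cons span_seq1 => /memv_addP[_ /vlineP[c1 ->] [_ /vlineP[c2 ->] ->]].
by exists c1, c2.
Qed.

Lemma simple_free (c1 c2 : C) : c1 *: a1 + c2 *: a2 = 0 -> c1 = 0 /\ c2 = 0.
Proof.
have [_ _ /andP[_ fr] _] := a_simple.
move: fr; rewrite free_cons seq1_free span_seq1 => /andP[a1n a20].
have [->|c10] := eqVneq c1 0.
  by rewrite scale0r add0r => /eqP; rewrite scaler_eq0 (negPf a20) orbF => /eqP.
move=> /eqP; rewrite addr_eq0 => /eqP e.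
case/negP: a1n; apply/vlineP; exists (- (c1^-1 * c2)).
by rewrite scaleNr -scalerA -scalerN -e scalerA mulVf // scale1r.
Qed.

Lemma dim_cartan : \dim h = 2%N.
Proof.
have [_ _ /size_basis sz _] := a_simple.
move: sz; rewrite dimvf /dim /= muln1.
by [].
Qed.

Lemma root_neq0 (a : dual C h) : is_root a -> a != 0. Proof. by case. Qed.

Lemma is_root_opp (a : dual C h) : is_root a -> is_root (- a).
Proof.
move=> [a0 [X X0 aX]]; split; first by rewrite oppr_eq0.
have [Y aY XY] := root_pairing X0 aX; exists Y => //.
by apply/eqP => Y0; move/eqP: XY; rewrite Y0 kap0r eq_sym oner_eq0.
Qed.

(** If [a] were isotropic, [td a] would commute with the root vectors of [a] and [- a]. Then
    [heisenberg_trivial] in the adjoint representation makes every root vanish on [td a]. As [a1]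
    and [a2] span the dual, [td a] and hence [a] would be zero. *)
Lemma root_norm_neq0 (a : dual C h) : is_root a -> dual_form a a != 0.
Proof.
move=> [a0 [X X0 aX]]; have [Y aY XY] := root_pairing X0 aX.
apply/negP => /eqP aa0.
have rep := @adjoint_rep C M.
have comm Z : root_vector a Z \/ root_vector (- a) Z ->
    bracket (vsval (td a)) Z = 0.
  by case=> ->; rewrite ?opp_lfunE -dual_formE aa0 ?oppr0 scale0r.
have eig (b : dual C h) Z : Z != 0 -> root_vector b Z -> b (td a) = 0.
  move=> Z0 /[dup] bZ /root_vectorE bZ'.
  apply: (@heisenberg_trivial _ _ (adjoint M X) (adjoint M Y)
     (adjoint M (vsval (td a))) _ Z) => //.
  - by move=> u; rewrite (repE rep) comm ?linear0 ?zero_lfunE ?addr0; auto.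
  - by move=> u; rewrite (repE rep) comm ?linear0 ?zero_lfunE ?addr0; auto.
  - by move=> u; rewrite (repE rep) (bracket_opposite aX aY) XY scale1r.
  - by rewrite adjointE bZ.
  - by have := weight_nilpotent rep a0 aX bZ'.
  - move=> k; have := weight_shift_iter rep k aX bZ'.
    have na0 : - a != 0 by rewrite oppr_eq0.
    by move=> /(weight_nilpotent rep na0 aY).
have td0 : td a = 0.
  apply: cartan_separated => b; have [c1 [c2 ->]] := simple_span b.
  have [[_ [X1 X10 aX1]] [_ [X2 X20 aX2]] _ _] := a_simple.
  by rewrite add_lfunE !scale_lfunE (eig _ _ X10 aX1) (eig _ _ X20 aX2) !scaler0 addr0.
case/negP: a0; apply/eqP/lfunP => H.
by rewrite zero_lfunE -tdE td0 linear0 kap0l.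
Qed.

Lemma root_triple (a : dual C h) : is_root a ->
  exists e f, [/\ root_vector a e, root_vector (- a) f & kap e f = 1].
Proof.
move=> [_ [X X0 aX]]; have [Y aY XY] := root_pairing X0 aX.
by exists X, Y.
Qed.

Section RepWeights.
Variables (V : vectType C) (rho : 'Hom(so5 M, 'End(V))).
Hypothesis rep : is_rep rho.

Lemma weight_integral (a mu : dual C h) :
  is_root a -> weight_space rho mu != 0%VS ->
  exists z : int, coroot_pairing mu a = z%:~R.
Proof.
move=> ra; have [e [f [ae af ef]]] := root_triple ra.
have [he hf hef hw] := sl2_of_root ae af ef (root_norm_neq0 ra) rep.
rewrite -vpick0 => v0.
by apply: (sl2_integral he hf hef v0); apply: hw; apply: memv_pick.
Qed.

Lemma coroot_pairingDl (mu nu a : dual C h) :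
  coroot_pairing (mu + nu) a = coroot_pairing mu a + coroot_pairing nu a.
Proof. by rewrite /coroot_pairing dual_formDl mulrDr mulrDl. Qed.

Lemma coroot_pairingZl c (mu a : dual C h) :
  coroot_pairing (c *: mu) a = c * coroot_pairing mu a.
Proof. by rewrite /coroot_pairing dual_formZl !mulrA (mulrC 2). Qed.

Lemma coroot_pairingNr (mu a : dual C h) :
  coroot_pairing mu (- a) = - coroot_pairing mu a.
Proof.
by rewrite /coroot_pairing dual_formNr // !dual_formNl dual_formNr // opprK mulrN mulNr.
Qed.

(** By [sl2_lowering_inj] with [j = k], the [k]-th power of [f] is injective on the weight space of
    [mu], and it lands in that of the reflected weight. Equality follows by reflecting back. *)
Lemma weight_reflection_nat (a mu : dual C h) (k : nat) :
  is_root a -> coroot_pairing mu a = k%:R ->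
  (\dim (weight_space rho mu) <= \dim (weight_space rho (mu - a *+ k)%R))%N.
Proof.
move=> ra muk; have [e [f [ae af ef]]] := root_triple ra.
have [he hf hef hw] := sl2_of_root ae af ef (root_norm_neq0 ra) rep.
pose F := rho f; pose Fk := iter k (fun g => F \o g)%VF \1%VF.
have FkE u : Fk u = iter k F u.
  by rewrite /Fk; elim: k {muk Fk} => [|k IH] /=; rewrite ?id_lfunE // comp_lfunE IH.
rewrite -(@limg_dim_eq _ _ _ Fk).
  apply: dimvS; apply/subvP => _ /memv_imgP[v muv ->]; rewrite FkE -mulNrn.
  exact: weight_shift_iter.
apply/eqP; rewrite -subv0; apply/subvP => v /memv_capP[muv].
rewrite memv_ker FkE memv0 => /eqP Fv; apply/eqP.
apply: (sl2_lowering_inj he hf hef (k := k) (j := k)) => //.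
  by rewrite (hw _ _ muv) muk.
have iterZ c j u : iter j (c *: rho f) u = c ^+ j *: iter j F u.
  elim: j => [|j IH]; first by rewrite scale1r.
  by rewrite !iterS IH linearZ /= scale_lfunE scalerA -exprSr.
by rewrite iterZ Fv scaler0.
Qed.

Lemma weight_reflection (a mu : dual C h) (z : int) :
  is_root a -> coroot_pairing mu a = z%:~R ->
  \dim (weight_space rho (mu - a *~ z)) = \dim (weight_space rho mu).
Proof.
have le (b nu : dual C h) (y : int) : is_root b -> coroot_pairing nu b = y%:~R ->
    (\dim (weight_space rho nu) <= \dim (weight_space rho (nu - b *~ y)%R))%N.
  move=> rb; case: y => y yE; first exact: weight_reflection_nat.
  have -> : nu - b *~ Negz y = nu - (- b) *+ y.+1.
    by rewrite NegzE mulrNz mulNrn.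
  apply: weight_reflection_nat; first exact: is_root_opp.
  by rewrite coroot_pairingNr yE NegzE mulrNz opprK.
move=> ra muz; apply/eqP; rewrite eqn_leq le // andbT.
have e : coroot_pairing (mu - a *~ z) a = (- z)%:~R.
  rewrite coroot_pairingDl muz -mulrNz -scaler_int coroot_pairingZl.
  have -> : coroot_pairing a a = 2.
    by rewrite /coroot_pairing mulfK // root_norm_neq0.
  by ring.
have := le a _ _ ra e; rewrite mulrNz opprK subrK.
by [].
Qed.

End RepWeights.
End RootTheory.

(** * The root system B_2 *)

Section B2Combinatorics.
Variables (D : int -> int -> Prop) (A B : int).
Hypothesis D0 : ~ D 0 0.
Hypothesis D10 : D 1 0.
Hypothesis D01 : D 0 1.
Hypothesis Dopp : forall p q, D p q -> D (- p) (- q).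
Hypothesis Dsign : forall p q, D p q -> (0 <= p) && (0 <= q) \/ (p <= 0) && (q <= 0).
Hypothesis Dp0 : forall p, D p 0 -> p = 1 \/ p = -1.
Hypothesis Dq0 : forall q, D 0 q -> q = 1 \/ q = -1.
Hypothesis Ds1 : forall p q, D p q -> D (- p - A * q) q.
Hypothesis Ds2 : forall p q, D p q -> D p (- q - B * p).
Hypothesis AB0 : A = 0 <-> B = 0.
Hypothesis Dle : forall L : seq (int * int), uniq L ->
  {in L, forall v, D v.1 v.2} -> (size L <= 8)%N.
Hypothesis Dge : forall L : seq (int * int),
  (forall p q, D p q -> (p, q) \in L) -> (8 <= size L)%N.

Lemma cartan_integers_le0 : A <= 0 /\ B <= 0.
Proof.
split; first by have := Dsign (Ds1 D01); lia.
by have := Dsign (Ds2 D10); lia.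
Qed.

Definition root_list := [:: (1, 0); (0, 1); (- A, 1); (1, - B);
  (-1, 0); (0, -1); (A, -1); (-1, B)] : seq (int * int).

(** Here [D p q] stands for [p a1 + q a2] being a root, and [A], [B] are the off-diagonal Cartan
    integers. The count of eight rules out [A = 0], which allows four roots, and [A = B = -1], where
    the six roots of A_2 cannot be enlarged to eight. Otherwise [root_list] already has eight
    distinct members and is everything. *)
Lemma cartan_integers :
  (A = -2 /\ B = -1 \/ A = -1 /\ B = -2) /\
  (forall p q, D p q -> (p, q) \in root_list).
Proof.
have [Ale Ble] := cartan_integers_le0.
have An0 : A <> 0.
  move=> A0; have B0 := AB0.1 A0.
  pose L4 := [:: (1, 0); (-1, 0); (0, 1); (0, -1)] : seq (int * int).
  suff : (8 <= size L4)%N by [].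
  apply: Dge => p q Dpq.
  have := Dsign Dpq; have := Dsign (Ds1 Dpq).
  have [q0|qn0] := eqVneq q 0.
    by move: Dpq; rewrite q0 => /Dp0 [] ->; rewrite !inE eqxx ?orbT.
  have [p0|pn0] := eqVneq p 0.
    by move: Dpq; rewrite p0 => /Dq0 [] ->; rewrite !inE eqxx ?orbT.
  by move/eqP: qn0; move/eqP: pn0; rewrite A0; lia.
have Bn0 : B <> 0 by move=> B0; apply/An0/AB0.
have Dm10 : D (-1) 0 by have := Dopp D10; rewrite oppr0.
have D0m1 : D 0 (-1) by have := Dopp D01; rewrite oppr0.
have DA1 : D (- A) 1 by have := Ds1 D01; rewrite oppr0 add0r mulr1.
have D1B : D 1 (- B) by have := Ds2 D10; rewrite oppr0 add0r mulr1.
have DA1' : D A (-1) by have := Dopp DA1; rewrite opprK.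
have D1B' : D (-1) B by have := Dopp D1B; rewrite opprK.
have [/andP[/eqP A1 /eqP B1]|nAB] := boolP ((A == -1) && (B == -1)).
  pose L6 := [:: (1, 0); (-1, 0); (0, 1); (0, -1); (1, 1); (-1, -1)] : seq (int * int).
  suff : (8 <= size L6)%N by [].
  apply: Dge => p q Dpq; apply/negPn/negP => nL.
  (* An involution that maps [L6] into itself maps the complement of [L6] into itself. *)
  have closed (u : int * int -> int * int) :
      all (fun v => u v \in L6) L6 -> (forall v, u (u v) = v) -> u (p, q) \notin L6.
    by move=> /allP cl uK; apply: contra nL => /cl; rewrite uK.
  have pq0 : ~ (p = 0 /\ q = 0) by case=> p0 q0; move: Dpq; rewrite p0 q0.
  have nL' : (- p, - q) \notin L6.
    by apply: (closed (fun v => (- v.1, - v.2))) => // -[x y]; rewrite !opprK.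
  have n1 : (- p + q, q) \notin L6.
    by apply: (closed (fun v => (- v.1 + v.2, v.2))) => // -[x y]; congr (_, _); rewrite /=; lia.
  have n2 : (p, - q + p) \notin L6.
    by apply: (closed (fun v => (v.1, - v.2 + v.1))) => // -[x y]; congr (_, _); rewrite /=; lia.
  have L8 p' q' : D p' q' -> (p', q') \in [:: (p, q), (- p, - q) & L6].
    move=> Dpq'; apply/negPn/negP => nL8.
    suff : (size [:: (p', q'), (p, q), (- p, - q) & L6] <= 8)%N by [].
    apply: Dle => [|v].
      rewrite cons_uniq nL8 /= [in X in X && _]inE negb_or nL nL' !andbT.
      by rewrite xpair_eqE; apply/negP => /andP[/eqP ? /eqP ?]; apply: pq0; lia.
    rewrite !inE => /orP[/eqP -> //|/orP[/eqP -> //|]].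
    move=> /orP[/eqP ->|]; first exact: Dopp.
    do 5![move=> /orP[/eqP -> //|]]; first by move: D1B; rewrite B1 opprK.
    by move=> /eqP -> /=; move: D1B'; rewrite B1.
  (* Each simple reflection sends the extra root to itself or to its negative, which leaves only
     [p = q = 0]. *)
  move: (L8 _ _ (Ds1 Dpq)) (L8 _ _ (Ds2 Dpq)).
  clearbody L6; rewrite A1 B1 !mulN1r !opprK !inE (negPf n1) (negPf n2) !orbF !xpair_eqE.
  by move=> /orP[] /andP[/eqP ? /eqP ?] /orP[] /andP[/eqP ? /eqP ?]; apply: pq0; lia.
have Dall p q : D p q -> (p, q) \in root_list.
  move=> Dpq; apply/negPn/negP => nL.
  suff : (size ((p, q) :: root_list) <= 8)%N by [].
  apply: Dle => [|v].
    rewrite cons_uniq nL /= !inE !negb_or !xpair_eqE.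
    by do ![apply/andP; split] => //=; move: nAB; lia.
  rewrite inE => /orP[/eqP -> //|]; rewrite !inE.
  by do 7![move=> /orP[/eqP -> //|]]; move=> /eqP ->.
split=> //.
(* The first reflection sends [(1, - B)] to [(A B - 1, - B)]; its membership in the list forces
   [A B = 2]. *)
have := Dall _ _ (Ds1 D1B); rewrite !inE !xpair_eqE => h.
have AB2 : A * B = 2.
  move: h; rewrite mulrN; set k := A * B.
  by do 7?[case/orP]; move=> /andP[/eqP ? /eqP ?]; move: nAB; lia.
have : A = -1 \/ A = -2.
  by move: AB2; have [|] := ltP A (-2); nia.
by case=> A1; move: AB2; rewrite A1; lia.
Qed.

End B2Combinatorics.

(** After Schur triangularization the diagonal entries are the eigenvalues, so the trace of the
    square is a sum of squares of integers. *)
Lemma trace_sqr_ge0 (C : numClosedFieldType) n (A : 'M[C]_n.+1) :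
  (forall a, eigenvalue A a -> exists z : int, a = z%:~R) -> 0 <= \tr (A *m A).
Proof.
move=> intA; have [P Pu] := spectral.Schur A (ltn0Sn n).
have Pun := spectral.unitarymx_unit Pu.
rewrite /similar_to /= conjumx // => trigT; set T := (P *m A *m invmx P) in trigT.
have -> : \tr (A *m A) = \tr (T *m T).
  by rewrite /T !mulmxA mulmxKV // [RHS]mxtrace_mulC !mulmxA mulVmx // mul1mx.
rewrite /mxtrace; apply: sumr_ge0 => i _; rewrite mxE (bigD1 i) //=.
rewrite [X in _ + X]big1 ?addr0 => [|j ji].
  have /intA[z ->] : eigenvalue A (T i i).
    have : eigenvalue T (T i i).
      rewrite eigenvalue_root_char char_poly_trig // rootE horner_prod.
      by rewrite (bigD1 i) //= !hornerE subrr mul0r.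
    move=> /eigenvalueP[v vT v0]; apply/eigenvalueP; exists (v *m P).
      rewrite -mulmxA -[P *m A](mulmxKV Pun) -/T mulmxA vT -scalemxAl.
      by [].
    by apply: contra v0 => /eqP vP; rewrite -(mulmxK Pun v) vP mul0mx.
  by rewrite -intrM ler0z -expr2 sqr_ge0.
have /is_trig_mxP tr := trigT.
by case: (ltngtP i j) ji => [ij|ij|/val_inj ->] //; rewrite ?eqxx //
  (tr _ _ ij) ?mul0r ?mulr0.
Qed.

Lemma sum_count_eq (T S : eqType) (f : T -> S) (s : seq T) (L : seq S) :
  uniq L -> (\sum_(a <- L) count (fun v => f v == a) s)%N
            = count (fun v => f v \in L) s.
Proof.
move=> uL; elim: s => [|v s IH] /=; first by rewrite big1.
rewrite big_split /= IH; congr (_ + _)%N.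
rewrite -(count_uniq_mem _ uL) -sum1_count [RHS]big_mkcond /=.
by apply: eq_bigr => a _; rewrite eq_sym; case: eqP.
Qed.

Section RootSystem.
Variables (C : numFieldType) (M : 'M[C]_5).
Hypotheses (Msym : M^T = M) (Munit : M \in unitmx).
Variable h : {vspace so5 M}.
Hypothesis h_cartan : is_cartan h.
Variables (a1 a2 : dual C h).
Hypothesis a_simple : simple_roots a1 a2.

Let root_triple := root_triple Msym Munit h_cartan.
Let root_norm_neq0 := root_norm_neq0 Msym Munit h_cartan a_simple.
Let bracket_opposite := bracket_opposite h_cartan Msym Munit.
Let sl2_of_root := sl2_of_root Msym Munit h_cartan.

Lemma is_rootE (a : dual C h) :
  is_root a <-> a != 0 /\ weight_space (adjoint M) a != 0%VS.
Proof.
split=> [[a0 [X X0 /root_vectorE aX]]|[a0 w0]]; split=> //.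
  by apply: contra X0 => /eqP w0; rewrite -memv0 -w0.
exists (vpick (weight_space (adjoint M) a)); first by rewrite vpick0.
by apply/root_vectorE/memv_pick.
Qed.

Lemma coroot_pairing_self (a : dual C h) : is_root a -> coroot_pairing a a = 2.
Proof. by move=> /root_norm_neq0 a0; rewrite /coroot_pairing mulfK. Qed.

(** The difference of the two sides is orthogonal to [f], hence commutes with it by
    [bracket_opposite]; a vector of sl_2-weight 2 killed by one lowering is zero. *)
Lemma root_line (a : dual C h) e f X : is_root a ->
  root_vector a e -> root_vector (- a) f -> kap e f = 1 -> root_vector a X ->
  X = kap X f *: e.
Proof.
move=> ra ae af ef aX.
have [he hf hef hw] := sl2_of_root ae af ef (root_norm_neq0 ra) (@adjoint_rep C M).
apply/eqP; rewrite -subr_eq0; apply/eqP.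
set Z := X - _.
have aZ : root_vector a Z.
  move=> H; rewrite linearB /= (root_vectorZ (kap X f) ae) aX.
  by rewrite scalerBr.
apply: (sl2_lowering_inj he hf hef (k := 2) (j := 1)) => //.
  by rewrite (hw a) ?coroot_pairing_self //; apply/root_vectorE.
have Zf : kap Z f = 0 by rewrite /Z -scaleNr kapDl kapZl ef mulr1 subrr.
rewrite /= scale_lfunE adjointE bracketC (bracket_opposite aZ af).
by rewrite Zf scale0r oppr0 scaler0.
Qed.

Lemma root_space_dim (a : dual C h) : is_root a ->
  \dim (weight_space (adjoint M) a) = 1%N.
Proof.
move=> ra; have [e [f [ae af ef]]] := root_triple ra.
have -> : weight_space (adjoint M) a = <[e]>%VS.
  apply/vspaceP => X; apply/idP/idP => [/root_vectorE aX|/vlineP[c ->]].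
    by apply/vlineP; exists (kap X f); apply: root_line ae af ef aX.
  by apply/memvZ/root_vectorE.
rewrite dim_vline; case: eqP => // e0.
by move/eqP: ef; rewrite e0 kap0l eq_sym oner_eq0.
Qed.

(** Lowering [Z] by [k - 1] steps reaches the line of [e], and three more lowerings lead through
    [td a] and [f] to zero. But [Z] has sl_2-weight [2 k], which is at least [k + 2], so [Z] would
    vanish. *)
Lemma root_multiple (a : dual C h) k : (1 < k)%N -> is_root a -> ~ is_root (a *+ k).
Proof.
move=> k1 ra [_ [Z Z0 kaZ]]; have [e [f [ae af ef]]] := root_triple ra.
have [he hf hef hw] := sl2_of_root ae af ef (root_norm_neq0 ra) (@adjoint_rep C M).
set c := 2 / _ in hf hef hw.
case/negP: Z0; apply/eqP.
apply: (sl2_lowering_inj he hf hef (k := k.*2) (j := k.+2)) => //.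
- rewrite (hw (a *+ k)); last exact/root_vectorE.
  rewrite -scaler_nat coroot_pairingZl coroot_pairing_self //.
  by rewrite -natrM muln2.
- by rewrite -addnn -addn2 leq_add2l.
have wt j : root_vector (a *+ k - a *+ j) (iter j (c *: adjoint M f) Z).
  elim: j => [|j IH]; first by rewrite mulr0n subr0.
  rewrite iterS scale_lfunE adjointE; apply: root_vectorZ.
  by rewrite mulrSr opprD addrA addrC; apply: root_vectorB.
have E1 : exists x, iter k.-1 (c *: adjoint M f) Z = x *: e.
  exists (kap (iter k.-1 (c *: adjoint M f) Z) f).
  apply: root_line ae af ef _ => //; have := wt k.-1.
  have -> : a *+ k - a *+ k.-1 = a.
    by rewrite -{1}(prednK (ltnW k1)) mulrS addrK.
  by [].
case: E1 => x E1; have kE : k.+2 = k.-1.+3 by rewrite (prednK (ltnW k1)).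
rewrite kE !iterS E1 !scale_lfunE !linearZ /= !adjointE.
rewrite (bracketC f e) (bracket_opposite ae af) ef scale1r.
rewrite linearN /= (bracketC f (vsval _)) af !linearN !linearZ /= bracketxx.
by rewrite !(scaler0, oppr0).
Qed.

Lemma dim_so5_full : \dim {: so5 M} = 10%N.
Proof. by rewrite dimvf /dim /= dim_so5. Qed.

Lemma weight_space0 : \dim (weight_space (adjoint M) (0 : dual C h)) = 2%N.
Proof.
rewrite -[RHS](dim_cartan a_simple); congr (\dim _); apply/vspaceP => X.
by apply/idP/idP => [/root_vectorE/(root_vector0 h_cartan)|
  /(root_vector0 h_cartan)/root_vectorE].
Qed.

(** A basis of root vectors has ten members, two of weight zero and exactly one for each root.
    Bounds on arbitrary lists, here and in [root_count_ge], express the exact count before any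
    enumeration of the roots is known. *)
Lemma root_count_le (L : seq (dual C h)) :
  uniq L -> {in L, forall a, is_root a} -> (size L <= 8)%N.
Proof.
move=> uL Lr; have [b [wt [bb wtP]]] := root_basis h_cartan.
have wtP' : {in b, forall v, v \in weight_space (adjoint M) (wt v)}.
  by move=> v vb; apply/root_vectorE/wtP.
have sb : size b = 10%N by rewrite size_tuple dim_so5_full.
have dE mu := weight_basis_dim mu bb wtP'.
have u0 : uniq (0 :: L).
  by rewrite /= uL andbT; apply/negP => /Lr /root_neq0; rewrite eqxx.
have := count_size (fun v => wt v \in 0 :: L) b.
rewrite -sum_count_eq // sb big_cons -dE weight_space0.
rewrite -[10%N]/(2 + 8)%N leq_add2l; apply: leq_trans.
rewrite -sum1_size [X in (_ <= X)%N]big_seq [X in (X <= _)%N]big_seq.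
apply: leq_sum => a /Lr /root_space_dim; rewrite dE => ->.
by [].
Qed.

Lemma root_count_ge (L : seq (dual C h)) :
  (forall a, is_root a -> a \in L) -> (8 <= size L)%N.
Proof.
move=> Lr; have [b [wt [bb wtP]]] := root_basis h_cartan.
have wtP' : {in b, forall v, v \in weight_space (adjoint M) (wt v)}.
  by move=> v vb; apply/root_vectorE/wtP.
have sb : size b = 10%N by rewrite size_tuple dim_so5_full.
have dE mu := weight_basis_dim mu bb wtP'.
pose L' := filter (fun a => a != 0) (undup L).
have uL : uniq (0 :: L') by rewrite /= mem_filter eqxx filter_uniq ?undup_uniq.
have bL : count (fun v => wt v \in 0 :: L') b = 10%N.
  rewrite -sb.
  apply/eqP; rewrite -all_count; apply/allP => v vb.
  rewrite inE mem_filter mem_undup; case: eqVneq => //= wn.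
  apply: Lr; split=> //; exists v; last exact: wtP.
  by have /andP[_ fb] := bb; apply: free_not0 fb vb.
have : (10 <= 2 + size L')%N.
  rewrite -[X in (X <= _)%N]bL -sum_count_eq // big_cons -dE weight_space0 leq_add2l.
  rewrite -sum1_size [X in (X <= _)%N]big_seq [X in (_ <= X)%N]big_seq.
  apply: leq_sum => a; rewrite mem_filter => /andP[a0 _].
  rewrite -dE; have [->|w0] := eqVneq (weight_space (adjoint M) a) 0%VS.
    by rewrite dimv0.
  by rewrite root_space_dim //; apply/is_rootE.
move=> le; apply: leq_trans (_ : 8 <= size L')%N _; first by [].
by rewrite size_filter (leq_trans (count_size _ _)) ?size_undup.
Qed.

Definition root_comb (p q : int) : dual C h := a1 *~ p + a2 *~ q.

Lemma rootv_inj p q p' q' : root_comb p q = root_comb p' q' -> p = p' /\ q = q'.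
Proof.
move=> /eqP; rewrite -subr_eq0 /root_comb opprD addrACA -!mulrzBr => /eqP.
rewrite -!scaler_int => /(simple_free a_simple)[/eqP + /eqP].
by rewrite !intr_eq0 !subr_eq0 => /eqP -> /eqP ->.
Qed.

Lemma rootvD p q p' q' : root_comb p q + root_comb p' q' = root_comb (p + p') (q + q').
Proof. by rewrite /root_comb !mulrzDr addrACA. Qed.

Lemma rootvN p q : - root_comb p q = root_comb (- p) (- q).
Proof. by rewrite /root_comb opprD !mulrNz. Qed.

Lemma rootv_subl p q k : root_comb (p - k) q = root_comb p q - a1 *~ k.
Proof. by rewrite /root_comb mulrzBr addrAC. Qed.

Lemma rootv_subr p q k : root_comb p (q - k) = root_comb p q - a2 *~ k.
Proof. by rewrite /root_comb mulrzBr addrA. Qed.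

Lemma rootvP (b : dual C h) : is_root b -> exists p q, b = root_comb p q /\
  ((0 <= p) && (0 <= q) \/ (p <= 0) && (q <= 0)).
Proof.
have [_ _ _ sgn] := a_simple => rb.
case: (sgn b rb) => [[m1 [m2 e]]|[m1 [m2 e]]].
  by exists m1%:Z, m2%:Z; split; [rewrite e /root_comb -!pmulrn | left].
exists (- m1%:Z), (- m2%:Z); split; last by right; rewrite !oppr_le0.
by rewrite -rootvN -[b]opprK e /root_comb -!pmulrn.
Qed.

Lemma rootv_reflect (a : dual C h) (p q : int) (k : int) :
  is_root a -> coroot_pairing (root_comb p q) a = k%:~R ->
  is_root (root_comb p q) -> is_root (root_comb p q - a *~ k).
Proof.
move=> ra pk /[dup] rpq /is_rootE[n0 w0]; apply/is_rootE.
have e := weight_reflection Msym Munit h_cartan a_simple (@adjoint_rep C M) ra pk.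
split; last by rewrite -dimv_eq0 e dimv_eq0.
apply/eqP => /subr0_eq E; case/negP: n0.
have : coroot_pairing (root_comb p q) a = 2 * k%:~R.
  by rewrite E -scaler_int coroot_pairingZl coroot_pairing_self // mulrC.
rewrite pk => /eqP; rewrite -subr_eq0 -{1}[k%:~R]mul1r -mulrBl mulf_eq0.
rewrite intr_eq0 => /orP[|/eqP k0]; last by rewrite E k0.
have -> : (1 - 2 : C) = -1 by ring.
by rewrite oppr_eq0 oner_eq0.
Qed.

End RootSystem.

Section RootSystemB2.
Variables (C : numClosedFieldType) (M : 'M[C]_5).
Hypotheses (Msym : M^T = M) (Munit : M \in unitmx).
Variable h : {vspace so5 M}.
Hypothesis h_cartan : is_cartan h.

(** The coroot [k *: td a], acting on row vectors of length 5, has integral eigenvalues by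
    [sl2_integral], and the trace of its square is [4 / dual_form a a]. *)
Lemma root_norm_inv_ge0 (a : dual C h) : is_root a -> dual_form a a != 0 ->
  0 <= (dual_form a a)^-1.
Proof.
move=> ra aa; have [e [f [ae af ef]]] := root_triple Msym Munit h_cartan ra.
set k := 2 / dual_form a a.
have ka : k * dual_form a a = 2 by rewrite mulfVK.
pose t := vsval (td a).
have te : vsval t *m vsval e - vsval e *m vsval t = dual_form a a *: vsval e.
  by rewrite -vsval_bracket ae linearZ.
have tf : vsval t *m vsval f - vsval f *m vsval t = - dual_form a a *: vsval f.
  by rewrite -vsval_bracket af opp_lfunE linearZ.
have eft : vsval e *m vsval f - vsval f *m vsval e = vsval t.
  by rewrite -vsval_bracket (bracket_opposite h_cartan Msym Munit ae af) ef scale1r.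
(* On row vectors the matrices act from the right, so e and f trade places. *)
pose R (A : 'M[C]_5) : 'End('rV[C]_5) := linfun (mulmxr A).
pose E := R (k *: vsval f); pose F := R (vsval e); pose H := R (k *: vsval t).
have RE A u : R A u = u *m A by rewrite lfunE.
have int_eig z : eigenvalue (k *: vsval t) z -> exists n : int, z = n%:~R.
  move=> /eigenvalueP[v vz v0].
  apply: (@sl2_integral _ _ E F H _ _ _ z v) => // [u|u|u|]; last by rewrite RE.
  - have K1 : (k *: vsval f) *m (k *: vsval t) =
        (k *: vsval t) *m (k *: vsval f) + 2 *: (k *: vsval f).
      rewrite -!scalemxAl -!scalemxAr; move/eqP: tf; rewrite subr_eq => /eqP ->.
      rewrite !scalerDr !scalerA addrAC -scalerDl.
      set c := (X in X *: vsval f); have -> : c = 0 by rewrite /c -ka; ring.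
      by rewrite scale0r add0r.
    by rewrite !RE -!mulmxA K1 mulmxDr -[in LHS](scalemxAr 2).
  - have K2 : vsval e *m (k *: vsval t) =
        (k *: vsval t) *m vsval e - 2 *: vsval e.
      rewrite -scalemxAl -scalemxAr; move/eqP: te; rewrite subr_eq => /eqP ->.
      by rewrite scalerDr scalerA ka [RHS]addrAC subrr add0r.
    by rewrite !RE -!mulmxA K2 mulmxBr -[in LHS](scalemxAr 2).
  - rewrite !RE -!mulmxA -mulmxDr -scalemxAr -scalemxAl -scalerDr; congr (u *m (k *: _)).
    by rewrite -eft addrC subrK.
have := trace_sqr_ge0 int_eig.
rewrite -scalemxAl -scalemxAr scalerA linearZ /=.
have -> : \tr (vsval t *m vsval t) = dual_form a a.
  by rewrite dual_formE -(tdE h_cartan Msym Munit).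
rewrite -mulrA ka -/k /k => h0.
have : 0 <= (2 * 2)^-1 * (2 / dual_form a a * 2).
  by apply: mulr_ge0; rewrite // invr_ge0 mulr_ge0 // ler0n.
by congr (0 <= _); field.
Qed.

Variables (a1 a2 : dual C h).
Hypothesis a_simple : simple_roots a1 a2.
Hypothesis a2_long : long_second a1 a2.

Notation rootv := (root_comb a1 a2).

Lemma so5_root_system :
  [/\ dual_form a1 a2 = - dual_form a1 a1,
      dual_form a2 a2 = 2 * dual_form a1 a1 &
      forall p q, is_root (rootv p q) <-> (p, q) \in root_list (-2) (-1)].
Proof.
have [r1 r2 _ _] := a_simple.
have rep := @adjoint_rep C M.
have e10 : rootv 1 0 = a1 by rewrite /root_comb mulr1z mulr0z addr0.
have e01 : rootv 0 1 = a2 by rewrite /root_comb mulr1z mulr0z add0r.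
have w1 : weight_space (adjoint M) a1 != 0%VS by have [] := (is_rootE a1).1 r1.
have w2 : weight_space (adjoint M) a2 != 0%VS by have [] := (is_rootE a2).1 r2.
have [A AE] := weight_integral Msym Munit h_cartan a_simple rep r1 w2.
have [B BE] := weight_integral Msym Munit h_cartan a_simple rep r2 w1.
have n1 := root_norm_neq0 Msym Munit h_cartan a_simple r1.
have n2 := root_norm_neq0 Msym Munit h_cartan a_simple r2.
have s1 := coroot_pairing_self Msym Munit h_cartan a_simple r1.
have s2 := coroot_pairing_self Msym Munit h_cartan a_simple r2.
have sym := dual_formC h_cartan Msym Munit a1 a2.
have pair (a : dual C h) p q : coroot_pairing (rootv p q) a =
    coroot_pairing a1 a * p%:~R + coroot_pairing a2 a * q%:~R.
  by rewrite coroot_pairingDl -!scaler_int !coroot_pairingZl !(mulrC _%:~R).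
pose D p q := is_root (rootv p q).
have Dopp p q : D p q -> D (- p) (- q).
  by rewrite /D -rootvN; apply: is_root_opp.
have Ds1 p q : D p q -> D (- p - A * q) q.
  move=> Dpq; rewrite /D.
  have -> : - p - A * q = p - (2 * p + A * q) by ring.
  rewrite rootv_subl.
  apply: rootv_reflect => //; rewrite pair s1 AE; ring.
have Ds2 p q : D p q -> D p (- q - B * p).
  move=> Dpq; rewrite /D.
  have -> : - q - B * p = q - (2 * q + B * p) by ring.
  rewrite rootv_subr.
  apply: rootv_reflect => //; rewrite pair s2 BE; ring.
have mult (a : dual C h) k : is_root a -> is_root (a *~ k) -> k = 1 \/ k = -1.
  move=> ra; case: k => [[|[|k]]|[|k]].
  - by rewrite mulr0z => -[]; rewrite eqxx.
  - by left.
  - by rewrite -pmulrn => /(root_multiple Msym Munit h_cartan a_simple (isT : 1 < k.+2)%N ra).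
  - by right.
  - rewrite NegzE mulrNz => /(is_root_opp Msym Munit h_cartan); rewrite opprK -pmulrn.
    by move/(root_multiple Msym Munit h_cartan a_simple (isT : 1 < k.+2)%N ra).
have D0 : ~ D 0 0 by rewrite /D /root_comb !mulr0z addr0 => -[]; rewrite eqxx.
have D10 : D 1 0 by rewrite /D e10.
have D01 : D 0 1 by rewrite /D e01.
have Dsign p q : D p q -> (0 <= p) && (0 <= q) \/ (p <= 0) && (q <= 0).
  by move=> /(rootvP a_simple)[p' [q' [/(rootv_inj a_simple)[-> ->]]]].
have Dp0 p : D p 0 -> p = 1 \/ p = -1.
  by rewrite /D /root_comb mulr0z addr0; apply: mult.
have Dq0 q : D 0 q -> q = 1 \/ q = -1.
  by rewrite /D /root_comb mulr0z add0r; apply: mult.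
have A0 : A = 0 <-> dual_form a1 a2 = 0.
  rewrite sym; move: AE; rewrite /coroot_pairing => /eqP.
  rewrite (can2_eq (divfK n1) (mulfK n1)) => /eqP e; split=> [A0|e0].
    by move/eqP: e; rewrite A0 mul0r mulf_eq0 pnatr_eq0 /= => /eqP.
  by move/esym/eqP: e; rewrite e0 mulr0 mulf_eq0 intr_eq0 (negPf n1) orbF => /eqP.
have B0 : B = 0 <-> dual_form a1 a2 = 0.
  move: BE; rewrite /coroot_pairing => /eqP.
  rewrite (can2_eq (divfK n2) (mulfK n2)) => /eqP e; split=> [B0|e0].
    by move/eqP: e; rewrite B0 mul0r mulf_eq0 pnatr_eq0 /= => /eqP.
  by move/esym/eqP: e; rewrite e0 mulr0 mulf_eq0 intr_eq0 (negPf n2) orbF => /eqP.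
have AB0 : A = 0 <-> B = 0 by rewrite A0 B0.
have Dle (L : seq (int * int)) : uniq L -> {in L, forall v, D v.1 v.2} -> (size L <= 8)%N.
  move=> uL LD; rewrite -(size_map (fun v => rootv v.1 v.2)).
  apply: (root_count_le Msym Munit h_cartan a_simple).
    rewrite map_inj_uniq // => -[p q] [p' q'] /= /(rootv_inj a_simple)[-> ->].
    by [].
  by move=> _ /mapP[v vL ->]; apply: LD.
have Dge (L : seq (int * int)) : (forall p q, D p q -> (p, q) \in L) -> (8 <= size L)%N.
  move=> LD; rewrite -(size_map (fun v => rootv v.1 v.2)).
  apply: (root_count_ge Msym Munit h_cartan a_simple) => a ra.
  have [p [q [e _]]] := rootvP a_simple ra; rewrite e in ra *.
  by apply/mapP; exists (p, q) => //; apply: LD.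
have [AB Dall] := cartan_integers D0 D10 D01 Dopp Dsign Dp0 Dq0 Ds1 Ds2 AB0 Dle Dge.
set x := dual_form a1 a1 in n1 *.
have eA : dual_form a1 a2 = A%:~R * x / 2.
  by rewrite -AE /coroot_pairing sym -/x; field.
have eB : dual_form a1 a2 = B%:~R * dual_form a2 a2 / 2.
  by rewrite -BE /coroot_pairing; field.
(* In the other case the norm of [a2] is [x / 2] with [x] nonnegative, so [a2] would be the short
   root. *)
have [A2 B1] : A = -2 /\ B = -1.
  case: AB => // -[A1 B2]; exfalso.
  have x2 : dual_form a2 a2 = x / 2.
    move: eB; rewrite eA A1 B2 => /(congr1 (fun z => - z)) e.
    have : dual_form a2 a2 = - ((-2)%:~R * dual_form a2 a2 / 2) by field.
    by rewrite -e => ->; field.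
  have x0 : 0 <= x.
    by rewrite -[x]invrK invr_ge0; apply: root_norm_inv_ge0.
  have := a2_long; rewrite /long_second x2 -/x ltr_pdivlMr // => lt.
  have : x <= x * 2 by rewrite ler_peMr // ler1n.
  by move=> le; have := lt_le_trans lt le; rewrite ltxx.
split.
- by rewrite eA A2; field.
- by move: eB; rewrite eA A2 B1 => /(congr1 (fun z => - 2 * z)) e;
    transitivity (- 2 * ((-1)%:~R * dual_form a2 a2 / 2)); [field | rewrite -e; field].
move=> p q; split=> [/Dall|]; first by rewrite A2 B1.
have D21 : D 2 1 by have := Ds1 _ _ D01; rewrite A2.
have D11 : D 1 1 by have := Ds2 _ _ D10; rewrite B1.
rewrite !inE !xpair_eqE; do 4![case/orP=> [/andP[/eqP -> /eqP ->] //|]].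
case/orP=> [/andP[/eqP -> /eqP ->]|]; first by have := Dopp _ _ D10; rewrite oppr0.
case/orP=> [/andP[/eqP -> /eqP ->]|]; first by have := Dopp _ _ D01; rewrite oppr0.
case/orP=> /andP[/eqP -> /eqP ->]; first exact: (Dopp _ _ D21).
exact: (Dopp _ _ D11).
Qed.
End RootSystemB2.

(** * Casimir element and Freudenthal relations *)

Section Casimir.
Variables (C : numFieldType) (M : 'M[C]_5).
Hypotheses (Msym : M^T = M) (Munit : M \in unitmx).
Variable B : seq (so5 M * so5 M).
Hypothesis expand : forall Z, Z = \sum_(b <- B) kap Z b.2 *: b.1.

Lemma kap_sumr (I : Type) (r : seq I) (F : I -> so5 M) X :
  kap X (\sum_(i <- r) F i) = \sum_(i <- r) kap X (F i).
Proof. exact: (linear_sum (kap X)). Qed.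

Lemma dual_expand Z : Z = \sum_(b <- B) kap Z b.1 *: b.2.
Proof.
apply/eqP; rewrite -subr_eq0; apply/eqP/(kap_nondeg Msym Munit) => U.
rewrite kapC -scaleN1r kapDr kapZr kap_sumr mulN1r {1}[U]expand.
rewrite kapC kap_sumr; apply/eqP; rewrite subr_eq0; apply/eqP.
by apply: eq_bigr => b _; rewrite !kapZr mulrC.
Qed.

Variables (V : vectType C) (rho : 'Hom(so5 M, 'End(V))).
Hypothesis rep : is_rep rho.

Definition casimir : 'End(V) := \sum_(b <- B) (rho b.1 \o rho b.2)%VF.

Lemma casimirE u : casimir u = \sum_(b <- B) rho b.1 (rho b.2 u).
Proof. by rewrite sum_lfunE; apply: eq_bigr => b _; rewrite comp_lfunE. Qed.

(** Both families of commutators are expanded in the dual bases; invariance of the trace form makes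
    their coefficients opposite, so the double sums cancel termwise. *)
Lemma casimir_comm Z u : rho Z (casimir u) = casimir (rho Z u).
Proof.
rewrite !casimirE linear_sum /=; apply/eqP; rewrite -subr_eq0 -sumrB; apply/eqP.
transitivity (\sum_(b <- B) (rho (bracket Z b.1) (rho b.2 u)
                             + rho b.1 (rho (bracket Z b.2) u))).
  apply: eq_bigr => b _; rewrite (repE rep Z b.1) (repE rep Z b.2).
  by rewrite linearD /= addrAC [X in X + _]addrAC subrr add0r addrC.
rewrite big_split /=.
have -> : \sum_(b <- B) rho (bracket Z b.1) (rho b.2 u) =
    \sum_(b <- B) \sum_(c <- B) kap (bracket Z b.1) c.2 *: rho c.1 (rho b.2 u).
  apply: eq_bigr => b _; rewrite {1}[bracket Z b.1]expand linear_sum sum_lfunE.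
  by apply: eq_bigr => c _; rewrite linearZ scale_lfunE.
have -> : \sum_(b <- B) rho b.1 (rho (bracket Z b.2) u) =
    \sum_(b <- B) \sum_(c <- B) kap (bracket Z b.2) c.1 *: rho b.1 (rho c.2 u).
  apply: eq_bigr => b _; rewrite {1}[bracket Z b.2]dual_expand linear_sum.
  rewrite sum_lfunE linear_sum.
  by apply: eq_bigr => c _; rewrite linearZ scale_lfunE linearZ.
rewrite [X in _ + X]exchange_big -big_split /=; apply: big1 => b _.
rewrite -big_split; apply: big1 => c _ /=.
rewrite -scalerDl (bracketC Z b.1) -scaleN1r kapZl kap_inv (kapC _ b.1).
by rewrite mulN1r addNr scale0r.
Qed.

End Casimir.

Section WeightedTrace.
Variables (C : numFieldType) (M : 'M[C]_5) (h : {vspace so5 M}).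
Variables (V : vectType C) (rho : 'Hom(so5 M, 'End(V))).
Hypothesis rep : is_rep rho.
Variables (n : nat) (b : n.-tuple V) (wt : V -> dual C h).
Hypothesis bb : basis_of fullv b.
Hypothesis wtP : {in b, forall v, v \in weight_space rho (wt v)}.

Lemma mem_nth_tuple (i : 'I_n) : b`_i \in b.
Proof. by rewrite mem_nth ?size_tuple. Qed.

(** For [g] preserving the weight space of [mu] this is its trace there; using only diagonal
    coefficients avoids forming the restriction of [g]. *)
Definition wtrace (g : V -> V) (mu : dual C h) : C :=
  \sum_(i < n | wt b`_i == mu) coord b i (g b`_i).

Lemma wtraceD g g' mu : wtrace (fun u => g u + g' u) mu = wtrace g mu + wtrace g' mu.
Proof. by rewrite -big_split; apply: eq_bigr => i _; rewrite linearD. Qed.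

Lemma wtrace_sum (I : Type) (r : seq I) (g : I -> V -> V) mu :
  wtrace (fun u => \sum_(i <- r) g i u) mu = \sum_(i <- r) wtrace (g i) mu.
Proof. by rewrite exchange_big; apply: eq_bigr => i _; rewrite linear_sum. Qed.

Lemma wtraceZ c g mu : wtrace (fun u => c *: g u) mu = c * wtrace g mu.
Proof. by rewrite mulr_sumr; apply: eq_bigr => i _; rewrite linearZ. Qed.

Lemma eq_wtrace g g' mu :
  {in weight_space rho mu, g =1 g'} -> wtrace g mu = wtrace g' mu.
Proof.
move=> gg; apply: eq_bigr => i /eqP e; rewrite gg // -e.
exact/wtP/mem_nth_tuple.
Qed.

Lemma wtrace_id mu : wtrace id mu = (\dim (weight_space rho mu))%:R.
Proof.
rewrite (weight_basis_dim mu bb wtP).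
have fb : free b by case/andP: bb.
rewrite /wtrace (eq_bigr (fun _ => 1)) => [|i _]; last by rewrite coord_free // eqxx.
rewrite -sum1_count natr_sum (big_nth 0) big_mkord size_tuple.
by apply: eq_bigr.
Qed.

Lemma wtrace_cyclic (a mu : dual C h) X Y :
  root_vector a X -> root_vector (- a) Y ->
  wtrace (fun u => rho Y (rho X u)) mu = wtrace (fun u => rho X (rho Y u)) (mu + a).
Proof.
move=> aX aY.
have bw (i : 'I_n) := wtP (mem_nth_tuple i).
have EX (i : 'I_n) : wt b`_i == mu -> rho X b`_i =
    \sum_(j < n | wt b`_j == mu + a) coord b j (rho X b`_i) *: b`_j.
  move=> /eqP wi; rewrite {1}[rho X _](coord_basis bb (memvf _)).
  rewrite (bigID (fun j : 'I_n => wt b`_j == mu + a)) /= [X in _ + X]big1 ?addr0 //.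
  move=> j wj; rewrite (coord_weight bb wtP (mu := mu + a)) ?scale0r // -wi.
  exact: (weight_shift rep aX (bw i)).
have EY (i : 'I_n) : wt b`_i == mu + a -> rho Y b`_i =
    \sum_(j < n | wt b`_j == mu) coord b j (rho Y b`_i) *: b`_j.
  move=> /eqP wi; rewrite {1}[rho Y _](coord_basis bb (memvf _)).
  rewrite (bigID (fun j : 'I_n => wt b`_j == mu)) /= [X in _ + X]big1 ?addr0 //.
  move=> j wj; rewrite (coord_weight bb wtP (mu := mu)) ?scale0r //.
  by rewrite -[mu](addrK a) -wi; exact: (weight_shift rep aY (bw i)).
rewrite /wtrace.
transitivity (\sum_(i < n | wt b`_i == mu) \sum_(j < n | wt b`_j == mu + a)
    coord b j (rho X b`_i) * coord b i (rho Y b`_j)).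
  apply: eq_bigr => i wi; rewrite {1}(EX i wi) !linear_sum /=.
  by apply: eq_bigr => j _; rewrite !linearZ.
rewrite exchange_big /=; apply: eq_bigr => j wj; rewrite {2}(EY j wj) !linear_sum /=.
by apply: eq_bigr => i _; rewrite !linearZ mulrC.
Qed.

End WeightedTrace.

Section HighestWeight.
Variables (C : numFieldType) (M : 'M[C]_5).
Hypotheses (Msym : M^T = M) (Munit : M \in unitmx).
Variable h : {vspace so5 M}.
Hypothesis h_cartan : is_cartan h.
Variables (pos : seq (dual C h)) (e f : dual C h -> so5 M).
Hypothesis ee : {in pos, forall a, root_vector a (e a)}.
Hypothesis ff : {in pos, forall a, root_vector (- a) (f a)}.
Hypothesis ef : {in pos, forall a, kap (e a) (f a) = 1}.
Variable Hs : seq (subvs_of h * subvs_of h).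

Definition dual_basis : seq (so5 M * so5 M) :=
  [seq (vsval H.1, vsval H.2) | H <- Hs] ++ [seq (e a, f a) | a <- pos]
  ++ [seq (f a, e a) | a <- pos].

Hypothesis expand : forall Z, Z = \sum_(b <- dual_basis) kap Z b.2 *: b.1.

Variables (V : vectType C) (rho : 'Hom(so5 M, 'End(V))).
Hypothesis rep : is_rep rho.

(** When [Hs] runs through dual bases of [h] this is (mu, mu + 2 rho), that is |mu + rho|^2 -
    |rho|^2. *)
Definition norm2 (mu : dual C h) : C :=
  \sum_(H <- Hs) (mu H.1 : C) * mu H.2 + \sum_(a <- pos) dual_form mu a.

Lemma rep_opposite (a mu : dual C h) u : a \in pos -> u \in weight_space rho mu ->
  rho (e a) (rho (f a) u) = rho (f a) (rho (e a) u) + dual_form mu a *: u.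
Proof.
move=> ap /mem_weight_space hu; rewrite (repE rep); congr (_ + _).
rewrite (bracket_opposite h_cartan Msym Munit (ee ap) (ff ap)) ef // scale1r.
exact: hu.
Qed.

Lemma casimir_weight (mu : dual C h) u : u \in weight_space rho mu ->
  casimir dual_basis rho u =
    norm2 mu *: u + 2 *: \sum_(a <- pos) rho (f a) (rho (e a) u).
Proof.
move=> hu; rewrite casimirE !big_cat !big_map /= scalerDl -addrA.
congr (_ + _).
  rewrite scaler_suml; apply: eq_bigr => H _.
  move/mem_weight_space: hu => hu.
  by rewrite hu linearZ /= hu scalerA mulrC.
rewrite -big_split scaler_suml scaler_sumr -big_split !big_seq /=.
apply: eq_bigr => a ap; rewrite (rep_opposite ap hu).
by rewrite (addrC _ (_ *: u)) -addrA scaler_nat mulr2n.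
Qed.

Variables (lam : dual C h) (v0 : V).
Hypothesis v0n : v0 != 0.
Hypothesis v0w : v0 \in weight_space rho lam.
Hypothesis v0e : {in pos, forall a, rho (e a) v0 = 0}.
Hypothesis irr : irreducible rho.

(** The eigenspace for the eigenvalue found on [v0] is a nonzero submodule, hence everything. *)
Lemma casimir_scalar u : casimir dual_basis rho u = norm2 lam *: u.
Proof.
pose K := passmx.leigenspace (casimir dual_basis rho) (norm2 lam).
have KE w : (w \in K) = (casimir dual_basis rho w == norm2 lam *: w).
  by rewrite memv_ker add_lfunE opp_lfunE scale_lfunE id_lfunE subr_eq0.
have v0K : v0 \in K.
  rewrite KE (casimir_weight v0w) big_seq big1 ?scaler0 ?addr0 //.
  by move=> a /v0e ->; rewrite linear0.
have [_ /(_ K) []] := irr.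
- move=> X; apply/subvP => _ /memv_imgP[w + ->]; rewrite !KE => /eqP hw.
  by rewrite -(casimir_comm Msym Munit expand rep) hw linearZ.
- by move=> K0; move: v0K; rewrite K0 memv0 (negPf v0n).
by move=> Kf; apply/eqP; rewrite -KE Kf memvf.
Qed.

Fixpoint words k : seq V :=
  if k is k'.+1 then [seq rho (f a) u | a <- pos, u <- words k'] else [:: v0].

Fixpoint words_upto k : seq V :=
  if k is k'.+1 then words_upto k' ++ words k else [:: v0].

Lemma words_uptoP k u : u \in words_upto k -> exists2 j, (j <= k)%N & u \in words j.
Proof.
elim: k => [|k IH]; first by exists 0.
rewrite /= mem_cat => /orP[/IH[j jk uj]|uk]; last by exists k.+1.
by exists j => //; apply: leqW.
Qed.

Lemma words_upto_mem k j u : (j <= k)%N -> u \in words j -> u \in words_upto k.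
Proof.
elim: k => [|k IH]; first by rewrite leqn0 => /eqP ->.
rewrite leq_eqVlt ltnS [words_upto _]/= mem_cat => /orP[/eqP -> ->|jk uj].
  by rewrite orbT.
by rewrite IH.
Qed.

(** The growing spans stabilize at a space stable under all [f a]. It is stable under every [Z] by
    induction on word length, moving [Z] past the leading [f a] at the cost of a bracket;
    irreducibility then makes it everything. *)
Lemma words_span : exists k, <<words_upto k>>%VS = fullv.
Proof.
have inc k : (<<words_upto k>> <= <<words_upto k.+1>>)%VS.
  by apply: sub_span => u uk; rewrite /= mem_cat uk.
have [k kP] := chain_stationary inc.
exists k; set K := <<words_upto k>>%VS in kP *.
have fK (a : dual C h) u : a \in pos -> u \in K -> rho (f a) u \in K.
  move=> ap uK; have : rho (f a) u \in (rho (f a) @: K)%VS by apply: memv_img.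
  apply/subvP; rewrite limg_span; apply/span_subvP => _ /mapP[w + ->].
  move=> /words_uptoP[j jk wj]; apply: (subvP kP); apply: memv_span.
  apply: (@words_upto_mem _ j.+1) => //.
  by apply/allpairsP; exists (a, w).
have v0K : v0 \in K by apply/memv_span/(@words_upto_mem _ 0); rewrite ?mem_head.
have wK j u : u \in words j -> u \in K.
  elim: j u => [|j IH] u; first by rewrite inE => /eqP ->.
  by move=> /allpairsP[[a w] /= [ap /IH wj ->]]; apply: fK.
have stab j u Z : u \in words j -> rho Z u \in K.
  elim: j u Z => [|j IH] u Z.
    rewrite inE => /eqP ->; rewrite [Z]expand linear_sum sum_lfunE.
    rewrite big_seq; apply: memv_suml => b bB; rewrite linearZ scale_lfunE.
    apply: memvZ; move: bB; rewrite !mem_cat => /or3P[]/mapP[x xi ->] /=.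
    - by move/mem_weight_space: v0w => ->; apply: memvZ.
    - by rewrite v0e ?mem0v.
    - exact: fK.
  move=> /allpairsP[[a w] /= [ap wj ->]]; rewrite (repE rep); apply: memvD.
    by apply: fK => //; apply: IH.
  exact: IH.
have [_ /(_ K) []] := irr => //.
- move=> X; rewrite limg_span; apply/span_subvP => _ /mapP[w + ->].
  by move=> /words_uptoP[j _ wj]; apply: stab wj.
- by move=> K0; move: v0K; rewrite K0 memv0 (negPf v0n).
Qed.

Lemma words_weight k u : u \in words k -> exists s : seq (dual C h),
  [/\ size s = k, {subset s <= pos} & u \in weight_space rho (lam - \sum_(a <- s) a)].
Proof.
elim: k u => [|k IH] u.
  by rewrite inE => /eqP ->; exists [::]; rewrite big_nil subr0.
move=> /allpairsP[[a w] /= [ap /IH[s [sk sp ws]] ->]].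
exists (a :: s); split; first by rewrite /= sk.
  by move=> c; rewrite inE => /orP[/eqP ->|/sp].
have := weight_shift rep (ff ap) ws.
by rewrite big_cons opprD addrCA [- a + _]addrC.
Qed.

(** The clause about [s = [::]] is what bounds the multiplicity of [lam] itself by one. *)
Lemma highest_weight_basis :
  exists (b : (\dim {: V}).-tuple V) (wt : V -> dual C h),
  [/\ basis_of fullv b, {in b, forall u, u \in weight_space rho (wt u)} &
     {in b, forall u, exists s, [/\ {subset s <= pos},
       wt u = lam - \sum_(a <- s) a & s = [::] -> u = v0]}].
Proof.
have [k kf] := words_span.
have [b bw bb] := basis_in_seq (words_upto k); rewrite kf in bb.
have sz : size b == \dim {: V} by move/andP: bb => [/eqP <- /eqP ->].
have [s sP] : exists s : V -> seq (dual C h), {in b, forall u,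
    [/\ {subset s u <= pos}, u \in weight_space rho (lam - \sum_(a <- s u) a)
       & s u = [::] -> u = v0]}.
  apply: (@seq_choice _ _ [::] (fun u s => [/\ {subset s <= pos},
    u \in weight_space rho (lam - \sum_(a <- s) a) & s = [::] -> u = v0])).
  move=> u /bw /words_uptoP[j _ /[dup] uj /words_weight[s [sj sp us]]].
  exists s; split=> // s0; move: uj; rewrite -sj s0 inE => /eqP.
  by [].
exists (Tuple sz), (fun u => lam - \sum_(a <- s u) a); split=> //.
  by move=> u /sP[].
by move=> u /sP[s1 s2 s3]; exists (s u).
Qed.

Section Freudenthal.
Variables (n : nat) (b : n.-tuple V) (wt : V -> dual C h).
Hypothesis bb : basis_of fullv b.
Hypothesis wtP : {in b, forall v, v \in weight_space rho (wt v)}.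

Definition mult (mu : dual C h) : C := (\dim (weight_space rho mu))%:R.

Definition string_trace (a mu : dual C h) : C :=
  wtrace b wt (fun u => rho (f a) (rho (e a) u)) mu.

Lemma string_trace_shift (a mu : dual C h) : a \in pos ->
  string_trace a mu = string_trace a (mu + a) + dual_form (mu + a) a * mult (mu + a).
Proof.
move=> ap; rewrite /string_trace (wtrace_cyclic rep bb wtP mu (ee ap) (ff ap)).
rewrite /mult -(wtrace_id bb wtP) -wtraceZ -wtraceD.
by apply: (eq_wtrace wtP) => u uw; rewrite (rep_opposite ap uw).
Qed.

Lemma freudenthal (mu : dual C h) :
  (norm2 lam - norm2 mu) * mult mu = 2 * \sum_(a <- pos) string_trace a mu.
Proof.
rewrite /mult -(wtrace_id bb wtP) mulrBl -!wtraceZ.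
apply/eqP; rewrite subr_eq addrC -wtrace_sum -wtraceZ -wtraceD; apply/eqP.
apply: (eq_wtrace wtP) => u uw.
by rewrite -casimir_scalar (casimir_weight uw).
Qed.

End Freudenthal.
End HighestWeight.

(** * Irreducible so_5-modules in root coordinates *)

Section So5Modules.
Variables (C : numClosedFieldType) (M : 'M[C]_5).
Hypotheses (Msym : M^T = M) (Munit : M \in unitmx).
Variable h : {vspace so5 M}.
Hypothesis h_cartan : is_cartan h.
Variables (a1 a2 : dual C h).
Hypothesis a_simple : simple_roots a1 a2.
Hypothesis a2_long : long_second a1 a2.

Notation rootv := (root_comb a1 a2).

Let x := dual_form a1 a1.

Lemma short_norm_neq0 : x != 0.
Proof. by have [r1 _ _ _] := a_simple; exact: (root_norm_neq0 Msym Munit h_cartan a_simple r1). Qed.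

Let forms := so5_root_system Msym Munit h_cartan a_simple a2_long.

Lemma dual_form12 : dual_form a1 a2 = - x. Proof. by have [] := forms. Qed.
Lemma dual_form22 : dual_form a2 a2 = 2 * x. Proof. by have [] := forms. Qed.
Lemma dual_form21 : dual_form a2 a1 = - x.
Proof. by rewrite (dual_formC h_cartan Msym Munit) dual_form12. Qed.

Definition pos_coords : seq (int * int) := [:: (1, 0); (0, 1); (1, 1); (2, 1)].
Definition pos_roots : seq (dual C h) := [seq rootv c.1 c.2 | c <- pos_coords].

Lemma pos_root_is_root : {in pos_roots, forall a, is_root a}.
Proof.
have [_ _ R] := forms; move=> _ /mapP[[p q] pq ->]; apply/R.
by move: pq; rewrite !inE => /or4P[] /eqP[-> ->].
Qed.

Lemma pos_roots_uniq : uniq pos_roots.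
Proof.
by rewrite map_inj_uniq // => -[p q] [p' q'] /= /(rootv_inj a_simple)[-> ->].
Qed.

Lemma root_sign (a : dual C h) : is_root a -> a \in pos_roots \/ - a \in pos_roots.
Proof.
have [_ _ R] := forms; move=> ra.
have [p [q [e _]]] := rootvP a_simple ra.
have : ((p, q) \in pos_coords) || ((- p, - q) \in pos_coords).
  move: ra; rewrite e => /R; rewrite !inE !xpair_eqE.
  by do 7?[case/orP]; move=> /andP[/eqP -> /eqP ->].
by rewrite e rootvN => /orP[] /(map_f (fun c => rootv c.1 c.2)); [left|right].
Qed.

Lemma pos_roots_add_neq0 (a b : dual C h) :
  a \in pos_roots -> b \in pos_roots -> a + b != 0.
Proof.
move=> /mapP[[p q] pq ->] /mapP[[p' q'] pq' ->] /=; rewrite rootvD.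
apply/eqP => E; have : rootv (p + p') (q + q') = rootv 0 0.
  by rewrite E /root_comb !mulr0z addr0.
move=> /(rootv_inj a_simple); move: pq pq'; rewrite !inE.
by move=> /or4P[] /eqP[-> ->] /or4P[] /eqP[-> ->] [].
Qed.

(** Dual bases of [h]: the second members come from inverting the Gram matrix of [a1], [a2], which
    is [x] times the matrix with rows (1, -1) and (-1, 2). *)
Definition cartan_pairs : seq (subvs_of h * subvs_of h) :=
  [:: (td a1, td (x^-1 *: (2 *: a1 + a2))); (td a2, td (x^-1 *: (a1 + a2)))].

Lemma td_to_dual (H : subvs_of h) : td (to_dual H) = H.
Proof.
apply/eqP; rewrite -subr_eq0; apply/eqP/(cartan_nondeg h_cartan Msym Munit) => H'.
rewrite linearB /= -scaleN1r kapDl kapZl (tdE h_cartan Msym Munit) lfunE /=.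
by rewrite mulN1r subrr.
Qed.

Lemma tdD (b c : dual C h) : td (b + c) = td b + td c.
Proof. by rewrite /td linearD. Qed.

Lemma tdZ k (b : dual C h) : td (k *: b) = k *: td b.
Proof. by rewrite /td linearZ. Qed.

(** By linearity it is enough to expand the vectors of a root basis. For one of nonzero weight,
    orthogonality of root spaces leaves a single term and [root_line] evaluates it; for weight zero
    only [cartan_pairs] contributes. *)
Lemma root_expansion (e f : dual C h -> so5 M) :
    {in pos_roots, forall a, root_vector a (e a)} ->
    {in pos_roots, forall a, root_vector (- a) (f a)} ->
    {in pos_roots, forall a, kap (e a) (f a) = 1} ->
  forall Z, Z = \sum_(b <- dual_basis pos_roots e f cartan_pairs) kap Z b.2 *: b.1.
Proof.
move=> ee ff ef Z.
have [b [wt [bb wtP]]] := root_basis h_cartan.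
pose S Y := \sum_(b <- dual_basis pos_roots e f cartan_pairs) kap Y b.2 *: b.1.
suff bS (i : 'I_(\dim {: so5 M})) : b`_i = S b`_i.
  rewrite -/(S Z); have -> : S Z = \sum_i coord b i Z *: S b`_i.
    rewrite /S {1}(coord_basis bb (memvf Z)); under [RHS]eq_bigr do rewrite scaler_sumr.
    rewrite [RHS]exchange_big /=; apply: eq_bigr => c _.
    rewrite kapC kap_sumr scaler_suml; apply: eq_bigr => i _.
    by rewrite kapZr kapC scalerA.
  rewrite [LHS](coord_basis bb (memvf Z)); apply: eq_bigr => i _.
  by rewrite -bS.
have bi : b`_i \in b by rewrite mem_nth ?size_tuple.
have wtb := wtP _ bi; have := bi; move: b`_i wtb {bi} => Y wY Yb.
have Y0 : Y != 0 by have /andP[_ fb] := bb; apply: free_not0 fb Yb.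
set w := wt Y in wY.
have [P PE] : exists P, P = pos_roots by exists pos_roots.
rewrite /S -PE !big_cat !big_map PE /=.
have h0 (H : subvs_of h) : root_vector (0 : dual C h) (vsval H).
  by apply/(root_vector0 h_cartan)/subvsP.
have [w0|wn0] := eqVneq w 0.
  rewrite w0 in wY.
  rewrite [X in _ + (X + _)]big_seq [X in _ + (_ + X)]big_seq.
  rewrite [X in _ + (X + _)]big1 => [|a ap]; last first.
    rewrite (kap_root wY (ff _ ap)) ?scale0r // add0r oppr_eq0.
    by have [] := pos_root_is_root ap.
  rewrite [X in _ + (_ + X)]big1 => [|a ap]; last first.
    rewrite (kap_root wY (ee _ ap)) ?scale0r // add0r.
    by have [] := pos_root_is_root ap.
  have /(root_vector0 h_cartan) Yh := wY.
  rewrite -(vsprojK Yh) -(td_to_dual (vsproj h Y)).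
  have [c1 [c2 ->]] := simple_span a_simple (to_dual (vsproj h Y)).
  rewrite !addr0 !big_cons big_nil /= addr0.
  rewrite !(tdE h_cartan Msym Munit) -!dual_formE.
  rewrite !(dual_formDl, dual_formZl, dual_formDr h_cartan Msym Munit).
  have fZr k (u v : dual C h) : dual_form u (k *: v) = k * dual_form u v.
    by rewrite !(dual_formC h_cartan Msym Munit u) dual_formZl.
  rewrite !(fZr, dual_formDr h_cartan Msym Munit) dual_form12 dual_form21 dual_form22 -/x.
  rewrite tdD !tdZ linearD !linearZ /=; move: short_norm_neq0; move: (x) (vsval _) (vsval _).
  move=> y t1 t2 yn; congr (_ + _); congr (_ *: _).
    by field.
  by field.
have rw : is_root w by split=> //; exists Y.
rewrite [X in X + _]big1 ?add0r => [|H _]; last first.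
  by rewrite (kap_root wY (h0 _)) ?scale0r // addr0.
have [wp|wp] := root_sign rw.
  rewrite [X in _ + X]big_seq [X in _ + X]big1 ?addr0 => [|a ap]; last first.
    by rewrite (kap_root wY (ee _ ap)) ?scale0r // pos_roots_add_neq0.
  rewrite (bigD1_seq w) ?pos_roots_uniq //= big_seq_cond big1 ?addr0.
    exact: (root_line Msym Munit h_cartan a_simple rw (ee _ wp) (ff _ wp) (ef _ wp) wY).
  move=> a /andP[ap aw]; rewrite (kap_root wY (ff _ ap)) ?scale0r //.
  by rewrite subr_eq0 eq_sym.
rewrite [X in X + _]big_seq [X in X + _]big1 ?add0r => [|a ap]; last first.
  rewrite (kap_root wY (ff _ ap)) ?scale0r //.
  by rewrite -oppr_eq0 opprD opprK pos_roots_add_neq0.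
rewrite (bigD1_seq (- w)) ?pos_roots_uniq //= big_seq_cond big1 ?addr0.
  have wf := ff _ wp; rewrite opprK in wf.
  by apply: (root_line Msym Munit h_cartan a_simple rw wf (ee _ wp) _ wY); rewrite kapC ef.
move=> a /andP[ap aw]; rewrite (kap_root wY (ee _ ap)) ?scale0r //.
by rewrite addrC addr_eq0.
Qed.

Variables (w1 w2 : dual C h).
Hypothesis w_fund : fundamental_weights a1 a2 w1 w2.
Variables (l1 l2 : int) (V : vectType C) (rho : 'Hom(so5 M, 'End(V))).
Let lam := w1 *~ l1 + w2 *~ l2.
Hypothesis V_lam : irreducible_module rho a1 a2 lam.

Definition wmult (p q : int) : nat := \dim (weight_space rho (lam - rootv p q)).

Lemma lam_pairing1 : coroot_pairing lam a1 = l1%:~R.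
Proof.
have [e11 e12 e21 e22] := w_fund.
by rewrite coroot_pairingDl -!scaler_int !coroot_pairingZl e11 e21 mulr1 mulr0 addr0.
Qed.

Lemma lam_pairing2 : coroot_pairing lam a2 = l2%:~R.
Proof.
have [e11 e12 e21 e22] := w_fund.
by rewrite coroot_pairingDl -!scaler_int !coroot_pairingZl e12 e22 mulr1 mulr0 add0r.
Qed.

Lemma lam_form1 : dual_form lam a1 = l1%:~R * x / 2.
Proof. by rewrite -lam_pairing1 /coroot_pairing -/x; field; apply: short_norm_neq0. Qed.

Lemma lam_form2 : dual_form lam a2 = l2%:~R * x.
Proof. by rewrite -lam_pairing2 /coroot_pairing dual_form22; field; apply: short_norm_neq0. Qed.

Lemma dual_formMz (b c : dual C h) (k : int) :
  dual_form (b *~ k) c = k%:~R * dual_form b c.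
Proof. by rewrite -scaler_int dual_formZl. Qed.

Lemma weight_form1 p q :
  dual_form (lam - rootv p q) a1 = x * (l1%:~R / 2 - p%:~R + q%:~R).
Proof.
rewrite dual_formDl lam_form1 dual_formNl dual_formDl !dual_formMz dual_form21 -/x.
by field.
Qed.

Lemma weight_form2 p q :
  dual_form (lam - rootv p q) a2 = x * (l2%:~R + p%:~R - 2 * q%:~R).
Proof.
rewrite dual_formDl lam_form2 dual_formNl dual_formDl !dual_formMz dual_form12 dual_form22.
by ring.
Qed.

Lemma wmult_reflect1 p q : wmult (l1 - p + 2 * q) q = wmult p q.
Proof.
have rep : is_rep rho by have [] := V_lam.
have [r1 _ _ _] := a_simple.
rewrite /wmult -(weight_reflection Msym Munit h_cartan a_simple rep (a := a1)
  (mu := lam - rootv p q) (z := l1 - 2 * p + 2 * q) r1); last first.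
  rewrite /coroot_pairing weight_form1 -/x; have := short_norm_neq0 => xn.
  by field.
congr (\dim (weight_space _ _)).
have -> : l1 - p + 2 * q = p - - (l1 - 2 * p + 2 * q) by ring.
by rewrite rootv_subl mulrNz opprK opprD addrA.
Qed.

Lemma wmult_reflect2 p q : wmult p (l2 + p - q) = wmult p q.
Proof.
have rep : is_rep rho by have [] := V_lam.
have [_ r2 _ _] := a_simple.
rewrite /wmult -(weight_reflection Msym Munit h_cartan a_simple rep (a := a2)
  (mu := lam - rootv p q) (z := l2 + p - 2 * q) r2); last first.
  rewrite /coroot_pairing weight_form2 dual_form22; have := short_norm_neq0 => xn.
  by field.
congr (\dim (weight_space _ _)).
have -> : l2 + p - q = q - - (l2 + p - 2 * q) by ring.
by rewrite rootv_subr mulrNz opprK opprD addrA.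
Qed.

(** This is |lam + rho|^2 - |lam + rho - p a1 - q a2|^2 divided by the norm [x] of the short
    root. *)
Definition weyl_form (p q : int) : int :=
  p * (l1 + 1) + 2 * q * (l2 + 1) - p ^+ 2 + 2 * p * q - 2 * q ^+ 2.

Lemma wmult_properties :
  [/\ wmult 0 0 = 1%N, (forall p q, wmult p q != 0%N -> (0 <= p) && (0 <= q)) &
  exists T : int -> int -> int -> int -> C,
    (forall i j p q, (i, j) \in pos_coords -> T i j p q = T i j (p - i) (q - j) +
      (i%:~R * (l1%:~R / 2 - (p - i)%:~R + (q - j)%:~R)
       + j%:~R * (l2%:~R + (p - i)%:~R - 2 * (q - j)%:~R))
      * (wmult (p - i) (q - j))%:R) /\
    (forall p q, (weyl_form p q)%:~R * (wmult p q)%:R =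
      2 * (T 1 0 p q + T 0 1 p q + T 1 1 p q + T 2 1 p q))].
Proof.
have [rep irr [v0 [v0n v0w v0e]]] := V_lam.
have [ef0 ef0P] : exists ef : dual C h -> so5 M * so5 M, {in pos_roots, forall a,
    [/\ root_vector a (ef a).1, root_vector (- a) (ef a).2
      & kap (ef a).1 (ef a).2 = 1]}.
  apply: (@seq_choice _ _ (0, 0) (fun (a : dual C h) ef => [/\ root_vector a ef.1,
    root_vector (- a) ef.2 & kap ef.1 ef.2 = 1])) => a /pos_root_is_root.
  by case/(root_triple Msym Munit h_cartan) => e [f [? ? ?]]; exists (e, f).
pose e a := (ef0 a).1; pose f a := (ef0 a).2.
have ee : {in pos_roots, forall a, root_vector a (e a)} by move=> a /ef0P[].
have ff : {in pos_roots, forall a, root_vector (- a) (f a)} by move=> a /ef0P[].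
have ef : {in pos_roots, forall a, kap (e a) (f a) = 1} by move=> a /ef0P[].
have expand := root_expansion ee ff ef.
have v0e' : {in pos_roots, forall a, rho (e a) v0 = 0}.
  move=> a ap; apply: (v0e a); [exact: pos_root_is_root| |exact: ee].
  move: ap => /mapP[[p q] pq ->]; move: pq; rewrite !inE.
  have nn (i j : nat) : nonneg_comb a1 a2 (rootv i%:Z j%:Z).
    by exists i, j; rewrite /root_comb -!pmulrn.
  case/or4P=> /eqP[-> ->]; [exact: (nn 1 0)%N|exact: (nn 0 1)%N
    |exact: (nn 1 1)%N|exact: (nn 2 1)%N].
have [b [wt [bb wtP bs]]] :=
  highest_weight_basis ff expand rep v0n v0w v0e' irr.
have wE u : u \in b -> exists p q : int, [/\ 0 <= p, 0 <= q, wt u = lam - rootv p q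
    & (p, q) = (0, 0) -> u = v0].
  move=> /bs[s [sp -> s0]].
  suff [p [q [p0 q0 -> pq0]]] : exists p q : int, [/\ 0 <= p, 0 <= q,
      \sum_(a <- s) a = rootv p q & (p, q) = (0, 0) -> s = [::]].
    by exists p, q; split=> // /pq0 /s0.
  elim: s sp {s0} => [|a s IH] sp.
    by exists 0, 0; rewrite big_nil /root_comb !mulr0z addr0.
  have [|p [q [p0 q0 E _]]] := IH.
    by move=> c cs; apply: sp; rewrite inE cs orbT.
  have /mapP[[i j] ij ae] := sp _ (mem_head _ _).
  exists (i + p), (j + q); rewrite big_cons E ae rootvD.
  have [i0 j0 ij0] : [/\ 0 <= i, 0 <= j & 0 < i + j].
    by move: ij; rewrite !inE => /or4P[] /eqP[-> ->].
  by split=> // [||[]]; lia.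
have dimE p q : wmult p q = count (fun v => wt v == lam - rootv p q) b.
  exact: weight_basis_dim bb wtP.
have lamI p q p' q' : lam - rootv p q = lam - rootv p' q' -> p = p' /\ q = q'.
  by move/addrI/oppr_inj/(rootv_inj a_simple).
split.
- apply/eqP; rewrite eqn_leq; apply/andP; split.
    have ub : uniq b by apply: free_uniq; case/andP: bb.
    rewrite dimE -size_filter; apply: (@uniq_leq_size _ _ [:: v0]).
      exact: filter_uniq.
    move=> u; rewrite mem_filter => /andP[/eqP E ub'].
    have [p [q [_ _ Eu pq]]] := wE u ub'.
    by move: E; rewrite Eu => /lamI[p0 q0]; rewrite pq ?mem_head // p0 q0.
  rewrite lt0n dimv_eq0; apply: contra v0n => /eqP w0.
  rewrite -memv0 -w0; have -> : rootv 0 0 = 0 by rewrite /root_comb !mulr0z addr0.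
  by rewrite subr0.
- move=> p q; rewrite dimE -lt0n -has_count => /hasP[u ub /eqP].
  have [p' [q' [p0 q0 -> _]]] := wE u ub.
  by move=> /lamI[<- <-]; rewrite p0 q0.
have xn := short_norm_neq0.
(* Dividing by the short norm [x] makes all coefficients of the recursion rational. *)
exists (fun i j p q => x^-1 * string_trace e f rho b wt (rootv i j) (lam - rootv p q)).
split=> [i j p q ij|p q].
  have ap := map_f (fun c => rootv c.1 c.2) ij; rewrite -/pos_roots /= in ap.
  rewrite (string_trace_shift Msym Munit h_cartan ee ff ef rep bb wtP _ ap).
  have -> : lam - rootv p q + rootv i j = lam - rootv (p - i) (q - j).
    by rewrite -rootvD -rootvN; move: (rootv p q) (rootv i j) => r r1; rewrite opprB addrA addrAC.
  rewrite mulrDr; congr (_ + _).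
  have -> : dual_form (lam - rootv (p - i) (q - j)) (rootv i j) =
      i%:~R * dual_form (lam - rootv (p - i) (q - j)) a1
      + j%:~R * dual_form (lam - rootv (p - i) (q - j)) a2.
    rewrite dual_formDr // !(dual_formC h_cartan Msym Munit (lam - _)).
    by rewrite !dual_formMz.
  rewrite weight_form1 weight_form2 mulrA; congr (_ * _).
  by field.
have := freudenthal Msym Munit h_cartan ee ff ef expand rep v0n v0w v0e' irr
  bb wtP (lam - rootv p q).
rewrite !big_cons big_nil addr0 /= => F.
rewrite -!mulrDr !addrA in F *.
rewrite mulrCA -F mulrA; congr (_ * _).
(* The quotient by [x] is (mu, mu) computed with the inverse Gram matrix, and [4 a1 + 3 a2] is the
   sum of the positive roots. *)
have nE mu : norm2 pos_roots cartan_pairs mu =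
    (2 * dual_form mu a1 ^+ 2 + 2 * dual_form mu a1 * dual_form mu a2
     + dual_form mu a2 ^+ 2) / x + (4 * dual_form mu a1 + 3 * dual_form mu a2).
  rewrite /norm2 !big_cons !big_nil -!dual_formE /= /root_comb.
  rewrite ?mulr0z ?mulr1z ?addr0 ?add0r.
  have fZr k (u v : dual C h) : dual_form u (k *: v) = k * dual_form u v.
    by rewrite !(dual_formC h_cartan Msym Munit u) dual_formZl.
  have -> : a1 *~ 2 = 2 *: a1 by rewrite -scaler_int.
  rewrite !(fZr, dual_formDr h_cartan Msym Munit).
  by field.
have l0 : lam = lam - rootv 0 0 by rewrite /root_comb !mulr0z addr0 subr0.
rewrite {1}l0 !nE !weight_form1 !weight_form2 /weyl_form.
by field.
Qed.

End So5Modules.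

(** * Weyl character formula *)

(* The coefficients of (1 - x)(1 - y)(1 - x y)(1 - x^2 y), acting by shifts. *)
Definition weyl_diff (R : pzRingType) (g : int -> int -> R) (p q : int) : R :=
  g p q - g (p - 1) q - g p (q - 1) + g (p - 3) (q - 1) + g (p - 1) (q - 2)
  - g (p - 4) (q - 2) - g (p - 3) (q - 3) + g (p - 4) (q - 3).

Section Denominator.
Variables (F : numFieldType) (l1 l2 : int) (m : int -> int -> F).
Variable T : int -> int -> int -> int -> F.

Hypothesis T_shift : forall i j p q, (i, j) \in pos_coords ->
  T i j p q = T i j (p - i) (q - j) +
      (i%:~R * (l1%:~R / 2 - (p - i)%:~R + (q - j)%:~R)
       + j%:~R * (l2%:~R + (p - i)%:~R - 2 * (q - j)%:~R)) * m (p - i) (q - j).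
Hypothesis T_sum : forall p q, (weyl_form l1 l2 p q)%:~R * m p q =
  2 * (T 1 0 p q + T 0 1 p q + T 1 1 p q + T 2 1 p q).

Lemma weyl_form_diff p q : (weyl_form l1 l2 p q)%:~R * weyl_diff m p q = 0.
Proof.
pose g (h : int -> int -> F) (i j : nat) := h (p - i%:Z) (q - j%:Z).
pose W (i j : nat) : F := (weyl_form l1 l2 (p - i%:Z) (q - j%:Z))%:~R.
pose dF i j := W i j * g m i j
  - 2 * (g (T 1 0) i j + g (T 0 1) i j + g (T 1 1) i j + g (T 2 1) i j).
pose P : F := p%:~R; pose Q : F := q%:~R.
pose dR (a b i j i' j' : nat) := g (T a%:Z b%:Z) i j - g (T a%:Z b%:Z) i' j'
  - (a%:R * (l1%:~R / 2 - (P - i'%:R) + (Q - j'%:R))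
     + b%:R * (l2%:~R + (P - i'%:R) - 2 * (Q - j'%:R))) * g m i' j'.
have F0 i j : dF i j = 0 by rewrite /dF /W /g T_sum subrr.
have R0 (a b i j i' j' : nat) : (a%:Z, b%:Z) \in pos_coords ->
    i' = (i + a)%N -> j' = (j + b)%N -> dR a b i j i' j' = 0.
  move=> ab -> ->; rewrite /dR /g (T_shift _ _ ab) !PoszD !opprD !addrA.
  by rewrite /P /Q !natrD !rmorphB /= -!pmulrn; ring.
(* The instances of [dF] carry the eight coefficients of [weyl_diff]. Those of [dR] for a given root
   carry the coefficients of the product of the three factors belonging to the other roots, so that
   all [T] terms cancel. *)
transitivity (
    dF 0 0 - dF 0 1 - dF 1 0 + dF 1 2 + dF 3 1 - dF 3 3 - dF 4 2 + dF 4 3 +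
    2 * (dR 1 0 0 0 1 0 - dR 1 0 0 1 1 1 - dR 1 0 1 1 2 1 + dR 1 0 1 2 2 2 -
    dR 1 0 2 1 3 1 + dR 1 0 2 2 3 2 + dR 1 0 3 2 4 2 - dR 1 0 3 3 4 3) + 2 *
    (dR 0 1 0 0 0 1 - dR 0 1 1 0 1 1 - dR 0 1 1 1 1 2 + dR 0 1 3 1 3 2 + dR
    0 1 3 2 3 3 - dR 0 1 4 2 4 3) + 2 * (dR 1 1 0 0 1 1 - dR 1 1 0 1 1 2 -
    dR 1 1 1 0 2 1 + dR 1 1 1 1 2 2 - dR 1 1 2 1 3 2 + dR 1 1 2 2 3 3 + dR 1
    1 3 1 4 2 - dR 1 1 3 2 4 3) + 2 * (dR 2 1 0 0 2 1 - dR 2 1 0 1 2 2 - dR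
    2 1 1 0 3 1 + dR 2 1 1 2 3 3 + dR 2 1 2 1 4 2 - dR 2 1 2 2 4 3)).
  rewrite /dF /dR /W /weyl_diff /weyl_form.
  have e0 (h : int -> int -> F) : h p q = g h 0 0 by rewrite /g !subr0.
  have e1 (h : int -> int -> F) : h (p - 1) q = g h 1 0 by rewrite /g !subr0.
  have e2 (h : int -> int -> F) : h p (q - 1) = g h 0 1 by rewrite /g !subr0.
  rewrite e0 e1 e2 -[m (p - 3) (q - 1)]/(g m 3 1) -[m (p - 1) (q - 2)]/(g m 1 2).
  rewrite -[m (p - 4) (q - 2)]/(g m 4 2) -[m (p - 3) (q - 3)]/(g m 3 3).
  rewrite -[m (p - 4) (q - 3)]/(g m 4 3) /P /Q.
  by field.
by rewrite !F0 !R0 //; ring.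
Qed.

End Denominator.

Definition delta (p q : int) : rat := ((p == 0) && (q == 0))%:R.

(** * Kostant's partition function *)

Section KostantPartition.

(** The three chamber polynomials are numbered after [quasi_polynomial] 4, 1 and 5: on those cones
    only the identity term of the alternating sum survives. *)
Definition kpoly4 (p : int) : rat :=
  1 / 8 * (-1) ^ p + p%:~R + 1 / 4 * p%:~R ^+ 2 + 7 / 8.
Definition kpoly1 (p q : int) : rat :=
  1 / 2 * p%:~R + 1 / 2 * q%:~R + q%:~R * p%:~R - 1 / 2 * q%:~R ^+ 2 + 7 / 8
  - 1 / 4 * p%:~R ^+ 2 + 1 / 8 * (-1) ^ p.
Definition kpoly5 (q : int) : rat := 1 + 3 / 2 * q%:~R + 1 / 2 * q%:~R ^+ 2.

(** Given by closed formulas instead of by counting; [kostant_diff] is what links it to the positive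
    roots. *)
Definition kostant (p q : int) : rat :=
  if (p < 0) || (q < 0) then 0 else if p <= q then kpoly4 p
  else if p <= 2 * q then kpoly1 p q else kpoly5 q.

Lemma exprN1D (a b : int) : (-1 : rat) ^ (a + b) = (-1) ^ a * (-1) ^ b.
Proof. by rewrite expfzDr. Qed.

Lemma exprN1_even (k : int) : (-1 : rat) ^ (2 * k) = 1.
Proof. by rewrite -exprz_exp (_ : (-1) ^ 2 = 1) ?exp1rz. Qed.

Lemma kostant_neg1 p q : p <= -1 -> kostant p q = 0.
Proof. by rewrite /kostant => h; case: ifP => //; lia. Qed.

Lemma kostant_neg2 p q : q <= -1 -> kostant p q = 0.
Proof. by rewrite /kostant => h; case: ifP => //; lia. Qed.

(* Adjacent quasi-polynomials agree on a margin around their common wall, so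
   each of the three formulas holds slightly outside its chamber. *)
Lemma kostant4 p q : -3 <= p -> p <= q -> kostant p q = kpoly4 p.
Proof.
move=> hp hpq; rewrite /kostant; case: ifP => [neg|_]; last by rewrite hpq.
have : p = -1 \/ p = -2 \/ p = -3 by lia.
by case=> [->|[->|->]].
Qed.

(** The margin -2 is needed for the argument [q - (l1 + l2 + 2)] on cones with [l1 + l2 <= q]; the
    -3 in [kostant4] is needed for [p - (l1 + 2 * l2 + 3)] in the same way. *)
Lemma kostant5 p q : -2 <= q -> 2 * q <= p -> kostant p q = kpoly5 q.
Proof.
move=> hq hpq.
have [q0|q0] := ltP q 0.
  have [->|->] : q = -1 \/ q = -2 by lia.
    by rewrite kostant_neg2.
  by rewrite kostant_neg2.
rewrite /kostant; case: ifP => [|_]; first by lia.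
case: ifP => [h|h].
  have [-> ->] : p = 0 /\ q = 0 by lia.
  by [].
case: ifP => // h2.
have -> : p = 2 * q by lia.
by rewrite /kpoly1 /kpoly5 exprN1_even; field.
Qed.

(** The lower margin absorbs the shift of [p] by [l1 + 1], the other two the shift of [q] by
    [l2 + 1]. *)
Lemma kostant1 p q : -1 <= q -> q - 1 <= p -> p <= 2 * q + 2 ->
  kostant p q = kpoly1 p q.
Proof.
move=> hq h1 h2.
have [pn|pn] := ltP p 0.
  have [[-> ->]|[[-> ->]|[-> ->]]] :
      (p = -1 /\ q = -1) \/ (p = -2 /\ q = -1) \/ (p = -1 /\ q = 0) by lia.
  - by [].
  - by [].
  - by [].
have [qn|qn] := ltP q 0.
  have [-> ->] : p = 0 /\ q = -1 by lia.
  by [].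
have [pq|pq] := leP p q.
  rewrite kostant4 //; last by lia.
  have [->|->] : p = q \/ p = q - 1 by lia.
    by rewrite /kpoly1 /kpoly4; field.
  by rewrite /kpoly1 /kpoly4; field.
have [pq2|pq2] := leP p (2 * q).
  by rewrite /kostant pq2; case: ifP => [|_]; [lia|case: ifP => // ; lia].
rewrite kostant5; [|lia|lia].
have [->|->] : p = 2 * q + 1 \/ p = 2 * q + 2 by lia.
  by rewrite /kpoly1 /kpoly5 exprN1D exprN1_even; field.
have -> : 2 * q + 2 = 2 * (q + 1) by ring.
by rewrite /kpoly1 /kpoly5 exprN1_even; field.
Qed.

(* Removing the two simple roots leaves the partitions into a1 + a2 and
   2 a1 + a2, of which there is at most one. *)
Lemma weyl_diff_factor (g : int -> int -> rat) p q :
  let G p q := g p q - g (p - 1) q - g p (q - 1) + g (p - 1) (q - 1) in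
  weyl_diff g p q = G p q - G (p - 1) (q - 1) - G (p - 2) (q - 1)
    + G (p - 3) (q - 2).
Proof.
rewrite /weyl_diff /=.
have -> : p - 1 - 1 = p - 2 by lia.
have -> : p - 2 - 1 = p - 3 by lia.
have -> : p - 3 - 1 = p - 4 by lia.
have -> : q - 1 - 1 = q - 2 by lia.
have -> : q - 2 - 1 = q - 3 by lia.
ring.
Qed.

(** The right side counts solutions of [p = a + 2 b], [q = a + b] in natural numbers; the only
    candidate is [a = 2 q - p], [b = p - q]. Thanks to the margins all four values fall under one
    formula in each chamber. *)
Lemma kostant_simple_diff p q :
  kostant p q - kostant (p - 1) q - kostant p (q - 1) + kostant (p - 1) (q - 1)
  = ((q <= p) && (p <= 2 * q))%:R.
Proof.
have s1 : (-1 : rat) ^ (p - 1) = - (-1) ^ p.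
  by rewrite exprN1D mulrN1.
have [pn|pn] := ltP p 0.
  rewrite !kostant_neg1; [|lia..]; rewrite (_ : (q <= p) && (p <= 2 * q) = false); last by lia.
  by [].
have [qn|qn] := ltP q 0.
  rewrite !kostant_neg2; [|lia..]; rewrite (_ : (q <= p) && (p <= 2 * q) = false); last by lia.
  by [].
have [pq|pq] : p < q \/ q <= p by lia.
  have -> : kostant p q = kpoly4 p by apply: kostant4; lia.
  have -> : kostant (p - 1) q = kpoly4 (p - 1) by apply: kostant4; lia.
  have -> : kostant p (q - 1) = kpoly4 p by apply: kostant4; lia.
  have -> : kostant (p - 1) (q - 1) = kpoly4 (p - 1) by apply: kostant4; lia.
  rewrite (_ : (q <= p) && (p <= 2 * q) = false); last by lia.
  by move: (kpoly4 p) (kpoly4 (p - 1)) => x y /=; ring.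
have [pq2|pq2] : p <= 2 * q \/ 2 * q < p by lia.
  have -> : kostant p q = kpoly1 p q by apply: kostant1; lia.
  have -> : kostant (p - 1) q = kpoly1 (p - 1) q by apply: kostant1; lia.
  have -> : kostant p (q - 1) = kpoly1 p (q - 1) by apply: kostant1; lia.
  have -> : kostant (p - 1) (q - 1) = kpoly1 (p - 1) (q - 1) by apply: kostant1; lia.
  rewrite (_ : (q <= p) && (p <= 2 * q) = true); last by lia.
  by rewrite /kpoly1 s1 /=; field.
have -> : kostant p q = kpoly5 q by apply: kostant5; lia.
have -> : kostant (p - 1) q = kpoly5 q by apply: kostant5; lia.
have -> : kostant p (q - 1) = kpoly5 (q - 1) by apply: kostant5; lia.
have -> : kostant (p - 1) (q - 1) = kpoly5 (q - 1) by apply: kostant5; lia.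
rewrite (_ : (q <= p) && (p <= 2 * q) = false); last by lia.
by move: (kpoly5 q) (kpoly5 (q - 1)) => x y /=; ring.
Qed.

Lemma kostant_diff p q : weyl_diff kostant p q = delta p q.
Proof.
rewrite weyl_diff_factor /= !kostant_simple_diff /delta.
(* All terms are indicators, so the rational identity reduces to one of natural numbers within reach
   of [lia]. *)
have E (a b c d e : bool) : (a + d = b + c + e)%N ->
    (a%:R - b%:R - c%:R + d%:R : rat) = e%:R.
  by case: a b c d e => [] [] [] [] [].
apply: E; lia.
Qed.

End KostantPartition.

(** For each Weyl group element w: its sign and the coordinates of (lam + rho) - w (lam + rho) in
    the simple roots. *)
Definition weyl_orbit (l1 l2 : int) : seq (int * (int * int)) :=
  [:: (1, (0, 0)); (-1, (l1 + 1, 0)); (-1, (0, l2 + 1));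
      (1, (l1 + 2 * l2 + 3, l2 + 1)); (1, (l1 + 1, l1 + l2 + 2));
      (-1, (2 * l1 + 2 * l2 + 4, l1 + l2 + 2));
      (-1, (l1 + 2 * l2 + 3, l1 + 2 * l2 + 3));
      (1, (2 * l1 + 2 * l2 + 4, l1 + 2 * l2 + 3))].

Definition weyl_alt (l1 l2 : int) (g : int -> int -> rat) (p q : int) : rat :=
  \sum_(c <- weyl_orbit l1 l2) c.1%:~R * g (p - c.2.1) (q - c.2.2).

(** The Weyl denominator identity. It presents both operators as sums of shifts of the same kind, so
    that [weyl_alt_comm] applies. *)
Lemma weyl_diffE g p q : weyl_diff g p q = weyl_alt 0 0 g p q.
Proof.
rewrite /weyl_alt !big_cons big_nil /= !subr0 /weyl_diff.
rewrite !(mulr0, addr0, add0r) !mulr1z !mulrN1z; ring.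
Qed.

Lemma weyl_alt_comm l1 l2 k1 k2 g p q :
  weyl_alt l1 l2 (weyl_alt k1 k2 g) p q = weyl_alt k1 k2 (weyl_alt l1 l2 g) p q.
Proof.
rewrite /weyl_alt; under eq_bigr do rewrite mulr_sumr.
rewrite exchange_big /=; apply: eq_bigr => c _; rewrite mulr_sumr.
apply: eq_bigr => d _; rewrite mulrCA.
by rewrite [p - _ - _]addrAC [q - _ - _]addrAC.
Qed.

Section WeylCharacter.
Variables (l1 l2 : int) (m : int -> int -> rat).
Hypotheses (l1_ge0 : 0 <= l1) (l2_ge0 : 0 <= l2).
Hypothesis m_supp : forall p q, m p q != 0 -> (0 <= p) && (0 <= q).
Hypothesis m00 : m 0 0 = 1.
Hypothesis m_s1 : forall p q, m (l1 - p + 2 * q) q = m p q.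
Hypothesis m_s2 : forall p q, m p (l2 + p - q) = m p q.
Hypothesis m_sphere : forall p q,
  (weyl_form l1 l2 p q)%:~R * weyl_diff m p q = 0.

Let o := weyl_alt l1 l2 delta.
Let r p q := weyl_diff m p q - o p q.

Lemma m_neg p q : (p < 0) || (q < 0) -> m p q = 0.
Proof. by move=> h; apply/eqP/negPn/negP => /m_supp; lia. Qed.

(** The dot reflection, combined with the symmetry [m_s1], exchanges the eight terms in pairs of
    opposite sign. *)
Lemma weyl_diff_s1 p q : weyl_diff m (l1 + 1 - p + 2 * q) q = - weyl_diff m p q.
Proof.
rewrite /weyl_diff.
have -> : m (l1 + 1 - p + 2 * q) q = m (p - 1) q.
  by rewrite -m_s1; congr m; ring.
have -> : m (l1 + 1 - p + 2 * q - 1) q = m p q.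
  by rewrite -m_s1; congr m; ring.
have -> : m (l1 + 1 - p + 2 * q) (q - 1) = m (p - 3) (q - 1).
  by rewrite -m_s1; congr m; ring.
have -> : m (l1 + 1 - p + 2 * q - 3) (q - 1) = m p (q - 1).
  by rewrite -m_s1; congr m; ring.
have -> : m (l1 + 1 - p + 2 * q - 1) (q - 2) = m (p - 4) (q - 2).
  by rewrite -m_s1; congr m; ring.
have -> : m (l1 + 1 - p + 2 * q - 4) (q - 2) = m (p - 1) (q - 2).
  by rewrite -m_s1; congr m; ring.
have -> : m (l1 + 1 - p + 2 * q - 3) (q - 3) = m (p - 4) (q - 3).
  by rewrite -m_s1; congr m; ring.
have -> : m (l1 + 1 - p + 2 * q - 4) (q - 3) = m (p - 3) (q - 3).
  by rewrite -m_s1; congr m; ring.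
ring.
Qed.

Lemma weyl_diff_s2 p q : weyl_diff m p (l2 + 1 + p - q) = - weyl_diff m p q.
Proof.
rewrite /weyl_diff.
have -> : m p (l2 + 1 + p - q) = m p (q - 1).
  by rewrite -m_s2; congr m; ring.
have -> : m (p - 1) (l2 + 1 + p - q) = m (p - 1) (q - 2).
  by rewrite -m_s2; congr m; ring.
have -> : m p (l2 + 1 + p - q - 1) = m p q.
  by rewrite -m_s2; congr m; ring.
have -> : m (p - 3) (l2 + 1 + p - q - 1) = m (p - 3) (q - 3).
  by rewrite -m_s2; congr m; ring.
have -> : m (p - 1) (l2 + 1 + p - q - 2) = m (p - 1) q.
  by rewrite -m_s2; congr m; ring.
have -> : m (p - 4) (l2 + 1 + p - q - 2) = m (p - 4) (q - 3).
  by rewrite -m_s2; congr m; ring.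
have -> : m (p - 3) (l2 + 1 + p - q - 3) = m (p - 3) (q - 1).
  by rewrite -m_s2; congr m; ring.
have -> : m (p - 4) (l2 + 1 + p - q - 3) = m (p - 4) (q - 2).
  by rewrite -m_s2; congr m; ring.
ring.
Qed.

Lemma weyl_alt_delta_s1 p q : o (l1 + 1 - p + 2 * q) q = - o p q.
Proof.
have E A B A' : A' = l1 + 1 - A + 2 * B ->
    delta (l1 + 1 - p + 2 * q - A) (q - B) = delta (p - A') (q - B).
  by move=> ->; congr (nat_of_bool _)%:R; lia.
rewrite /o /weyl_alt !big_cons !big_nil /=.
rewrite (E 0 0 (l1 + 1)) ?(E (l1 + 1) 0 0) ?(E 0 (l2 + 1) (l1 + 2 * l2 + 3))
  ?(E (l1 + 2 * l2 + 3) (l2 + 1) 0)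
  ?(E (l1 + 1) (l1 + l2 + 2) (2 * l1 + 2 * l2 + 4))
  ?(E (2 * l1 + 2 * l2 + 4) (l1 + l2 + 2) (l1 + 1))
  ?(E (l1 + 2 * l2 + 3) (l1 + 2 * l2 + 3) (2 * l1 + 2 * l2 + 4))
  ?(E (2 * l1 + 2 * l2 + 4) (l1 + 2 * l2 + 3) (l1 + 2 * l2 + 3)); try by lia.
by move: delta => d; ring.
Qed.

Lemma weyl_alt_delta_s2 p q : o p (l2 + 1 + p - q) = - o p q.
Proof.
have E A B B' : B' = l2 + 1 + A - B ->
    delta (p - A) (l2 + 1 + p - q - B) = delta (p - A) (q - B').
  by move=> ->; congr (nat_of_bool _)%:R; lia.
rewrite /o /weyl_alt !big_cons !big_nil /=.
rewrite (E 0 0 (l2 + 1)) ?(E 0 (l2 + 1) 0) ?(E (l1 + 1) 0 (l1 + l2 + 2))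
  ?(E (l1 + 1) (l1 + l2 + 2) 0)
  ?(E (l1 + 2 * l2 + 3) (l2 + 1) (l1 + 2 * l2 + 3))
  ?(E (l1 + 2 * l2 + 3) (l1 + 2 * l2 + 3) (l2 + 1))
  ?(E (2 * l1 + 2 * l2 + 4) (l1 + l2 + 2) (l1 + 2 * l2 + 3))
  ?(E (2 * l1 + 2 * l2 + 4) (l1 + 2 * l2 + 3) (l1 + l2 + 2)); try by lia.
by move: delta => d; ring.
Qed.

Lemma weyl_form_delta p q : (weyl_form l1 l2 p q)%:~R * o p q = 0.
Proof.
have E A B : weyl_form l1 l2 A B = 0 ->
    (weyl_form l1 l2 p q)%:~R * delta (p - A) (q - B) = 0.
  move=> W0; rewrite /delta; case: andP => [[/eqP pA /eqP qB]|_]; last by rewrite mulr0.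
  have -> : p = A by lia.
  have -> : q = B by lia.
  by rewrite W0 mul0r.
rewrite /o /weyl_alt mulr_sumr big_seq big1 // => -[s [A B]]; rewrite !inE /= => h.
rewrite mulrCA E ?mulr0 //; move: h.
by do 7?[case/orP]; move=> /eqP[_ -> ->]; rewrite /weyl_form; ring.
Qed.

Lemma defect_supp p q : (p < 0) || (q < 0) -> r p q = 0.
Proof.
move=> h; rewrite /r.
have -> : weyl_diff m p q = 0 by rewrite /weyl_diff !m_neg; [ring|lia..].
have -> : o p q = 0; last by rewrite subr0.
rewrite /o /weyl_alt big_seq big1 // => -[s [A B]]; rewrite !inE /= => hAB.
have [A0 B0] : 0 <= A /\ 0 <= B.
  by move: hAB; do 7?[case/orP]; move=> /eqP[_ -> ->]; lia.
have -> : delta (p - A) (q - B) = 0; last by rewrite mulr0.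
by rewrite /delta (_ : _ && _ = false) //; lia.
Qed.

Lemma defect00 : r 0 0 = 0.
Proof.
rewrite /r /weyl_diff m00.
have mn p q : (p < 0) || (q < 0) -> m p q = 0 := @m_neg p q.
rewrite !mn //.
rewrite /o /weyl_alt big_cons big_seq big1 => [|-[s [A B]]].
  by rewrite /delta /=; ring.
rewrite !inE /= => hAB.
have AB : 0 < A \/ 0 < B.
  by move: hAB; do 6?[case/orP]; move=> /eqP[_ -> ->]; lia.
have -> : delta (0 - A) (0 - B) = 0; last by rewrite mulr0.
by rewrite /delta (_ : _ && _ = false) //; lia.
Qed.

(* A nonzero value of minimal height would sit at a strictly dominant weight on
   the sphere through lam + rho, that is at p = q = 0. *)
Lemma defect_eq0 p q : r p q = 0.
Proof.
have [k] : exists k : nat, p + q < k%:Z by exists (absz (p + q)).+1; lia.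
elim: k p q => [|k IH] p q pqk; first by apply: defect_supp; lia.
have [neg|nn] := boolP ((p < 0) || (q < 0)); first exact: defect_supp.
have s1 : r (l1 + 1 - p + 2 * q) q = - r p q.
  by rewrite /r weyl_diff_s1 weyl_alt_delta_s1; move: (weyl_diff m p q) => y; ring.
have s2 : r p (l2 + 1 + p - q) = - r p q.
  by rewrite /r weyl_diff_s2 weyl_alt_delta_s2; move: (weyl_diff m p q) => y; ring.
have opp0 (y : rat) : y = - y -> y = 0 by lra.
(* The reflection lowers the height, or fixes the point and gives [r = - r], or else mu + rho pairs
   positively with the coroot of [a1]. The same trichotomy follows for [a2]. *)
have [lt1|[eq1|gt1]] : l1 + 1 - p + 2 * q < p \/ l1 + 1 - p + 2 * q = p \/
    p < l1 + 1 - p + 2 * q by lia.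
- by apply/eqP; rewrite -oppr_eq0 -s1 IH //; lia.
- by apply: opp0; rewrite -s1 eq1.
have [lt2|[eq2|gt2]] : l2 + 1 + p - q < q \/ l2 + 1 + p - q = q \/
    q < l2 + 1 + p - q by lia.
- by apply/eqP; rewrite -oppr_eq0 -s2 IH //; lia.
- by apply: opp0; rewrite -s2 eq2.
have [/andP[/eqP -> /eqP ->]|pq0] := boolP ((p == 0) && (q == 0)); first exact: defect00.
have W0 : (weyl_form l1 l2 p q)%:~R * r p q = 0.
  by rewrite /r mulrBr m_sphere weyl_form_delta subrr.
(* Up to scale the form is the pairing of lam - mu with the sum of the strictly dominant weights lam
   + rho and mu + rho. *)
have Wpos : 0 < weyl_form l1 l2 p q.
  have : 2 * weyl_form l1 l2 p q =
      p * (l1 + 1 + (l1 + 1 - 2 * p + 2 * q))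
      + 2 * q * (l2 + 1 + (l2 + 1 + p - 2 * q)) by rewrite /weyl_form; ring.
  have : 0 <= p /\ 0 <= q by lia.
  have : 0 < l1 + 1 - 2 * p + 2 * q by lia.
  have : 0 < l2 + 1 + p - 2 * q by lia.
  move: (l1 + 1 - 2 * p + 2 * q) (l2 + 1 + p - 2 * q) => u v v0 u0 [p0 q0].
  have : p = 0 \/ 0 < p by lia.
  have : q = 0 \/ 0 < q by lia.
  by case=> [q1|q1]; case=> [p1|p1]; move: pq0; rewrite ?p1 ?q1 => pq0 E; nia.
apply/eqP; move/eqP: W0; rewrite mulf_eq0 intr_eq0.
by case/orP=> // /eqP W0; rewrite W0 in Wpos.
Qed.

Lemma weyl_alt_kostant_supp p q :
  (p < 0) || (q < 0) -> weyl_alt l1 l2 kostant p q = 0.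
Proof.
move=> h; rewrite /weyl_alt big_seq big1 // => -[s [A B]]; rewrite !inE /= => hAB.
have [A0 B0] : 0 <= A /\ 0 <= B.
  by move: hAB; do 7?[case/orP]; move=> /eqP[_ -> ->]; lia.
case/orP: h => h; first by rewrite kostant_neg1 ?mulr0 //; lia.
by rewrite kostant_neg2 ?mulr0 //; lia.
Qed.

Lemma weyl_character p q : m p q = weyl_alt l1 l2 kostant p q.
Proof.
pose d p q := m p q - weyl_alt l1 l2 kostant p q.
have dn p' q' : (p' < 0) || (q' < 0) -> d p' q' = 0.
  by move=> h; rewrite /d m_neg // weyl_alt_kostant_supp // subrr.
have dD p' q' : weyl_diff d p' q' = 0.
  have -> : weyl_diff d p' q' =
      weyl_diff m p' q' - weyl_diff (weyl_alt l1 l2 kostant) p' q'.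
    by rewrite /weyl_diff /d; move: (weyl_alt l1 l2 kostant) => g; ring.
  (* Commuting the operators lets the denominator act on [kostant] first, where it gives [delta]. *)
  rewrite [X in _ - X]weyl_diffE weyl_alt_comm.
  have -> : weyl_alt l1 l2 (weyl_alt 0 0 kostant) p' q' = o p' q'.
    by apply: eq_bigr => c _; rewrite -weyl_diffE kostant_diff.
  exact: defect_eq0.
(* Apart from [d p q], every term of [weyl_diff d p q] has smaller height, so vanishing outside the
   quadrant propagates. *)
suff d0 : d p q = 0 by apply/eqP; rewrite -subr_eq0; apply/eqP.
have [k] : exists k : nat, p + q < k%:Z by exists (absz (p + q)).+1; lia.
elim: k p q => [|k IH] p q pqk; first by apply: dn; lia.
have := dD p q; rewrite /weyl_diff.
rewrite (IH (p - 1) q) ?(IH p (q - 1)) ?(IH (p - 3) (q - 1)) ?(IH (p - 1) (q - 2))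
  ?(IH (p - 4) (q - 2)) ?(IH (p - 3) (q - 3)) ?(IH (p - 4) (q - 3)); try by lia.
by rewrite !(subr0, addr0).
Qed.

End WeylCharacter.

(** * The 33 cones *)

(** Moves the cone conditions to the integers, where [lia] can decide them. *)
Lemma cone_int (R : numDomainType) k (l1 l2 b1 b2 : int) :
  @cone R k l1%:~R l2%:~R b1%:~R b2%:~R = cone k l1 l2 b1 b2.
Proof.
have E (x y : int) (z t : R) : x%:~R = z -> y%:~R = t -> (z <= t) = (x <= y).
  by move=> <- <-; rewrite ler_int.
do 34?[case: k => [|k]] => //; rewrite /cone;
  repeat congr (_ && _);
  by apply: E; rewrite ?(rmorphD, rmorphN, rmorphM, rmorph0).
Qed.

(** Settles the non-dominant weights, for which the multiplicity is zero by convention: no cone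
    contains them. *)
Lemma cone_dominant k (l1 l2 b1 b2 : int) :
  cone k l1 l2 b1 b2 -> (0 <= l1) && (0 <= l2).
Proof. by do 34?[case: k => [|k]] => //; rewrite /cone; lia. Qed.

(* The hypotheses say that the weight and its images under the Weyl group are
   all at most lam, that is, the weight lies in the convex hull of the orbit of lam. *)
Lemma cone_cover (l1 l2 b1 b2 : int) :
    0 <= l1 -> 0 <= l2 -> 0 <= b1 -> 0 <= b2 ->
    0 <= l1 - b1 + 2 * b2 -> 0 <= l2 + b1 - b2 -> 0 <= l1 + l2 - b1 + b2 ->
    0 <= l1 + 2 * l2 + b1 - 2 * b2 -> 0 <= 2 * l1 + 2 * l2 - b1 ->
    0 <= l1 + 2 * l2 - b2 ->
  exists2 k, (1 <= k <= 33)%N & cone k l1 l2 b1 b2.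
Proof.
move=> ? ? ? ? ? ? ? ? ? ?.
(* A decision tree on the signs of the wall equations; the signs along each branch and the
   hypotheses imply the inequalities of the cone at its leaf. *)
case: (lerP 0 (b1 - l1)) => ?; [
   case: (lerP 0 (l1 - b1 + b2)) => ?; [
    case: (lerP 0 (b1 - b2)) => ?; [
     case: (lerP 0 (2 * l2 + b1 - 2 * b2)) => ?; [
      case: (lerP 0 (l1 + 2 * l2 - b1)) => ?; [
       case: (lerP 0 (l1 + l2 - b2)) => ?; [
        case: (lerP 0 (b1 - 2 * b2)) => ?; [
         case: (lerP 0 (l2 - b2)) => ?; [
          by exists 2%N => //; rewrite /cone; lia
         |
          by exists 9%N => //; rewrite /cone; lia]
        |
         case: (lerP 0 (l2 - b2)) => ?; [
          by exists 3%N => //; rewrite /cone; lia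
         |
          by exists 10%N => //; rewrite /cone; lia]]
       |
        by exists 16%N => //; rewrite /cone; lia]
      |
       case: (lerP 0 (l1 + l2 - b2)) => ?; [
        case: (lerP 0 (b1 - 2 * b2)) => ?; [
         by exists 23%N => //; rewrite /cone; lia
        |
         by exists 28%N => //; rewrite /cone; lia]
       |
        by exists 32%N => //; rewrite /cone; lia]]
     |
      case: (lerP 0 (l1 + 2 * l2 - b1)) => ?; [
       case: (lerP 0 (l1 + l2 - b2)) => ?; [
        by exists 24%N => //; rewrite /cone; lia
       |
        by exists 30%N => //; rewrite /cone; lia]
      |
       case: (lerP 0 (l1 + l2 - b2)) => ?; [
        by exists 29%N => //; rewrite /cone; lia
       |
        by exists 33%N => //; rewrite /cone; lia]]]
    |
     case: (lerP 0 (l1 + l2 - b2)) => ?; [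
      case: (lerP 0 (2 * l2 + b1 - 2 * b2)) => ?; [
       case: (lerP 0 (l2 - b2)) => ?; [
        by exists 8%N => //; rewrite /cone; lia
       |
        by exists 15%N => //; rewrite /cone; lia]
      |
       by exists 21%N => //; rewrite /cone; lia]
     |
      case: (lerP 0 (2 * l2 + b1 - 2 * b2)) => ?; [
       by exists 22%N => //; rewrite /cone; lia
      |
       by exists 27%N => //; rewrite /cone; lia]]]
   |
    case: (lerP 0 (l1 + l2 - b2)) => ?; [
     case: (lerP 0 (l1 + 2 * l2 - b1)) => ?; [
      case: (lerP 0 (b1 - 2 * b2)) => ?; [
       case: (lerP 0 (l2 - b2)) => ?; [
        by exists 7%N => //; rewrite /cone; lia
       |
        by exists 14%N => //; rewrite /cone; lia]
      |
       case: (lerP 0 (l2 - b2)) => ?; [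
        by exists 13%N => //; rewrite /cone; lia
       |
        by exists 19%N => //; rewrite /cone; lia]]
     |
      case: (lerP 0 (b1 - 2 * b2)) => ?; [
       by exists 20%N => //; rewrite /cone; lia
      |
       by exists 25%N => //; rewrite /cone; lia]]
    |
     case: (lerP 0 (l1 + 2 * l2 - b1)) => ?; [
      by exists 26%N => //; rewrite /cone; lia
     |
      by exists 31%N => //; rewrite /cone; lia]]]
  |
   case: (lerP 0 (2 * l2 + b1 - 2 * b2)) => ?; [
    case: (lerP 0 (b1 - b2)) => ?; [
     case: (lerP 0 (l2 - b2)) => ?; [
      case: (lerP 0 (b1 - 2 * b2)) => ?; [
       by exists 5%N => //; rewrite /cone; lia
      |
       by exists 1%N => //; rewrite /cone; lia]
     |
      case: (lerP 0 (b1 - 2 * b2)) => ?; [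
       by exists 12%N => //; rewrite /cone; lia
      |
       by exists 6%N => //; rewrite /cone; lia]]
    |
     case: (lerP 0 (l2 - b2)) => ?; [
      by exists 4%N => //; rewrite /cone; lia
     |
      by exists 11%N => //; rewrite /cone; lia]]
   |
    case: (lerP 0 (b1 - b2)) => ?; [
     by exists 18%N => //; rewrite /cone; lia
    |
     by exists 17%N => //; rewrite /cone; lia]]].
Qed.

Lemma weyl_altE l1 l2 (g : int -> int -> rat) p q : weyl_alt l1 l2 g p q =
  g p q - g (p - (l1 + 1)) q - g p (q - (l2 + 1))
  + g (p - (l1 + 2 * l2 + 3)) (q - (l2 + 1)) + g (p - (l1 + 1)) (q - (l1 + l2 + 2))
  - g (p - (2 * l1 + 2 * l2 + 4)) (q - (l1 + l2 + 2))
  - g (p - (l1 + 2 * l2 + 3)) (q - (l1 + 2 * l2 + 3))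
  + g (p - (2 * l1 + 2 * l2 + 4)) (q - (l1 + 2 * l2 + 3)).
Proof.
by rewrite /weyl_alt !big_cons big_nil /= !subr0; ring.
Qed.

Section ConeFormulas.
Variables (l1 l2 p q : int).

(** Reduces all sign factors to the two, [(-1) ^ p] and [(-1) ^ (p + l1)], that occur in
    [quasi_polynomial]. *)
Lemma sign_shift1 : (-1 : rat) ^ (p - (l1 + 1)) = - (-1) ^ (p + l1).
Proof.
have -> : p - (l1 + 1) = p + l1 + 2 * (- l1 - 1) + 1 by ring.
by rewrite !exprN1D exprN1_even mulr1 mulrN1.
Qed.

Lemma sign_shift3 : (-1 : rat) ^ (p - (l1 + 2 * l2 + 3)) = - (-1) ^ (p + l1).
Proof.
have -> : p - (l1 + 2 * l2 + 3) = p + l1 + 2 * (- l1 - l2 - 2) + 1 by ring.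
by rewrite !exprN1D exprN1_even mulr1 mulrN1.
Qed.

(** The arguments name the formula for each of the first five orbit terms. The last three terms
    vanish on every cone, since [p <= 2 * l1 + 2 * l2] and [q <= l1 + 2 * l2] there. Once the signs
    are generalized, a polynomial identity remains. *)
Ltac cone_case c0 c1 c2 c3 c4 :=
  rewrite /cone => hc; rewrite weyl_altE;
  rewrite -> (c0 p q) by lia;
  rewrite -> (c1 (p - (l1 + 1)) q) by lia;
  rewrite -> (c2 p (q - (l2 + 1))) by lia;
  rewrite -> (c3 (p - (l1 + 2 * l2 + 3)) (q - (l2 + 1))) by lia;
  rewrite -> (c4 (p - (l1 + 1)) (q - (l1 + l2 + 2))) by lia;
  rewrite -> (kostant_neg1 (p := p - (2 * l1 + 2 * l2 + 4)) (q - (l1 + l2 + 2))) by lia;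
  rewrite -> (kostant_neg2 (p - (l1 + 2 * l2 + 3)) (q := q - (l1 + 2 * l2 + 3))) by lia;
  rewrite -> (kostant_neg1 (p := p - (2 * l1 + 2 * l2 + 4)) (q - (l1 + 2 * l2 + 3))) by lia;
  rewrite /quasi_polynomial /kpoly1 /kpoly4 /kpoly5 ?sign_shift1 ?sign_shift3;
  cbv zeta; generalize ((-1 : rat) ^ p) ((-1 : rat) ^ (p + l1)) => s t; field.

Lemma cone_formula k : cone k l1 l2 p q ->
  weyl_alt l1 l2 kostant p q = quasi_polynomial k l1 l2 p q.
Proof.
do 34?[case: k => [|k]] => //.
- by cone_case kostant1 kostant_neg1 kostant_neg2 kostant_neg1 kostant_neg2.
- by cone_case kostant5 kostant4 kostant_neg2 kostant_neg1 kostant_neg2.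
- by cone_case kostant1 kostant4 kostant_neg2 kostant_neg1 kostant_neg2.
- by cone_case kostant4 kostant_neg1 kostant_neg2 kostant_neg1 kostant_neg2.
- by cone_case kostant5 kostant_neg1 kostant_neg2 kostant_neg1 kostant_neg2.
- by cone_case kostant1 kostant_neg1 kostant5 kostant_neg1 kostant_neg2.
- by cone_case kostant5 kostant1 kostant_neg2 kostant_neg1 kostant_neg2.
- by cone_case kostant4 kostant4 kostant_neg2 kostant_neg1 kostant_neg2.
- by cone_case kostant5 kostant4 kostant5 kostant_neg1 kostant_neg2.
- by cone_case kostant1 kostant4 kostant5 kostant_neg1 kostant_neg2.
- by cone_case kostant4 kostant_neg1 kostant5 kostant_neg1 kostant_neg2.
- by cone_case kostant5 kostant_neg1 kostant5 kostant_neg1 kostant_neg2.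
- by cone_case kostant1 kostant1 kostant_neg2 kostant_neg1 kostant_neg2.
- by cone_case kostant5 kostant1 kostant5 kostant_neg1 kostant_neg2.
- by cone_case kostant4 kostant4 kostant5 kostant_neg1 kostant_neg2.
- by cone_case kostant1 kostant4 kostant5 kostant_neg1 kostant5.
- by cone_case kostant4 kostant_neg1 kostant1 kostant_neg1 kostant_neg2.
- by cone_case kostant1 kostant_neg1 kostant1 kostant_neg1 kostant_neg2.
- by cone_case kostant1 kostant1 kostant5 kostant_neg1 kostant_neg2.
- by cone_case kostant5 kostant1 kostant5 kostant4 kostant_neg2.
- by cone_case kostant4 kostant4 kostant1 kostant_neg1 kostant_neg2.
- by cone_case kostant4 kostant4 kostant5 kostant_neg1 kostant5.
- by cone_case kostant5 kostant4 kostant5 kostant4 kostant_neg2.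
- by cone_case kostant1 kostant4 kostant1 kostant_neg1 kostant_neg2.
- by cone_case kostant1 kostant1 kostant5 kostant4 kostant_neg2.
- by cone_case kostant1 kostant1 kostant5 kostant_neg1 kostant5.
- by cone_case kostant4 kostant4 kostant1 kostant_neg1 kostant5.
- by cone_case kostant1 kostant4 kostant5 kostant4 kostant_neg2.
- by cone_case kostant1 kostant4 kostant1 kostant4 kostant_neg2.
- by cone_case kostant1 kostant4 kostant1 kostant_neg1 kostant5.
- by cone_case kostant1 kostant1 kostant5 kostant4 kostant5.
- by cone_case kostant1 kostant4 kostant5 kostant4 kostant5.
- by cone_case kostant1 kostant4 kostant1 kostant4 kostant5.
Qed.
End ConeFormulas.

(** Multiplicities are natural numbers, so the relation obtained over the complex field passes
    through [int] to [rat]. *)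
Lemma weyl_diff_natr (R : pzRingType) (f : int -> int -> nat) p q :
  weyl_diff (fun p q => (f p q)%:R : R) p q = (weyl_diff (fun p q => (f p q)%:Z) p q)%:~R.
Proof. by rewrite /weyl_diff !(rmorphB, rmorphD) /= -!pmulrn. Qed.

Lemma weight_multiplicity_cones (C : numClosedFieldType) (M : 'M[C]_5)
    (M_sym : M^T = M) (M_nondeg : M \in unitmx)
    (h : {vspace so5 M}) (h_cartan : is_cartan h)
    (a1 a2 : dual C h) (a_simple : simple_roots a1 a2)
    (a2_long : long_second a1 a2)
    (w1 w2 : dual C h) (w_fund : fundamental_weights a1 a2 w1 w2)
    (l1 l2 : int) (V : vectType C) (rho : 'Hom(so5 M, 'End(V)))
    (V_lam : dominant l1 l2 ->
       irreducible_module rho a1 a2 (w1 *~ l1 + w2 *~ l2))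
    (b1 b2 : int) :
  (forall k, cone k l1 l2 b1 b2 ->
     (weight_multiplicity rho a1 a2 w1 w2 l1 l2 b1 b2)%:R
     = quasi_polynomial k l1 l2 b1 b2)
  /\
  (~ (exists2 k, (1 <= k <= 33)%N & cone k l1 l2 b1 b2) ->
   weight_multiplicity rho a1 a2 w1 w2 l1 l2 b1 b2 = 0%N).
Proof.
rewrite /weight_multiplicity; have [dom|ndom] := boolP (dominant l1 l2); last first.
  split=> // k /cone_dominant dom.
  by rewrite /dominant dom in ndom.
have /andP[l1_ge0 l2_ge0] := dom; have V_irr := V_lam dom.
pose m := wmult a1 a2 w1 w2 l1 l2 rho.
rewrite -/(wmult a1 a2 w1 w2 l1 l2 rho b1 b2) -/(m b1 b2).
have [m00 m_supp [T [T_shift T_sum]]] :=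
  wmult_properties M_sym M_nondeg h_cartan a_simple a2_long w_fund V_irr.
have m_s1 := wmult_reflect1 M_sym M_nondeg h_cartan a_simple a2_long w_fund V_irr.
have m_s2 := wmult_reflect2 M_sym M_nondeg h_cartan a_simple a2_long w_fund V_irr.
rewrite -/m in m00 m_supp T_shift T_sum m_s1 m_s2.
have sphere p q :
    (weyl_form l1 l2 p q)%:~R * weyl_diff (fun p q => (m p q)%:R : rat) p q = 0.
  have /eqP := weyl_form_diff T_shift T_sum p q.
  rewrite weyl_diff_natr -intrM intr_eq0 => /eqP E.
  by rewrite weyl_diff_natr -intrM E.
have mE := @weyl_character l1 l2 (fun p q => (m p q)%:R) l1_ge0 l2_ge0 _ _ _ _ sphere.
have {}mE p q : (m p q)%:R = weyl_alt l1 l2 kostant p q.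
  apply: mE => [p' q'|||]; first by rewrite pnatr_eq0; apply: m_supp.
  - by rewrite m00.
  - by move=> p' q'; rewrite m_s1.
  - by move=> p' q'; rewrite m_s2.
split=> [k ck|ncone]; first by rewrite mE (cone_formula ck).
apply/eqP/negPn/negP => m0; apply: ncone.
(* If the weight occurs, so do its images under alternating words of length up to three in the
   reflections; [m_supp] at these points gives the hypotheses of [cone_cover]. *)
have i1 p q : m p q != 0%N -> m (l1 - p + 2 * q) q != 0%N by rewrite m_s1.
have i2 p q : m p q != 0%N -> m p (l2 + p - q) != 0%N by rewrite m_s2.
have s1 := i1 _ _ m0; have s2 := i2 _ _ m0.
have s12 := i1 _ _ s2; have s21 := i2 _ _ s1.
have s121 := i1 _ _ s21; have s212 := i2 _ _ s12.
move: (m_supp _ _ m0) (m_supp _ _ s1) (m_supp _ _ s2) (m_supp _ _ s12)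
  (m_supp _ _ s21) (m_supp _ _ s121) (m_supp _ _ s212) => *.
by apply: cone_cover; lia.
Qed.

Theorem mainTheorem1 (R : realType) (M : 'M[R[i]]_5)
    (M_sym : M^T = M) (M_nondeg : M \in unitmx)
    (h : {vspace so5 M}) (h_cartan : is_cartan h)
    (a1 a2 : dual R[i] h) (a_simple : simple_roots a1 a2)
    (a2_long : long_second a1 a2)
    (w1 w2 : dual R[i] h) (w_fund : fundamental_weights a1 a2 w1 w2)
    (l1 l2 : int) (V : vectType R[i]) (rho : 'Hom(so5 M, 'End(V)))
    (V_lam : dominant l1 l2 ->
       irreducible_module rho a1 a2 (w1 *~ l1 + w2 *~ l2))
    (b1 b2 : int) :
  (forall k : nat, (1 <= k <= 33)%N ->
     @cone R k l1%:~R l2%:~R b1%:~R b2%:~R ->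
     (weight_multiplicity rho a1 a2 w1 w2 l1 l2 b1 b2)%:R
     = quasi_polynomial k l1 l2 b1 b2)
  /\
  (~ (exists2 k : nat, (1 <= k <= 33)%N
        & @cone R k l1%:~R l2%:~R b1%:~R b2%:~R) ->
   weight_multiplicity rho a1 a2 w1 w2 l1 l2 b1 b2 = 0%N).
Proof.
have [inC outC] := weight_multiplicity_cones M_sym M_nondeg h_cartan a_simple
  a2_long w_fund V_lam b1 b2.
split=> [k _|ncone]; first by rewrite cone_int; apply: inC.
by apply: outC => -[k k33 ck]; apply: ncone; exists k; rewrite ?cone_int.
Qed.
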